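(* Let $k$ be a complete non-Archimedean field and $\Gamma\subseteq\mathrm{PGL}_2(k)$ a Schottky group of rank $g>1$ with limit set $\Lambda_\Gamma$. Let $\mathcal{D}$ be a Schottky figure in $\mathbb{P}^{1,\mathrm{an}}_k$ adapted to a basis $(\gamma_1,\dots,\gamma_g)$ of $\Gamma$, and for $s\in\mathbb{R}_{\geqslant0}$ let $M(s)=M_{\mathcal{D}}(s)$ be the associated $2g\times2g$ matrix and $\lambda(M(s))$ its spectral radius. Then $s=\mathrm{Hdim}\,\Lambda_\Gamma$ if and only if $\lambda(M(s))=1$, where $\mathrm{Hdim}\,\Lambda_\Gamma$ is the Hausdorff dimension of $\Lambda_\Gamma$.
   Context: Let $(k,|\cdot|)$ be a complete non-Archimedean valued field. $\mathbb{P}^{1,\mathrm{an}}_k=\mathbb{A}^{1,\mathrm{an}}_k\cup\{\infty\}$ is the Berkovich projective line, where $\mathbb{A}^{1,\mathrm{an}}_k$ is the set of multiplicative semi-norms on $k[T]$ extending $|\cdot|$ with the coarsest topology making evaluations at polynomials continuous. It is uniquely path-connected, contains $\mathbb{P}^1(k)$, and $\mathrm{PGL}_2(k)$ acts by Möbius transformations. For $a\in k$, $r\geqslant0$, $\eta_{a,r}$ is the semi-norm $\sum a_n(T-a)^n\mapsto\max|a_n|r^n$. Type 1 points are the images of points of $\mathbb{P}^1(K)$, $K$ the completion of an algebraic closure of $k$, under $\mathbb{P}^{1,\mathrm{an}}_K\to\mathbb{P}^{1,\mathrm{an}}_k$. $\mathbb{H}_k$ is the set of points not of type 1, with the $\mathrm{PGL}_2(k)$-invariant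 interval-length metric $\rho$: $\rho(\eta_{a,r},\eta_{b,s})=|\log(r/s)|$ if $\max(r,s)\geqslant|a-b|$, and $|\log(|a-b|/r)|+|\log(|a-b|/s)|$ otherwise ($r,s>0$). $\Gamma\subseteq\mathrm{PGL}_2(k)$ is a Schottky group if it is free and finitely generated, its non-trivial elements are loxodromic (eigenvalues of different absolute values), and it acts freely and properly on some non-empty connected open $\Gamma$-invariant subset of $\mathbb{P}^{1,\mathrm{an}}_k$. Its rank is the minimal number of generators; a minimal generating set is a basis. Its limit set $\Lambda_\Gamma\subseteq\mathbb{P}^1(k)$ is the set of accumulation points of any orbit not reduced to a point. A closed disk is a set $\{|T-a|\leqslant r\}$ ($a\in k$, $r>0$; its boundary is the single point $\eta_{a,r}$) or an image of such a set under $\mathrm{PGL}_2(k)$. A Schottky figure adapted to $(\gamma_1,\dots,\gamma_g)$ is a family of pairwise disjoint closed disks $D_{\gamma_i},D_{\gamma_i^{-1}}$ with maximal open disks $D^\circ_{\gamma_i}\subseteq D_{\gamma_i}$, $D^\circ_{\gamma_i^{-1}}\subseteq D_{\gamma_i^{-1}}$ such that $\gamma_i(\mathbb{P}^{1,\mathrm{an}}_k\setminus D_{\gamma_i^{-1}})=D^\circ_{\gamma_i}$ and $\gamma_i^{-1}(\mathbb{P}^{1,\mathrm{an}}_k\setminus D_{\gamma_i})=D^\circ_{\gamma_i^{-1}}$. Let $\sigma(2i-1)=\gamma_i$, $\sigma(2i)=\gamma_i^{-1}$, $i=1,\dots,g$. $M_{\mathcal{D}}(s)$ has $(j,l)$ entry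 $e^{-s\rho(\partial D_{\sigma(j)^{-1}},\partial D_{\sigma(l)})}$ if $\sigma(j)^{-1}\neq\sigma(l)$ and $0$ otherwise. Hausdorff dimension is for the spherical metric on $\mathbb{P}^1(k)$: $d(x,y)=|x-y|$ if $|x|,|y|\leqslant1$; $d(x,y)=|1/x-1/y|$ if neither is in the closed unit disk; $d(x,y)=1$ otherwise. *)

(* Defs.v *)
From HB Require Import structures.
From mathcomp Require Import all_boot all_order all_algebra.
From mathcomp Require Import generic_quotient fieldext.
From mathcomp Require Import all_classical all_reals all_analysis.
From mathcomp Require Import complex.

Set Implicit Arguments.
Unset Strict Implicit.
Unset Printing Implicit Defensive.

Import Order.TTheory GRing.Theory Num.Theory.
Import numFieldNormedType.Exports.

Local Open Scope classical_set_scope.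
Local Open Scope ring_scope.

Record nonarch_abs (R : realType) (k : fieldType) := NonarchAbs {
  nabs :> k -> R;
  nabs_ge0 : forall x, 0 <= nabs x;
  nabs_eq0 : forall x, (nabs x == 0) = (x == 0);
  nabsM : forall x y, nabs (x * y) = nabs x * nabs y;
  nabsD_max : forall x y, nabs (x + y) <= Num.max (nabs x) (nabs y) }.

Definition complete_abs (R : realType) (k : fieldType) (v : nonarch_abs R k) :=
  forall u : nat -> k,
    (forall e : R, 0 < e ->
      exists N : nat, forall m n, (N <= m)%N -> (N <= n)%N -> v (u m - u n) < e) ->
    exists l : k, forall e : R, 0 < e ->
      exists N : nat, forall n, (N <= n)%N -> v (u n - l) < e.

Section NonarchTheory.
Context {R : realType} {k : fieldType} (v : nonarch_abs R k).

Lemma nabs0 : v 0 = 0.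
Proof. by apply/eqP; rewrite nabs_eq0. Qed.

Lemma nabs1 : v 1 = 1.
Proof.
have n0 : v 1 != 0 by rewrite nabs_eq0 oner_eq0.
by apply: (mulfI n0); rewrite -nabsM !mulr1.
Qed.

Lemma nabsN1 : v (-1) = 1.
Proof.
have /eqP : v (-1) ^+ 2 = 1 by rewrite expr2 -nabsM mulrNN mulr1 nabs1.
rewrite sqrf_eq1 => /orP[/eqP//|/eqP e].
by have := nabs_ge0 v (-1); rewrite e ler0N1.
Qed.

Lemma nabsN x : v (- x) = v x.
Proof. by rewrite -mulN1r nabsM nabsN1 mul1r. Qed.

Lemma nabsV x : v x^-1 = (v x)^-1.
Proof.
have [->|x0] := eqVneq x 0; first by rewrite invr0 nabs0 invr0.
have vx0 : v x != 0 by rewrite nabs_eq0.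
by apply: (mulfI vx0); rewrite -nabsM !divff// nabs1.
Qed.

Lemma nabsX x n : v (x ^+ n) = v x ^+ n.
Proof. by elim: n => [|n IH]; rewrite ?nabs1// !exprS nabsM IH. Qed.

Lemma nabsB_sym x y : v (x - y) = v (y - x).
Proof. by rewrite -nabsN opprB. Qed.

Lemma nabs_sum_le (I : finType) (P : pred I) (F : I -> k) (c : R) : 0 <= c ->
  (forall i, P i -> v (F i) <= c) -> v (\sum_(i | P i) F i) <= c.
Proof.
move=> c0 Fc; elim/big_ind: _ => //; first by rewrite nabs0.
by move=> x y xc yc; rewrite (le_trans (nabsD_max _ _ _))// ge_max xc.
Qed.

Lemma nabsD_dom x y : v y < v x -> v (x + y) = v x.
Proof.
move=> yx; apply/eqP; rewrite eq_le.
have -> /= : v (x + y) <= v x.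
  by rewrite (le_trans (nabsD_max _ _ _))// ge_max lexx ltW.
have := nabsD_max v (x + y) (- y); rewrite addrK nabsN le_max.
by case/orP => // /le_lt_trans/(_ yx); rewrite ltxx.
Qed.

End NonarchTheory.

Section PGL2.
Variable k : fieldType.

Definition GL2 := {M : 'M[k]_2 | M \in unitmx}.

Definition GL2_of (M : 'M[k]_2) (MU : M \in unitmx) : GL2 :=
  exist (fun M => is_true (M \in unitmx)) M MU.

Definition GL2_proportional (M N : GL2) : bool :=
  `[< exists2 c : k, c != 0 & val M = c *: val N >].

Lemma GL2_proportional_refl : reflexive GL2_proportional.
Proof. by move=> M; apply/asboolP; exists 1; rewrite ?oner_eq0// scale1r. Qed.

Lemma GL2_proportional_sym : symmetric GL2_proportional.
Proof.
suff H M N : GL2_proportional M N -> GL2_proportional N M.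
  by move=> M N; apply/idP/idP; apply: H.
move=> /asboolP[c c0 e]; apply/asboolP; exists c^-1; first by rewrite invr_eq0.
by rewrite e scalerA mulVf// scale1r.
Qed.

Lemma GL2_proportional_trans : transitive GL2_proportional.
Proof.
move=> N M P /asboolP[c c0 e] /asboolP[d d0 f].
by apply/asboolP; exists (c * d); rewrite ?mulf_neq0// e f scalerA.
Qed.

Canonical GL2_proportional_equiv :=
  EquivRel GL2_proportional GL2_proportional_refl GL2_proportional_sym
           GL2_proportional_trans.

Definition PGL2 := {eq_quot GL2_proportional}%qT.

HB.instance Definition _ := Choice.on PGL2.
HB.instance Definition _ := EqQuotient.on PGL2.

Definition GL2_one : GL2 := GL2_of (unitmx1 _ _).

Lemma GL2_mul_subproof (M N : GL2) : val M *m val N \in unitmx.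
Proof. by rewrite unitmx_mul (valP M) (valP N). Qed.
Definition GL2_mul (M N : GL2) : GL2 := GL2_of (GL2_mul_subproof M N).

Lemma GL2_inv_subproof (M : GL2) : invmx (val M) \in unitmx.
Proof. by rewrite unitmx_inv (valP M). Qed.
Definition GL2_inv (M : GL2) : GL2 := GL2_of (GL2_inv_subproof M).

Local Open Scope quotient_scope.

Definition PGL2_one : PGL2 := \pi_PGL2 GL2_one.
Definition PGL2_mul (g h : PGL2) : PGL2 := \pi_PGL2 (GL2_mul (repr g) (repr h)).
Definition PGL2_inv (g : PGL2) : PGL2 := \pi_PGL2 (GL2_inv (repr g)).

Lemma PGL2_eqP (M N : GL2) :
  reflect (exists2 c : k, c != 0 & val M = c *: val N)
          (\pi_PGL2 M == \pi_PGL2 N).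
Proof. by rewrite eqmodE; apply: asboolP. Qed.

Lemma repr_proportional (M : GL2) :
  exists2 c : k, c != 0 & val (repr (\pi_PGL2 M)) = c *: val M.
Proof. by apply/PGL2_eqP; rewrite reprK. Qed.

Lemma PGL2_mulE (M N : GL2) :
  PGL2_mul (\pi M) (\pi N) = \pi_PGL2 (GL2_mul M N).
Proof.
apply/eqP/PGL2_eqP => /=.
have [c c0 ->] := repr_proportional M; have [d d0 ->] := repr_proportional N.
exists (c * d); first by rewrite mulf_neq0.
by rewrite -scalemxAl -scalemxAr scalerA.
Qed.

Lemma PGL2_invE (M : GL2) : PGL2_inv (\pi M) = \pi_PGL2 (GL2_inv M).
Proof.
apply/eqP/PGL2_eqP => /=; have [c c0 ->] := repr_proportional M.
exists c^-1; first by rewrite invr_eq0.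
by rewrite invmxZ ?unitmxZ ?unitfE ?(valP M).
Qed.

Lemma PGL2_mulA : associative PGL2_mul.
Proof.
move=> f g h; rewrite -[f]reprK -[g]reprK -[h]reprK !PGL2_mulE.
by congr (\pi_ _ _); apply: val_inj; rewrite /= mulmxA.
Qed.

Lemma PGL2_mul1g : left_id PGL2_one PGL2_mul.
Proof.
move=> g; rewrite -[g]reprK PGL2_mulE.
by congr (\pi_ _ _); apply: val_inj; rewrite /= mul1mx.
Qed.

Lemma PGL2_mulg1 : right_id PGL2_one PGL2_mul.
Proof.
move=> g; rewrite -[g]reprK PGL2_mulE.
by congr (\pi_ _ _); apply: val_inj; rewrite /= mulmx1.
Qed.

Lemma PGL2_mulVg : left_inverse PGL2_one PGL2_inv PGL2_mul.
Proof.
move=> g; rewrite -[g]reprK PGL2_invE PGL2_mulE.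
by congr (\pi_ _ _); apply: val_inj; rewrite /= mulVmx ?(valP (repr g)).
Qed.

Lemma PGL2_mulgV : right_inverse PGL2_one PGL2_inv PGL2_mul.
Proof.
move=> g; rewrite -[g]reprK PGL2_invE PGL2_mulE.
by congr (\pi_ _ _); apply: val_inj; rewrite /= mulmxV ?(valP (repr g)).
Qed.

HB.instance Definition _ := isGroup.Build PGL2
  PGL2_mulA PGL2_mul1g PGL2_mulg1 PGL2_mulVg PGL2_mulgV.

End PGL2.

Record A1an (R : realType) (k : fieldType) (v : nonarch_abs R k) := A1anPoint {
  seminorm :> {poly k} -> R;
  seminorm_ge0 : forall p, 0 <= seminorm p;
  seminormM : forall p q, seminorm (p * q) = seminorm p * seminorm q;
  seminormD : forall p q, seminorm (p + q) <= seminorm p + seminorm q;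
  seminormC : forall c, seminorm c%:P = v c }.

Section A1an.
Context {R : realType} {k : fieldType} (v : nonarch_abs R k).

Lemma A1an_ext (x y : A1an v) : (forall p, x p = y p) -> x = y.
Proof.
case: x y => [x x0 xM xD xC] [y y0 yM yD yC] /= /funext e; subst y.
by congr A1anPoint; exact: Prop_irrelevance.
Qed.

HB.instance Definition _ := gen_eqMixin (A1an v).
HB.instance Definition _ := gen_choiceMixin (A1an v).

HB.instance Definition _ := Topological.copy (A1an v)
  (initial_topology (fun x : A1an v => seminorm x : {ptws {poly k} -> R})).

Lemma seminorm1 (x : A1an v) : x 1 = 1.
Proof. by rewrite -(nabs1 v) -(seminormC x) polyC1. Qed.

Lemma seminormX (x : A1an v) p n : x (p ^+ n) = x p ^+ n.
Proof.
by elim: n => [|n IH]; rewrite ?expr0 ?seminorm1// !exprS seminormM IH.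
Qed.

(* [P1an] is compact Hausdorff and contains [A1an] as the complement of the
   point [None], which stands for infinity, so that its topology is that of the
   one-point compactification. *)
Definition P1an := one_point_compactification (A1an v).

HB.instance Definition _ := Topological.on P1an.
HB.instance Definition _ := Pointed.on P1an.

End A1an.

Section Gauss.
Context {R : realType} {k : fieldType} (v : nonarch_abs R k).

Definition gauss_norm (r : R) (p : {poly k}) : R :=
  \big[Num.max/0]_(i < size p) (v p`_i * r ^+ i).

Variable r : R.
Hypothesis r0 : 0 <= r.
Implicit Types p q : {poly k}.

Lemma gauss_norm_ge0 p : 0 <= gauss_norm r p.
Proof.
rewrite /gauss_norm; elim/big_ind: _ => // [x y x0 y0|i _].
  by rewrite le_max x0.
by rewrite mulr_ge0 ?nabs_ge0 ?exprn_ge0.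
Qed.

Lemma gauss_norm_ge p i : v p`_i * r ^+ i <= gauss_norm r p.
Proof.
have [ip|pi] := ltnP i (size p); last first.
  by rewrite nth_default// nabs0 mul0r gauss_norm_ge0.
by rewrite /gauss_norm (bigD1 (Ordinal ip))//= le_max lexx.
Qed.

Lemma gauss_norm_le p c : 0 <= c -> (forall i, v p`_i * r ^+ i <= c) ->
  gauss_norm r p <= c.
Proof.
move=> c0 pc; rewrite /gauss_norm; elim/big_ind: _ => // x y xc yc.
by rewrite ge_max xc.
Qed.

Lemma gauss_norm_attained p :
  exists2 i, v p`_i * r ^+ i = gauss_norm r p &
    forall j, (j < i)%N -> v p`_j * r ^+ j < gauss_norm r p.
Proof.
have ex : exists i, v p`_i * r ^+ i == gauss_norm r p.
  have [|e] : (exists i, gauss_norm r p = v p`_i * r ^+ i) \/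
      gauss_norm r p = 0.
  - rewrite /gauss_norm; elim/big_ind: _ => [|x y|i _]; first by right.
    + by move=> xP yP; rewrite /Num.max; case: ifP.
    + by left; exists i.
  - by case=> i ->; exists i.
  - by exists (size p); rewrite e nth_default// nabs0 mul0r.
exists (ex_minn ex); case: ex_minnP => i /eqP ip imin // j ji.
rewrite lt_neqAle gauss_norm_ge andbT; apply/negP => /imin.
by rewrite leqNgt ji.
Qed.

Let sum_le (I : finType) (P : pred I) (F : I -> k) (w c : R) :
  0 <= w -> 0 <= c ->
  (forall i, P i -> v (F i) * w <= c) -> v (\sum_(i | P i) F i) * w <= c.
Proof.
move=> w0 c0 Fc; elim/big_ind: _ => //; first by rewrite nabs0 mul0r.
move=> x y xc yc; rewrite (le_trans (ler_wpM2r w0 (nabsD_max _ _ _)))//.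
by rewrite maxr_pMl// ge_max xc.
Qed.

Let sum_lt (I : finType) (P : pred I) (F : I -> k) (w c : R) :
  0 <= w -> 0 < c ->
  (forall i, P i -> v (F i) * w < c) -> v (\sum_(i | P i) F i) * w < c.
Proof.
move=> w0 c0 Fc; elim/big_ind: _ => //; first by rewrite nabs0 mul0r.
move=> x y xc yc; rewrite (le_lt_trans (ler_wpM2r w0 (nabsD_max _ _ _)))//.
by rewrite maxr_pMl// gt_max xc.
Qed.

Lemma gauss_normM p q : gauss_norm r (p * q) = gauss_norm r p * gauss_norm r q.
Proof.
have split_term i j : v (p`_i * q`_j) * r ^+ (i + j) =
    (v p`_i * r ^+ i) * (v q`_j * r ^+ j).
  by rewrite nabsM exprD mulrACA.
apply/eqP; rewrite eq_le; apply/andP; split.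
  apply: gauss_norm_le => [|n]; first by rewrite mulr_ge0 ?gauss_norm_ge0.
  rewrite coefM; apply: sum_le => [||[i /= ilt] _].
  - exact: exprn_ge0.
  - by rewrite mulr_ge0 ?gauss_norm_ge0.
  - rewrite -{2}(subnKC (ltnSE ilt)) split_term.
    by apply: ler_pM; rewrite ?gauss_norm_ge// mulr_ge0 ?nabs_ge0 ?exprn_ge0.
have [/eqP|PQ0] := eqVneq (gauss_norm r p * gauss_norm r q) 0.
  by move=> /eqP ->; exact: gauss_norm_ge0.
have {}PQ0 : 0 < gauss_norm r p * gauss_norm r q.
  by rewrite lt_def PQ0 mulr_ge0 ?gauss_norm_ge0.
have [i ip imin] := gauss_norm_attained p.
have [j jq jmin] := gauss_norm_attained q.
apply: le_trans (gauss_norm_ge (p * q) (i + j)).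
have ilt : (i < (i + j).+1)%N by rewrite ltnS leq_addr.
rewrite coefM (bigD1 (Ordinal ilt))//= addKn.
set x := p`_i * q`_j; set y := \sum_(_ | _) _.
have xE : v x * r ^+ (i + j) = gauss_norm r p * gauss_norm r q.
  by rewrite split_term ip jq.
have w0 : 0 <= r ^+ (i + j) by exact: exprn_ge0.
have Pp : 0 < gauss_norm r p.
  rewrite lt_def gauss_norm_ge0 andbT; apply: contraTneq PQ0 => ->.
  by rewrite mul0r ltxx.
have Qp : 0 < gauss_norm r q.
  rewrite lt_def gauss_norm_ge0 andbT; apply: contraTneq PQ0 => ->.
  by rewrite mulr0 ltxx.
have ylt : v y * r ^+ (i + j) < gauss_norm r p * gauss_norm r q.
  apply: sum_lt => // -[l /= llt]; rewrite -val_eqE /= => li.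
  rewrite -{2}(subnKC (ltnSE llt)) split_term.
  have [{}li|il|e] := ltngtP l i; last by rewrite e eqxx in li.
  - apply: (@le_lt_trans _ _ (v p`_l * r ^+ l * gauss_norm r q)).
      by rewrite ler_wpM2l ?gauss_norm_ge// mulr_ge0 ?nabs_ge0 ?exprn_ge0.
    by rewrite ltr_pM2r// imin.
  - apply: (@le_lt_trans _ _ (gauss_norm r p *
        (v q`_(i + j - l) * r ^+ (i + j - l)))).
      by rewrite ler_wpM2r ?gauss_norm_ge// mulr_ge0 ?nabs_ge0 ?exprn_ge0.
    rewrite ltr_pM2l// jmin// ltn_subLR ?ltn_add2r// -ltnS//.
have yx : v y < v x.
  by rewrite ltNge; apply/negP => /(ler_wpM2r w0); rewrite xE leNgt ylt.
by rewrite nabsD_dom// xE.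
Qed.

Lemma gauss_normD p q :
  gauss_norm r (p + q) <= gauss_norm r p + gauss_norm r q.
Proof.
apply: gauss_norm_le => [|i]; first by rewrite addr_ge0 ?gauss_norm_ge0.
rewrite coefD.
apply: (@le_trans _ _ ((v p`_i + v q`_i) * r ^+ i)); last first.
  by rewrite mulrDl lerD ?gauss_norm_ge.
rewrite ler_wpM2r ?exprn_ge0// (le_trans (nabsD_max _ _ _))//.
by rewrite ge_max lerDl lerDr !nabs_ge0.
Qed.

Lemma gauss_normC c : gauss_norm r c%:P = v c.
Proof.
apply/eqP; rewrite eq_le; apply/andP; split; last first.
  by have := gauss_norm_ge c%:P 0; rewrite coefC eqxx expr0 mulr1.
apply: gauss_norm_le => [|[|i]]; first exact: nabs_ge0.
- by rewrite coefC eqxx expr0 mulr1.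
- by rewrite coefC /= nabs0 mul0r nabs_ge0.
Qed.

End Gauss.

Section Eta.
Context {R : realType} {k : fieldType} (v : nonarch_abs R k).
Variables (a : k) (r : {nonneg R}).

Let eta_fun (p : {poly k}) : R := gauss_norm v r%:num (p \Po ('X + a%:P)).

Let eta_ge0 p : 0 <= eta_fun p.
Proof. exact: gauss_norm_ge0. Qed.

Let etaM p q : eta_fun (p * q) = eta_fun p * eta_fun q.
Proof. by rewrite /eta_fun comp_polyM gauss_normM. Qed.

Let etaD p q : eta_fun (p + q) <= eta_fun p + eta_fun q.
Proof. by rewrite /eta_fun comp_polyD gauss_normD. Qed.

Let etaC c : eta_fun c%:P = v c.
Proof. by rewrite /eta_fun comp_polyC gauss_normC. Qed.

(* The coefficients of [p \Po ('X + a%:P)] are those of [p] in the powers of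
   [T - a]. *)
Definition eta : A1an v := A1anPoint eta_ge0 etaM etaD etaC.

Lemma etaE p : eta p = gauss_norm v r%:num (p \Po ('X + a%:P)).
Proof. by []. Qed.

End Eta.

Lemma eta_subr (R : realType) (k : fieldType) (v : nonarch_abs R k)
    (a b : k) (r : {nonneg R}) :
  eta v a r ('X - b%:P) = Num.max (v (a - b)) r%:num.
Proof.
have r0 : 0 <= r%:num by [].
rewrite etaE comp_polyB comp_polyX comp_polyC -addrA -polyCB.
apply/eqP; rewrite eq_le; apply/andP; split.
  apply: gauss_norm_le => [|[|[|i]]]; first by rewrite le_max nabs_ge0.
  - by rewrite coefD coefX coefC /= add0r expr0 mulr1 le_max lexx.
  - by rewrite coefD coefX coefC /= addr0 nabs1 mul1r expr1 le_max lexx orbT.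
  - by rewrite coefD coefX coefC /= addr0 nabs0 mul0r le_max nabs_ge0.
rewrite ge_max; apply/andP; split.
  have := @gauss_norm_ge _ _ v r%:num r0 ('X + (a - b)%:P) 0.
  by rewrite coefD coefX coefC /= add0r expr0 mulr1.
have := @gauss_norm_ge _ _ v r%:num r0 ('X + (a - b)%:P) 1.
by rewrite coefD coefX coefC /= addr0 nabs1 mul1r expr1.
Qed.
Section Moebius.
Context {R : realType} {k : fieldType} (v : nonarch_abs R k).
Implicit Types (M N : 'M[k]_2) (p q : {poly k}) (x : A1an v).

Definition moebius_num M : {poly k} := M 0 0 *: 'X + (M 0 1)%:P.
Definition moebius_den M : {poly k} := M 1 0 *: 'X + (M 1 1)%:P.

(* For [size p <= n.+1] this is the polynomial
   [den ^+ n * p.[num / den]]. *)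
Definition moebius_homog M (n : nat) p : {poly k} :=
  \sum_(i < n.+1) p`_i *: (moebius_num M ^+ i * moebius_den M ^+ (n - i)).

Lemma moebius_homogE M n p : moebius_den M != 0 -> (size p <= n.+1)%N ->
  tofrac (moebius_homog M n p) = tofrac (moebius_den M) ^+ n *
    (map_poly (@tofrac {poly k} \o polyC) p).[
      tofrac (moebius_num M) / tofrac (moebius_den M)].
Proof.
move=> d0 pn; have D0 : tofrac (moebius_den M) != 0 by rewrite tofrac_eq0.
rewrite (@horner_coef_wide _ n.+1) ?(leq_trans (size_poly _ _))//.
rewrite /moebius_homog rmorph_sum mulr_sumr; apply: eq_bigr => -[i /= ilt] _.
rewrite coef_map /= -mul_polyC !rmorphM !rmorphXn /= exprMn.
rewrite [RHS]mulrCA; congr (_ * _); rewrite [RHS]mulrCA; congr (_ * _).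
by rewrite -{2}(subnK (ltnSE ilt)) exprD -mulrA -exprMn divff// expr1n mulr1.
Qed.

Let size_mul_bound m n p q : (size p <= m.+1)%N -> (size q <= n.+1)%N ->
  (size (p * q)%R <= (m + n).+1)%N.
Proof.
move=> pm qn; rewrite (leq_trans (size_polyMleq _ _))//.
by have := leq_add pm qn; rewrite addSn addnS; case: (size p + size q)%N.
Qed.

Lemma moebius_homogM M m n p q : moebius_den M != 0 ->
  (size p <= m.+1)%N -> (size q <= n.+1)%N ->
  moebius_homog M (m + n) (p * q) = moebius_homog M m p * moebius_homog M n q.
Proof.
move=> d0 pm qn; apply/eqP; rewrite -tofrac_eq rmorphM /= !moebius_homogE//.
  by rewrite rmorphM hornerM exprD mulrACA.
exact: size_mul_bound.
Qed.

Lemma moebius_homogD M n p q :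
  moebius_homog M n (p + q) = moebius_homog M n p + moebius_homog M n q.
Proof.
rewrite /moebius_homog -big_split; apply: eq_bigr => i _.
by rewrite coefD scalerDl.
Qed.

Lemma moebius_homogS M m n p : moebius_den M != 0 ->
  (size p <= m.+1)%N -> (m <= n)%N ->
  moebius_homog M n p = moebius_den M ^+ (n - m) * moebius_homog M m p.
Proof.
move=> d0 pm mn; apply/eqP; rewrite -tofrac_eq rmorphM rmorphXn /=.
rewrite !moebius_homogE// ?(leq_trans pm)// mulrA -exprD subnK//.
Qed.

Section Affine.
Variables (M : 'M[k]_2) (x : A1an v).
Hypothesis xd0 : x (moebius_den M) <> 0.

Let D0 : x (moebius_den M) != 0. Proof. exact/eqP. Qed.

Let d0 : moebius_den M != 0.
Proof. by apply: contra_neq D0 => ->; rewrite seminormC nabs0. Qed.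

Let moebius_fun p : R :=
  x (moebius_homog M (size p).-1 p) / x (moebius_den M) ^+ (size p).-1.

Let moebius_funE n p : (size p <= n.+1)%N ->
  moebius_fun p = x (moebius_homog M n p) / x (moebius_den M) ^+ n.
Proof.
move=> pn; have sp : (size p <= (size p).-1.+1)%N by case: size.
have le : ((size p).-1 <= n)%N by case: size pn.
rewrite (moebius_homogS d0 sp le) seminormM seminormX /moebius_fun.
rewrite -{2}(subnK le) exprD invfM mulrACA divff ?expf_neq0// mul1r//.
Qed.

Let moebius_fun_ge0 p : 0 <= moebius_fun p.
Proof. by rewrite divr_ge0 ?exprn_ge0 ?seminorm_ge0. Qed.

Let moebius_funM p q : moebius_fun (p * q) = moebius_fun p * moebius_fun q.
Proof.
have sp : (size p <= (size p).-1.+1)%N by case: size.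
have sq : (size q <= (size q).-1.+1)%N by case: size.
rewrite (@moebius_funE ((size p).-1 + (size q).-1)).
  by rewrite moebius_homogM// seminormM exprD invfM mulrACA.
exact: size_mul_bound.
Qed.

Let moebius_funD p q : moebius_fun (p + q) <= moebius_fun p + moebius_fun q.
Proof.
pose n := maxn (size p) (size q).
have spq : (size (p + q)%R <= n.+1)%N by exact/leqW/size_polyD.
rewrite !(@moebius_funE n)//; last 2 first.
- exact/leqW/leq_maxr.
- exact/leqW/leq_maxl.
rewrite moebius_homogD -mulrDl ler_wpM2r ?seminormD//.
by rewrite invr_ge0 exprn_ge0 ?seminorm_ge0.
Qed.

Let moebius_funC c : moebius_fun c%:P = v c.
Proof.
rewrite (@moebius_funE 0) ?size_polyC_leq1// expr0 divr1 -(seminormC x).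
by rewrite /moebius_homog big_ord1 coefC eqxx !expr0 mulr1 alg_polyC.
Qed.

(* The semi-norm [p |-> |p ((a T + b) / (c T + d))|_x]. *)
Definition moebius_A1an : A1an v :=
  A1anPoint moebius_fun_ge0 moebius_funM moebius_funD moebius_funC.

Lemma moebius_A1anE n p : (size p <= n.+1)%N ->
  moebius_A1an p = x (moebius_homog M n p) / x (moebius_den M) ^+ n.
Proof. exact: moebius_funE. Qed.

End Affine.

Definition moebius M (z : P1an v) : P1an v :=
  match z with
  | Some x =>
    match @eqP _ (x (moebius_den M)) 0 with
    | ReflectT _ => None
    | ReflectF xd0 => Some (moebius_A1an xd0)
    end
  | None =>
    if M 1 0 == 0 then None else Some (eta v (M 0 0 / M 1 0) 0%:nng)
  end.

Lemma moebius_infty M x : x (moebius_den M) = 0 -> moebius M (Some x) = None.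
Proof. by rewrite /moebius; case: eqP. Qed.

Lemma moebius_affine M x (xd0 : x (moebius_den M) <> 0) :
  moebius M (Some x) = Some (moebius_A1an xd0).
Proof.
rewrite /moebius; case: eqP => // xd0'; congr Some.
exact: A1an_ext.
Qed.

Lemma moebiusZ (c : k) M : c != 0 -> moebius (c *: M) =1 moebius M.
Proof.
move=> c0 [x|]; last first.
  by rewrite /= !mxE mulf_eq0 (negPf c0)/= -mulf_div divff// mul1r.
have numZ : moebius_num (c *: M) = c *: moebius_num M.
  by rewrite /moebius_num !mxE scalerDr scalerA -!mul_polyC !polyCM.
have denZ : moebius_den (c *: M) = c *: moebius_den M.
  by rewrite /moebius_den !mxE scalerDr scalerA -!mul_polyC !polyCM.
have xdenZ : x (moebius_den (c *: M)) = v c * x (moebius_den M).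
  by rewrite denZ -mul_polyC seminormM seminormC.
have vc0 : v c != 0 by rewrite nabs_eq0.
have [e|/eqP xd0] := eqVneq (x (moebius_den M)) 0.
  by rewrite !moebius_infty// xdenZ e mulr0.
have xcd0 : x (moebius_den (c *: M)) <> 0.
  by apply/eqP; rewrite xdenZ mulf_neq0//; exact/eqP.
rewrite (moebius_affine xd0) (moebius_affine xcd0); congr Some.
apply: A1an_ext => p; have sp : (size p <= (size p).+1)%N by [].
rewrite !(moebius_A1anE _ sp) xdenZ; set n := size p.
have -> : moebius_homog (c *: M) n p = c ^+ n *: moebius_homog M n p.
  rewrite /moebius_homog scaler_sumr; apply: eq_bigr => -[i /= ilt] _.
  rewrite numZ denZ !exprZn -scalerAl -scalerAr !scalerA -mulrA -exprD.
  by rewrite (subnKC (ltnSE ilt)) mulrC.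
rewrite -mul_polyC seminormM seminormC nabsX exprMn invfM mulrACA.
by rewrite divff ?mul1r// expf_neq0.
Qed.

Definition PGL2_act (g : PGL2 k) : P1an v -> P1an v := moebius (val (repr g)).

Lemma PGL2_actE (M : GL2 k) :
  PGL2_act (\pi_(PGL2 k) M)%qT = moebius (val M).
Proof.
apply/funext => z; rewrite /PGL2_act.
by have [c c0 ->] := repr_proportional M; exact: moebiusZ.
Qed.

End Moebius.

Section Disks.
Context {R : realType} {k : fieldType} (v : nonarch_abs R k).

Definition affine_closed_disk (a : k) (r : R) : set (P1an v) :=
  [set Some x | x in [set x : A1an v | x ('X - a%:P) <= r]].

Definition affine_open_disk (a : k) (r : R) : set (P1an v) :=
  [set Some x | x in [set x : A1an v | x ('X - a%:P) < r]].

Definition closed_disk (D : set (P1an v)) :=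
  exists (h : PGL2 k) (a : k) (r : R),
    0 < r /\ D = PGL2_act h @` affine_closed_disk a r.

Definition open_disk (D : set (P1an v)) :=
  exists (h : PGL2 k) (a : k) (r : R),
    0 < r /\ D = PGL2_act h @` affine_open_disk a r.

Definition maximal_open_disk (E D : set (P1an v)) :=
  [/\ open_disk E, E `<=` D &
      forall F, open_disk F -> E `<=` F -> F `<=` D -> F = E].

(* The topological boundary of a closed disk has exactly one element. *)
Definition bdry_point (D : set (P1an v)) : P1an v :=
  get (closure D `\` interior D).

Definition eta_dist (a : k) (r : R) (b : k) (s : R) : R :=
  if v (a - b) <= Num.max r s then `|ln (r / s)|
  else `|ln (v (a - b) / r)| + `|ln (v (a - b) / s)|.

Definition eta_params (z : P1an v) : k * {nonneg R} :=
  xget (0, 0%:nng) [set p | 0 < p.2%:num /\ z = Some (eta v p.1 p.2)].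

(* The interval-length metric at the points [eta_{a,r}] with [a] in [k] and
   [0 < r], see [rho_eta]; these are the only points of the hyperbolic part that
   occur as boundaries of closed disks. Elsewhere the value is meaningless. *)
Definition rho (z w : P1an v) : R :=
  eta_dist (eta_params z).1 (eta_params z).2%:num
           (eta_params w).1 (eta_params w).2%:num.

Lemma eta_eq (a b : k) (r s : {nonneg R}) :
  eta v a r = eta v b s -> r = s /\ v (a - b) <= r%:num.
Proof.
move=> e.
have H c : Num.max (v (a - c)) r%:num = Num.max (v (b - c)) s%:num.
  by rewrite -!eta_subr e.
have ea : r%:num = Num.max (v (a - b)) s%:num.
  by have := H a; rewrite subrr nabs0 (max_idPr _)// nabsB_sym.
have eb : Num.max (v (a - b)) r%:num = s%:num.
  by have := H b; rewrite subrr nabs0 => ->; rewrite (max_idPr _).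
split; last by rewrite ea le_max lexx.
apply/val_inj/eqP; rewrite eq_le /=; apply/andP; split.
  by rewrite -eb le_max lexx orbT.
by rewrite ea le_max lexx orbT.
Qed.

Lemma eta_distC a r b s : 0 < r -> 0 < s -> eta_dist a r b s = eta_dist b s a r.
Proof.
move=> r0 s0; rewrite /eta_dist nabsB_sym maxC; case: ifP => _; last by rewrite addrC.
by rewrite -[s / r]invf_div lnV ?normrN// posrE divr_gt0.
Qed.

Lemma eta_params_spec a (r : {nonneg R}) : 0 < r%:num ->
  (eta_params (Some (eta v a r))).2 = r /\
  v ((eta_params (Some (eta v a r))).1 - a) <= r%:num.
Proof.
move=> r0; rewrite /eta_params; case: xgetP => [p _|/(_ (a, r))[]//].
by move=> [_ /Some_inj/esym/eta_eq[<-]].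
Qed.

Lemma rho_eta a b (r s : {nonneg R}) : 0 < r%:num -> 0 < s%:num ->
  rho (Some (eta v a r)) (Some (eta v b s)) = eta_dist a r%:num b s%:num.
Proof.
have H a' a1 b1 (r1 s1 : R) : v (a' - a1) <= r1 ->
    eta_dist a' r1 b1 s1 = eta_dist a1 r1 b1 s1.
  move=> a'a1; rewrite /eta_dist.
  have E : a' - b1 = (a1 - b1) + (a' - a1) by rewrite [RHS]addrC addrA subrK.
  have [le|lt] := leP (v (a1 - b1)) (Num.max r1 s1).
    suff -> : v (a' - b1) <= Num.max r1 s1 by [].
    by rewrite E (le_trans (nabsD_max _ _ _))// ge_max le le_max a'a1.
  suff -> : v (a' - b1) = v (a1 - b1) by rewrite leNgt lt.
  rewrite E nabsD_dom// (le_lt_trans a'a1)// (le_lt_trans _ lt)//.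
  by rewrite le_max lexx.
move=> r0 s0; rewrite /rho.
have [-> ra] := eta_params_spec a r0; have [-> sb] := eta_params_spec b s0.
by rewrite (H _ _ _ _ _ ra) eta_distC// (H _ _ _ _ _ sb) eta_distC.
Qed.

End Disks.

Section Groups.
Variable G : groupType.
Local Open Scope group_scope.

Definition subgroup (H : set G) :=
  [/\ H 1, (forall g h, H g -> H h -> H (g * h)) & (forall g, H g -> H g^-1)].

Definition generates n (gamma : 'I_n -> G) (H : set G) :=
  H = smallest subgroup (range gamma).

(* The letter [(i, false)] stands for [gamma i], and [(i, true)] for its
   inverse. *)
Definition letter n (gamma : 'I_n -> G) (l : 'I_n * bool) : G :=
  if l.2 then (gamma l.1)^-1 else gamma l.1.

Definition reduced n : pred (seq ('I_n * bool)) :=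
  sorted (fun l m => m != (l.1, ~~ l.2)).

Definition free_family n (gamma : 'I_n -> G) :=
  forall w, reduced w -> w != [::] -> \prod_(l <- w) letter gamma l != 1.

Definition free_fingen (H : set G) :=
  exists n (gamma : 'I_n -> G), generates gamma H /\ free_family gamma.

Definition group_rank (H : set G) (n : nat) :=
  (exists gamma : 'I_n -> G, generates gamma H) /\
  (forall m (gamma : 'I_m -> G), generates gamma H -> (n <= m)%N).

Definition group_basis (H : set G) n (gamma : 'I_n -> G) :=
  generates gamma H /\ group_rank H n.

End Groups.

Section Schottky.
Context {R : realType} {k : fieldType} (v : nonarch_abs R k).

(* The eigenvalues may only exist in an extension [L] of [k]; when [k] is
   complete, [w] is the only extension of [v] to [L]. *)
Definition loxodromic (h : PGL2 k) :=
  exists (L : fieldExtType k) (w : nonarch_abs R L),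
    (forall c : k, w c%:A = v c) /\
    exists x y : L,
      let M := map_mx (in_alg L) (val (repr h)) in
      [/\ eigenvalue M x, eigenvalue M y & w x != w y].

Definition stable_set (Gamma : set (PGL2 k)) (U : set (P1an v)) :=
  forall h, Gamma h -> PGL2_act h @` U = U.

Definition acts_freely (Gamma : set (PGL2 k)) (U : set (P1an v)) :=
  forall h z, Gamma h -> U z -> PGL2_act h z = z -> h = 1%g.

(* Properness for a discrete group, as [U] is locally compact and Hausdorff. *)
Definition acts_properly (Gamma : set (PGL2 k)) (U : set (P1an v)) :=
  forall C : set (P1an v), compact C -> C `<=` U ->
    finite_set [set h | Gamma h /\ (PGL2_act h @` C) `&` C !=set0].

Definition schottky_group (Gamma : set (PGL2 k)) :=
  [/\ subgroup Gamma,
      free_fingen Gamma,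
      (forall h, Gamma h -> h != 1%g -> loxodromic h) &
      exists U : set (P1an v),
        [/\ U !=set0, connected U, open U & stable_set Gamma U] /\
        (acts_freely Gamma U /\ acts_properly Gamma U)].

Definition orbit_of (Gamma : set (PGL2 k)) (z : P1an v) : set (P1an v) :=
  [set PGL2_act h z | h in Gamma].

(* For a Schottky group the accumulation points do not depend on the choice of
   an orbit not reduced to a point. *)
Definition limit_set (Gamma : set (PGL2 k)) : set (P1an v) :=
  [set z | exists x, orbit_of Gamma x <> [set x] /\
                     limit_point (orbit_of Gamma x) z].

(* [D h] is the disk attached to [h], for [h] one of the [gamma i] or of their
   inverses; its values elsewhere are irrelevant. *)
Definition schottky_figure n (gamma : 'I_n -> PGL2 k)
    (D : PGL2 k -> set (P1an v)) :=
  let S := range (letter gamma) in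
  [/\ forall h, S h -> closed_disk (D h),
      forall h h', S h -> S h' -> h != h' -> D h `&` D h' = set0 &
      exists E : PGL2 k -> set (P1an v),
        forall h, S h ->
          maximal_open_disk (E h) (D h) /\
          PGL2_act h @` (~` D (h^-1)%g) = E h].

Lemma half_ord_subproof n (j : 'I_n.*2) : (j./2 < n)%N.
Proof. by rewrite ltn_half_double. Qed.

Definition half_ord n (j : 'I_n.*2) : 'I_n := Ordinal (half_ord_subproof j).

(* Indices start at 0: [sigma (2 * i)] is [gamma i] and [sigma (2 * i + 1)] its
   inverse. *)
Definition sigma n (gamma : 'I_n -> PGL2 k) (j : 'I_n.*2) : PGL2 k :=
  letter gamma (half_ord j, odd j).

Definition schottky_matrix n (gamma : 'I_n -> PGL2 k)
    (D : PGL2 k -> set (P1an v)) (s : R) : 'M[R]_n.*2 :=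
  \matrix_(j, l)
    if (sigma gamma j)^-1%g == sigma gamma l then 0 else
    expR (- s * rho (bdry_point (D (sigma gamma j)^-1%g))
                    (bdry_point (D (sigma gamma l)))).

End Schottky.

Definition spectral_radius (R : realType) n (A : 'M[R]_n) : R :=
  sup [set Normc.normc z | z in
    [set z : R[i] | eigenvalue (map_mx (real_complex R) A) z]].

Section Hausdorff.
Context {R : realType} {X : Type} (d : X -> X -> R).
Local Open Scope ereal_scope.

Definition diameter (U : set X) : \bar R :=
  ereal_sup [set (d x y)%:E | x in U & y in U].

(* The empty set contributes 0, also when [s] is 0. *)
Definition hausdorff_gauge (s : R) (U : set X) : \bar R :=
  if U == set0 then 0 else poweR (diameter U) s.

Definition hausdorff_premeasure (s delta : R) (A : set X) : \bar R :=
  ereal_inf [set \sum_(n <oo) hausdorff_gauge s (U n) | U in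
    [set U : nat -> set X |
      A `<=` \bigcup_n U n /\ forall n, diameter (U n) <= delta%:E]].

Definition hausdorff_measure (s : R) (A : set X) : \bar R :=
  ereal_sup [set hausdorff_premeasure s delta A | delta in
    [set delta : R | (0 < delta)%R]].

Definition hausdorff_dim (A : set X) : \bar R :=
  ereal_inf [set s%:E | s in
    [set s : R | (0 <= s)%R /\ hausdorff_measure s A = 0]].

End Hausdorff.

Section P1.
Context {R : realType} {k : fieldType} (v : nonarch_abs R k).

(* [None] is the point at infinity. *)
Definition P1 := option k.

Definition P1_an (z : P1) : P1an v :=
  if z is Some a then Some (eta v a 0%:nng) else None.

(* The coordinate [1/z], only meaningful for [z] outside the unit disk. *)
Definition P1_inv (z : P1) : k := if z is Some a then a^-1 else 0.

(* Only meaningful on the unit disk. *)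
Definition P1_val (z : P1) : k := if z is Some a then a else 0.

Definition in_unit_disk (z : P1) : bool :=
  if z is Some a then v a <= 1 else false.

Definition spherical_dist (z w : P1) : R :=
  if in_unit_disk z && in_unit_disk w then v (P1_val z - P1_val w)
  else if ~~ in_unit_disk z && ~~ in_unit_disk w then v (P1_inv z - P1_inv w)
  else 1.

End P1.

(* Main.v *)
Require Import Defs.
From mathcomp Require Import all_boot all_order all_algebra.
From mathcomp Require Import generic_quotient fieldext complex.
From mathcomp Require Import all_classical all_reals all_analysis.
From mathcomp Require Import ring lra.

Set Implicit Arguments.
Unset Strict Implicit.
Unset Printing Implicit Defensive.

Import Order.TTheory GRing.Theory Num.Theory.
Import numFieldNormedType.Exports.

Local Open Scope classical_set_scope.
Local Open Scope ring_scope.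

(** The disks [D_w] attached to the reduced words [w] are nested along the tree of
    words, and [rho] is Moebius invariant, so that as soon as infinity is not in
    [D_w] the radius of [D_w] is, up to a constant depending on the first letter,
    [exp (- l)] with [l] the sum of the distances [rho (D_(a^-1), D_b)] over
    consecutive letters [a], [b] of [w]. The sums of [diam (D_w) ^ s] over words
    of length [n] are thus governed by the powers of [M s]. Let [u > 0] be the
    Perron eigenvector of [M s], with eigenvalue the spectral radius. If
    [M s u <= u] then the covers by the [D_w] show that the [t]-dimensional measure
    vanishes for [t > s]; if [u <= M s u] then [exp (- s l) u_b], with [b] the last
    letter of [w], is a mass on words which cannot be exhausted by a cover of small
    total gauge. Perturbing [s] while keeping [u] handles the strict
    inequalities. *)

(** * Moebius action on the Berkovich line *)

(** The obstacle throughout is infinity: a disk of the figure, or a Moebius image of a disk, may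
    contain it, and then it has no radius. Two devices deal with this. Points are tested by
    homogeneous evaluations, which are equivariant up to a scalar and treat infinity like any other
    point; the composition law, the images of disks and the invariance of [rho] are obtained in this
    form. Radii are read only from words whose first letter has a disk avoiding infinity. At most
    one disk contains infinity, and [g > 1] leaves at least four letters, so every letter has an
    admissible predecessor of this kind. The same room among the letters makes the square of [M s]
    positive, which is what the Perron argument uses. Since [k] is not assumed locally compact, the
    lower bound does not extract a finite cover from a countable one. A deficit of mass is followed
    down the tree along a single ray, and completeness of [k] turns this ray into a point of the
    limit set that the cover misses. Only inequalities between [u] and [M s u] enter the two
    estimates, and these survive a small change of [s] when the eigenvalue differs from 1. *)

Section HomogeneousEvaluation.
Context {R : realType} {k : fieldType} {v : nonarch_abs R k}.
Implicit Types (x : A1an v) (z : P1an v) (p q : {poly k}) (M N : 'M[k]_2).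

Lemma nabs_natr_le1 n : v n%:R <= 1.
Proof.
elim: n => [|n IH]; first by rewrite nabs0.
by rewrite -natr1 (le_trans (nabsD_max _ _ _))// ge_max IH nabs1 lexx.
Qed.

Lemma seminorm0 x : x 0 = 0.
Proof. by rewrite -polyC0 seminormC nabs0. Qed.

Lemma seminormZ x c p : x (c *: p) = v c * x p.
Proof. by rewrite -mul_polyC seminormM seminormC. Qed.

Lemma seminormN x p : x (- p) = x p.
Proof. by rewrite -scaleN1r seminormZ nabsN1 mul1r. Qed.

Lemma seminorm_sum_le x (I : finType) (F : I -> {poly k}) :
  x (\sum_i F i) <= \sum_i x (F i).
Proof.
elim/big_rec2: _ => [|i y1 y2 _ IH]; first by rewrite seminorm0.
by rewrite (le_trans (seminormD _ _ _))// lerD2l.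
Qed.

(** Binomial coefficients have absolute value at most 1, so the only loss against the ultrametric
    inequality is the number of terms, which is linear in [n]. *)
Lemma seminorm_expD_le x p q n :
  x (p + q) ^+ n <= n.+1%:R * Num.max (x p) (x q) ^+ n.
Proof.
rewrite -seminormX exprDn (le_trans (seminorm_sum_le _ _))//.
have -> : n.+1%:R * Num.max (x p) (x q) ^+ n =
          \sum_(i < n.+1) Num.max (x p) (x q) ^+ n.
  by rewrite sumr_const card_ord mulr_natl.
have m0 : 0 <= Num.max (x p) (x q) by rewrite le_max seminorm_ge0.
apply: ler_sum => -[i /= ilt] _.
rewrite -scaler_nat seminormZ seminormM !seminormX.
rewrite -[leRHS]mul1r ler_pM ?nabs_ge0 ?mulr_ge0 ?exprn_ge0 ?seminorm_ge0//.
  exact: nabs_natr_le1.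
have -> : Num.max (x p) (x q) ^+ n =
    Num.max (x p) (x q) ^+ (n - i) * Num.max (x p) (x q) ^+ i.
  by rewrite -exprD (subnK (ltnSE ilt)).
rewrite ler_pM ?exprn_ge0 ?seminorm_ge0//.
  by rewrite lerXn2r ?nnegrE ?seminorm_ge0// le_max lexx.
by rewrite lerXn2r ?nnegrE ?seminorm_ge0// le_max lexx orbT.
Qed.

(* Apply subadditivity to large powers of [p + q]. *)
Lemma seminormD_max x p q : x (p + q) <= Num.max (x p) (x q).
Proof.
rewrite leNgt; apply/negP; set m := Num.max _ _ => mlt.
have m0 : 0 <= m by rewrite le_max seminorm_ge0.
have [mE|mn0] := eqVneq m 0.
  have := seminorm_expD_le x p q 1; rewrite expr1 -/m mE expr1 mulr0.
  by rewrite leNgt -mE mlt.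
have {}m0 : 0 < m by rewrite lt_def mn0.
pose h := x (p + q) / m - 1.
have h0 : 0 < h by rewrite subr_gt0 ltr_pdivlMr// mul1r.
have xE : x (p + q) = (1 + h) * m by rewrite /h addrCA subrr addr0 divfK
  ?gt_eqF.
have bern n : 1 + n%:R * h <= (1 + h) ^+ n.
  elim: n => [|n IH]; first by rewrite mul0r addr0.
  rewrite exprS -natr1; apply: le_trans (ler_wpM2l _ IH); last lra.
  have : 0 <= n%:R * h ^+ 2 by rewrite mulr_ge0 ?sqr_ge0.
  by rewrite expr2; lra.
(* Bernoulli's inequality alone grows linearly, like the number of terms. Its square at exponent
   [n * 2] wins: [n h ^ 2 > 2] gives [(1 + n h) ^ 2 > 2 n + 1]. *)
pose n := (Num.truncn (2 / h ^+ 2)).+1.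
have nh : 2 < n%:R * h ^+ 2.
  rewrite -ltr_pdivrMr ?exprn_gt0//.
  by have /andP[_] := truncn_itv (ltW (divr_gt0 (ltr0Sn R 1) (exprn_gt0 2 h0))).
have n1 : 1 <= n%:R :> R by rewrite ler1n.
have := seminorm_expD_le x p q (n * 2); rewrite -/m xE exprMn.
rewrite ler_pM2r ?exprn_gt0// exprM.
have : (1 + n%:R * h) ^+ 2 <= ((1 + h) ^+ n) ^+ 2.
  have nh0 : 0 < n%:R * h by rewrite mulr_gt0// ltr0n.
  by rewrite lerXn2r ?nnegrE ?exprn_ge0//; lra.
move=> /le_trans/[apply]; rewrite -natr1 natrM.
move: nh n1 h0; set N := n%:R => nh n1 h0; apply/negP; rewrite -ltNge.
have : 0 < N * h by apply: mulr_gt0 => //; lra.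
have : 2 * N <= N * (N * h ^+ 2) by rewrite mulrC ler_wpM2l//; lra.
rewrite !expr2; lra.
Qed.

Lemma seminormD_dom x p q : x q < x p -> x (p + q) = x p.
Proof.
move=> qp; apply/eqP; rewrite eq_le.
have -> /= : x (p + q) <= x p.
  by rewrite (le_trans (seminormD_max _ _ _))// ge_max lexx ltW.
have := seminormD_max x (p + q) (- q); rewrite addrK seminormN le_max.
by case/orP => // /le_lt_trans/(_ qp); rewrite ltxx.
Qed.

(* The absolute value at [z] of the degree-[n] homogenization of [p]. *)
Definition hev z n p : R := if z is Some x then x p else v p`_n.

Lemma hev_ge0 z n p : 0 <= hev z n p.
Proof. by case: z => [x|] /=; rewrite ?seminorm_ge0 ?nabs_ge0. Qed.

Lemma hevD z n p q : hev z n (p + q) <= Num.max (hev z n p) (hev z n q).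
Proof.
by case: z => [x|] /=; rewrite ?seminormD_max// coefD nabsD_max.
Qed.

Lemma hevZ z n c p : hev z n (c *: p) = v c * hev z n p.
Proof. by case: z => [x|] /=; rewrite ?seminormZ// coefZ nabsM. Qed.

Lemma hevN z n p : hev z n (- p) = hev z n p.
Proof. by rewrite -scaleN1r hevZ nabsN1 mul1r. Qed.

Lemma hev_dom z n p q : hev z n q < hev z n p -> hev z n (p + q) = hev z n p.
Proof.
by case: z => [x|] /=; [exact: seminormD_dom | rewrite coefD; exact: nabsD_dom].
Qed.

Lemma size_mul_le m n p q : (size p <= m.+1)%N -> (size q <= n.+1)%N ->
  (size (p * q)%R <= (m + n).+1)%N.
Proof.
move=> pm qn; rewrite (leq_trans (size_polyMleq _ _))//.
by have := leq_add pm qn; rewrite addSn addnS; case: (size p + size q)%N.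
Qed.

Lemma size_exp_le m n p : (size p <= m.+1)%N ->
  (size (p ^+ n)%R <= (n * m).+1)%N.
Proof.
move=> pm; elim: n => [|n IH]; first by rewrite expr0 size_poly1.
by rewrite exprS mulSn size_mul_le.
Qed.

Lemma coefM_top m n p q : (size p <= m.+1)%N -> (size q <= n.+1)%N ->
  (p * q)`_(m + n) = p`_m * q`_n.
Proof.
move=> pm qn; have mlt : (m < (m + n).+1)%N by rewrite ltnS leq_addr.
rewrite coefM (bigD1 (Ordinal mlt))//= addKn big1 ?addr0// => -[i /= ilt].
rewrite -val_eqE /= => im; have [im'|mi] := ltnP m i.
  by rewrite nth_default ?mul0r// (leq_trans pm).
rewrite [q`_ _]nth_default ?mulr0// (leq_trans qn)//.
have {im}mi : (i < m)%N by rewrite ltn_neqAle im.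
by rewrite ltn_subRL ltn_add2r.
Qed.

Lemma hevM z m n p q : (size p <= m.+1)%N -> (size q <= n.+1)%N ->
  hev z (m + n) (p * q) = hev z m p * hev z n q.
Proof.
move=> pm qn; case: z => [x|] /=; first by rewrite seminormM.
by rewrite coefM_top// nabsM.
Qed.

Lemma hevX z n p : (size p <= 2)%N -> hev z n (p ^+ n) = hev z 1 p ^+ n.
Proof.
move=> p2; elim: n => [|n IH].
  case: z => [x|] /=; first by rewrite !expr0 seminorm1.
  by rewrite !expr0 coef1 nabs1.
rewrite !exprS -IH -add1n hevM//.
by rewrite (leq_trans (size_exp_le n p2))// muln1.
Qed.

Lemma hev_sum_le z n (I : finType) (F : I -> {poly k}) (c : R) : 0 <= c ->
  (forall i, hev z n (F i) <= c) -> hev z n (\sum_i F i) <= c.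
Proof.
move=> c0 Fc; elim/big_ind: _ => //.
  by case: z {Fc} => [x|] /=; rewrite ?seminorm0 ?coef0 ?nabs0.
by move=> p q pc qc; rewrite (le_trans (hevD _ _ _ _))// ge_max pc.
Qed.

(** Homogeneous evaluations are meaningful only up to a factor [c ^ n]. The constant 1 in degree 1
    vanishes exactly at infinity, which separates infinity from affine points and forces [c = 1]
    between two affine points. *)
Lemma P1an_ext z z' (c : R) : c != 0 ->
  (forall n p, (size p <= n.+1)%N -> hev z' n p * c ^+ n = hev z n p) -> z' = z.
Proof.
move=> c0 H; case: z z' H => [x|] [y|] //= H.
- have c1 : c = 1.
    have := H 1 1; rewrite size_poly1 => /(_ isT).
    by rewrite !seminorm1 mul1r expr1.
  congr Some; apply: A1an_ext => p.
  have <- := H (size p) p (leqnSn _).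
  by rewrite c1 expr1n mulr1.
- have := H 1 1; rewrite size_poly1 => /(_ isT).
  by rewrite seminorm1 coef1/= nabs0 mul0r => /esym/eqP; rewrite oner_eq0.
- have := H 1 1; rewrite size_poly1 => /(_ isT).
  by rewrite seminorm1 coef1/= nabs0 mul1r expr1 => /eqP; rewrite (negPf c0).
Qed.

Lemma eta0E a p : eta v a 0%:nng p = v p.[a].
Proof.
have -> : p.[a] = (p \Po ('X + a%:P))`_0.
  by rewrite -horner_coef0 horner_comp !hornerE.
rewrite etaE; apply/eqP; rewrite eq_le; apply/andP; split; last first.
  by have := @gauss_norm_ge _ _ v 0 (lexx _) (p \Po ('X + a%:P)) 0;
    rewrite expr0 mulr1.
apply: gauss_norm_le => [|[|i]]; rewrite ?nabs_ge0//= ?expr0 ?mulr1//.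
by rewrite exprS mul0r mulr0 nabs_ge0.
Qed.

Section MoebiusAction.
Variable M : 'M[k]_2.
Hypothesis MU : M \in unitmx.

Lemma mx2_det : M 0 0 * M 1 1 - M 0 1 * M 1 0 != 0.
Proof.
move: MU; rewrite unitmxE unitfE (expand_det_row _ 0) !big_ord_recl big_ord0.
rewrite /cofactor !det_mx11 !mxE /= expr0 expr1 mul1r mulN1r addr0.
have -> : lift 0 0 = 1 :> 'I_2 by exact: val_inj.
have -> : lift 1 0 = 0 :> 'I_2 by exact: val_inj.
by rewrite mulrN.
Qed.

Lemma size_moebius_num : (size (moebius_num M) <= 2)%N.
Proof.
rewrite /moebius_num (leq_trans (size_polyD _ _))// geq_max.
by rewrite (leq_trans (size_scale_leq _ _)) ?size_polyX// (leq_trans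
  (size_polyC_leq1 _)).
Qed.

Lemma size_moebius_den : (size (moebius_den M) <= 2)%N.
Proof.
rewrite /moebius_den (leq_trans (size_polyD _ _))// geq_max.
by rewrite (leq_trans (size_scale_leq _ _)) ?size_polyX// (leq_trans
  (size_polyC_leq1 _)).
Qed.

(** The constant is the evaluation of the denominator at [z], or of the numerator when the
    denominator vanishes there. All branches of the definition of [moebius] are merged into this one
    rule. *)
Lemma hev_moebius z : exists2 c : R, 0 < c &
  forall n p, (size p <= n.+1)%N ->
    hev (moebius M z) n p * c ^+ n = hev z n (moebius_homog M n p).
Proof.
have d0 := mx2_det.
case: z => [x|].
  have [xd|/eqP xd] := eqVneq (x (moebius_den M)) 0; last first.
    exists (x (moebius_den M)).
      by rewrite lt_def seminorm_ge0 andbT; apply/eqP.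
    move=> n p pn; rewrite (moebius_affine xd) /hev (moebius_A1anE xd pn)
      divfK//.
    by rewrite expf_neq0//; apply/eqP.
  (* This combination is the constant [- det M], so the numerator and the denominator cannot both
     vanish at [x]. *)
  have numE : x (M 1 0 *: moebius_num M - M 0 0 *: moebius_den M) =
              v (M 0 0 * M 1 1 - M 0 1 * M 1 0).
    rewrite -(seminormC x) -[LHS]seminormN; congr (x _).
    rewrite /moebius_num /moebius_den -!mul_polyC !polyCB !polyCM; ring.
  have n0 : 0 < x (moebius_num M).
    rewrite lt_def seminorm_ge0 andbT; apply/eqP => xn.
    have := seminormD_max x (M 1 0 *: moebius_num M) (- (M 0 0 *: moebius_den
      M)).
    rewrite numE seminormN !seminormZ xn xd !mulr0 maxxx => h.
    by move: d0; rewrite -(nabs_eq0 v) eq_le h nabs_ge0.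
  exists (x (moebius_num M)) => // n p pn; rewrite moebius_infty//=.
  rewrite /moebius_homog big_ord_recr /= subnn expr0 mulr1 addrC.
  set S := \sum_(_ < n) _; have S0 : x S = 0.
    apply/eqP; rewrite /S; rewrite eq_le seminorm_ge0 andbT.
    rewrite (le_trans (seminorm_sum_le _ _))// big1// => i _.
    rewrite seminormZ seminormM !seminormX xd expr0n subn_eq0 leqNgt ltn_ord /=.
    by rewrite !mulr0.
  have TE : x (p`_n *: moebius_num M ^+ n) = v p`_n * x (moebius_num M) ^+ n.
    by rewrite seminormZ seminormX.
  have [pn0|pn0] := eqVneq p`_n 0.
    by rewrite pn0 scale0r add0r S0 nabs0 mul0r.
  have lt : x S < x (p`_n *: moebius_num M ^+ n).
    by rewrite S0 TE mulr_gt0 ?exprn_gt0// lt_def nabs_ge0 nabs_eq0 pn0.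
  by rewrite (seminormD_dom lt) TE.
have num1 : (moebius_num M)`_1 = M 0 0.
  by rewrite coefD coefZ coefX coefC /= addr0 mulr1.
have den1 : (moebius_den M)`_1 = M 1 0.
  by rewrite coefD coefZ coefX coefC /= addr0 mulr1.
have homE n p : (moebius_homog M n p)`_n =
    \sum_(i < n.+1) p`_i * (M 0 0 ^+ i * M 1 0 ^+ (n - i)).
  rewrite /moebius_homog coef_sum; apply: eq_bigr => -[i /= ilt] _.
  have topX (r : {poly k}) m : (size r <= 2)%N -> (r ^+ m)`_m = r`_1 ^+ m.
    move=> r2; elim: m => [|m IHm]; first by rewrite !expr0 coef1.
    rewrite !exprS -IHm -[in LHS]add1n coefM_top//.
    by rewrite (leq_trans (size_exp_le _ r2))// muln1.
  rewrite coefZ -{2}(subnKC (ltnSE ilt)) coefM_top.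
  - by rewrite (topX _ _ size_moebius_num) (topX _ _ size_moebius_den) num1
    den1.
  - by rewrite (leq_trans (size_exp_le _ size_moebius_num))// muln1.
  - by rewrite (leq_trans (size_exp_le _ size_moebius_den))// muln1.
have [c0|c0] := eqVneq (M 1 0) 0.
  have a0 : M 0 0 != 0 by move: d0; rewrite c0 mulr0 subr0 mulf_eq0 => /norP[].
  exists (v (M 0 0)); first by rewrite lt_def nabs_ge0 nabs_eq0 a0.
  move=> n p pn; rewrite /= c0 eqxx /= homE big_ord_recr /= big1 ?add0r.
    by rewrite subnn expr0 mulr1 nabsM nabsX.
  by move=> i _; rewrite c0 expr0n subn_eq0 leqNgt ltn_ord /= !mulr0.
exists (v (M 1 0)); first by rewrite lt_def nabs_ge0 nabs_eq0 c0.
have -> : moebius M None = Some (eta v (M 0 0 / M 1 0) 0%:nng)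
  by rewrite /= (negPf c0).
move=> n p pn; rewrite /hev eta0E homE -nabsX -nabsM; congr (v _).
rewrite (horner_coef_wide _ pn) mulr_suml; apply: eq_bigr => -[i /= ilt] _.
rewrite -mulrA; congr (_ * _); rewrite -{1}(subnKC (ltnSE ilt)) exprD.
by rewrite mulrA -exprMn divfK.
Qed.

End MoebiusAction.

Lemma size_moebius_homog M n p : (size (moebius_homog M n p) <= n.+1)%N.
Proof.
rewrite /moebius_homog (leq_trans (size_sum _ _ _))//; apply/bigmax_leqP =>
  -[i /= ilt] _.
rewrite (leq_trans (size_scale_leq _ _))// -(subnKC (ltnSE ilt)) size_mul_le//.
  by rewrite (leq_trans (size_exp_le _ (size_moebius_num M)))// muln1.
by rewrite (leq_trans (size_exp_le _ (size_moebius_den M)))// muln1 addKn.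
Qed.

Lemma moebius_den_neq0 M : M \in unitmx -> moebius_den M != 0.
Proof.
move=> /mx2_det; apply: contra_neq => d0.
have d1 : M 1 0 = 0.
  have := congr1 (fun q : {poly k} => q`_1) d0.
  by rewrite /moebius_den coefD coefZ coefX coefC coef0 /= mulr1 addr0.
have d2 : M 1 1 = 0.
  have := congr1 (fun q : {poly k} => q`_0) d0.
  by rewrite /moebius_den coefD coefZ coefX coefC coef0 /= mulr0 add0r.
by rewrite d1 d2 !mulr0 subr0.
Qed.

Lemma moebius_homogZ M n c p :
  moebius_homog M n (c *: p) = c *: moebius_homog M n p.
Proof.
rewrite /moebius_homog scaler_sumr; apply: eq_bigr => i _.
by rewrite coefZ scalerA.
Qed.

Lemma moebius_homog_sum M n (I : finType) (F : I -> {poly k}) :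
  moebius_homog M n (\sum_i F i) = \sum_i moebius_homog M n (F i).
Proof.
elim/big_rec2: _ => [|i y1 y2 _ <-]; last by rewrite moebius_homogD.
by rewrite /moebius_homog big1// => i _; rewrite coef0 scale0r.
Qed.

Lemma moebius_homog_exp M n p : M \in unitmx -> (size p <= 2)%N ->
  moebius_homog M n (p ^+ n) = moebius_homog M 1 p ^+ n.
Proof.
move=> MU p2; elim: n => [|n IH].
  by rewrite !expr0 /moebius_homog big_ord1 coef1 /= scale1r !expr0 mulr1.
rewrite !exprS -IH -add1n moebius_homogM ?moebius_den_neq0//.
by rewrite (leq_trans (size_exp_le _ p2))// muln1.
Qed.

Lemma moebius_homog1 M p : moebius_homog M 1 p =
  p`_0 *: moebius_den M + p`_1 *: moebius_num M.
Proof.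
by rewrite /moebius_homog !big_ord_recr big_ord0 /= !expr0 !expr1 mul1r mulr1
  add0r.
Qed.

(** On the two linear forms [moebius_num M] and [moebius_den M] this is the matrix product;
    linearity and multiplicativity extend it to all degrees. *)
Lemma moebius_homog_comp M N n p : M \in unitmx -> N \in unitmx ->
  (size p <= n.+1)%N ->
  moebius_homog N n (moebius_homog M n p) = moebius_homog (M *m N) n p.
Proof.
move=> MU NU pn.
have lin : moebius_homog N 1 (moebius_num M) = moebius_num (M *m N) /\
           moebius_homog N 1 (moebius_den M) = moebius_den (M *m N).
  rewrite !moebius_homog1 !coefD !coefZ !coefX !coefC /=.
  rewrite /moebius_num /moebius_den !mxE !big_ord_recl !big_ord0.
  rewrite /= !mulr0 !mulr1 !add0r !addr0.
  have -> : lift ord0 ord0 = 1 :> 'I_2 by apply: val_inj.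
  rewrite -!mul_polyC !polyCD !polyCM; split; ring.
rewrite {2}/moebius_homog moebius_homog_sum; apply: eq_bigr => -[i /= ilt] _.
rewrite moebius_homogZ; congr (_ *: _); rewrite -{1}(subnKC (ltnSE ilt)).
rewrite moebius_homogM ?moebius_den_neq0//.
- rewrite (@moebius_homog_exp N i (moebius_num M) NU (size_moebius_num M)).
  rewrite (@moebius_homog_exp N (n - i) (moebius_den M) NU (size_moebius_den
    M)).
  by case: lin => -> ->.
- by rewrite (leq_trans (size_exp_le _ (size_moebius_num M)))// muln1.
- by rewrite (leq_trans (size_exp_le _ (size_moebius_den M)))// muln1.
Qed.

Lemma moebius_comp M N z : M \in unitmx -> N \in unitmx ->
  moebius M (moebius N z) = moebius (M *m N) z.
Proof.
move=> MU NU; have MNU : M *m N \in unitmx by rewrite unitmx_mul MU.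
have [c c0 cE] := hev_moebius NU z.
have [d d0 dE] := hev_moebius MU (moebius N z).
have [e e0 eE] := hev_moebius MNU z.
apply: (@P1an_ext _ _ (d * c / e)).
  by rewrite !mulf_neq0 ?invr_eq0 ?gt_eqF.
move=> n p pn; rewrite expr_div_n exprMn !mulrA dE// cE ?size_moebius_homog//.
by rewrite moebius_homog_comp// -eE// mulfK// expf_neq0// gt_eqF.
Qed.

Lemma moebius_homog_id n p : (size p <= n.+1)%N ->
  moebius_homog (1%:M : 'M[k]_2) n p = p.
Proof.
move=> pn; transitivity (\poly_(i < n.+1) p`_i).
  rewrite poly_def /moebius_homog; apply: eq_bigr => i _.
  rewrite /moebius_num /moebius_den !mxE /= scale1r scale0r addr0 add0r.
  by rewrite expr1n mulr1.
apply/polyP => i; rewrite coef_poly; case: ltnP => // ni.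
by rewrite nth_default// (leq_trans pn).
Qed.

Lemma moebius1 z : moebius (1%:M : 'M[k]_2) z = z.
Proof.
have [c c0 cE] := hev_moebius (unitmx1 k 2) z.
apply: (@P1an_ext _ _ c); first by rewrite gt_eqF.
by move=> n p pn; rewrite cE// moebius_homog_id.
Qed.

End HomogeneousEvaluation.

Section PGL2Action.
Context {R : realType} {k : fieldType} {v : nonarch_abs R k}.
Implicit Types (g h : PGL2 k) (z : P1an v).

Lemma PGL2_actM g h z : PGL2_act (g * h)%g z = PGL2_act g (PGL2_act h z).
Proof.
rewrite -[g]reprK -[h]reprK [X in PGL2_act X](_ : _ = \pi_(PGL2 k) (GL2_mul
  (repr g) (repr h)))%qT.
  by rewrite !PGL2_actE moebius_comp ?(valP (repr g)) ?(valP (repr h)).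
exact: PGL2_mulE.
Qed.

Lemma PGL2_act1 z : PGL2_act 1%g z = z.
Proof.
by rewrite [X in PGL2_act X](_ : _ = \pi_(PGL2 k)%qT (GL2_one k))// PGL2_actE
  moebius1.
Qed.

Lemma PGL2_actK g : cancel (@PGL2_act _ _ v g) (PGL2_act g^-1%g).
Proof. by move=> z; rewrite -PGL2_actM mulVg PGL2_act1. Qed.

Lemma PGL2_actKV g : cancel (@PGL2_act _ _ v g^-1%g) (PGL2_act g).
Proof. by move=> z; rewrite -PGL2_actM mulgV PGL2_act1. Qed.

Lemma PGL2_act_inj g : injective (@PGL2_act _ _ v g).
Proof. exact: can_inj (PGL2_actK g). Qed.

Lemma PGL2_act_imageE g (A : set (P1an v)) z :
  (PGL2_act g @` A) z <-> A (PGL2_act g^-1%g z).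
Proof.
split=> [[y Ay <-]|Az]; first by rewrite PGL2_actK.
by exists (PGL2_act g^-1%g z) => //; rewrite PGL2_actKV.
Qed.

Lemma PGL2_act_imageM g h (A : set (P1an v)) :
  PGL2_act (g * h)%g @` A = PGL2_act g @` (PGL2_act h @` A).
Proof.
rewrite eqEsubset; split=> [z [y Ay <-]|z [_ [y Ay <-] <-]].
  by rewrite PGL2_actM; exists (PGL2_act h y) => //; exists y.
by exists y => //; rewrite PGL2_actM.
Qed.

Lemma PGL2_act_imageC g (A : set (P1an v)) :
  PGL2_act g @` (~` A) = ~` (PGL2_act g @` A).
Proof.
apply/seteqP; split=> [z /PGL2_act_imageE nA /PGL2_act_imageE //|z nA].
by apply/PGL2_act_imageE => Az; apply/nA/PGL2_act_imageE.
Qed.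

Lemma PGL2_act_imageK g (A : set (P1an v)) :
  PGL2_act g^-1%g @` (PGL2_act g @` A) = A.
Proof.
apply/seteqP; split=> z.
  by move=> /PGL2_act_imageE/PGL2_act_imageE; rewrite invgK PGL2_actK.
by move=> Az; apply/PGL2_act_imageE/PGL2_act_imageE; rewrite invgK PGL2_actK.
Qed.

End PGL2Action.

(** * Topology of the Berkovich line and boundaries of disks *)

Lemma fmap_ultra (T U : Type) (f : T -> U) (F : set_system T) :
  UltraFilter F -> UltraFilter (f @ F).
Proof.
move=> FU; have FP : ProperFilter F by exact: ultra_proper.
split; first exact: fmap_proper_filter.
move=> G GP FG; apply/seteqP; split=> [A GA|A /FG//].
have [//|FnA] := in_ultra_setVsetC (f @^-1` A) FU.
have GnA : G (~` A) by exact: FG.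
by have /filter_ex [? []] : G (A `&` ~` A) by exact: filterI.
Qed.

Lemma ptws_cvg (I : Type) (V : topologicalType) (F : set_system (I -> V))
    (f : I -> V) : Filter F ->
  (forall t, (fun g : I -> V => g t) @ F --> f t) -> {ptws, F --> f}.
Proof.
move=> FF H; apply/cvg_sup => t A [B [[W oW <-] /= Wf] BA].
by apply: filterS BA _; apply: (H t); apply: open_nbhs_nbhs.
Qed.

Section A1anTopology.
Context {R : realType} {k : fieldType} {v : nonarch_abs R k}.
Implicit Types (x y : A1an v) (z : P1an v) (p q : {poly k}).

Lemma A1an_cvgP (F : set_system (A1an v)) x : Filter F ->
  (forall p, (fun y : A1an v => y p) @ F --> x p) -> F --> x.
Proof.
move=> FF H A [B [[V oV <-] /= Vx] BA].
apply: filterS BA _.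
have : {ptws, (fun y : A1an v => seminorm y : {ptws {poly k} -> R}) @ F -->
  seminorm x}.
  by apply: ptws_cvg => p; exact: H.
by apply; apply: open_nbhs_nbhs.
Qed.

Lemma eval_continuous p : continuous (fun y : A1an v => y p).
Proof.
move=> x.
have c : (fun y : A1an v => seminorm y : {ptws {poly k} -> R}) @ x -->
    (seminorm x : {ptws {poly k} -> R}).
  exact: (@initial_continuous (A1an v) {ptws {poly k} -> R} (fun y =>
    seminorm y)).
exact: (cvg_comp (fun y : A1an v => seminorm y : {ptws {poly k} -> R}) (proj p)
  c
  (@proj_continuous {poly k} (fun=> R) p (seminorm x))).
Qed.

Lemma open_eval_lt p c : open [set x : A1an v | x p < c].
Proof.
have -> : [set x : A1an v | x p < c] = (fun y : A1an v =>
  y p) @^-1` [set t | t < c] by [].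
by apply: open_comp => [x _|]; [exact: eval_continuous|exact: open_lt].
Qed.

Lemma open_eval_gt p c : open [set x : A1an v | c < x p].
Proof.
have -> : [set x : A1an v | c < x p] = (fun y : A1an v =>
  y p) @^-1` [set t | c < t] by [].
by apply: open_comp => [x _|]; [exact: eval_continuous|exact: open_gt].
Qed.

Lemma A1an_hausdorff : hausdorff_space (A1an v).
Proof.
move=> x y cl; apply: A1an_ext => p; apply/eqP; rewrite eq_le; apply/andP.
suff H x' y' : cluster (nbhs x') y' -> x' p <= y' p.
  split; apply: H => // A B yA xB; have [z [zB zA]] := cl B A xB yA;
    by exists z.
move=> cl'; rewrite leNgt; apply/negP => lt.
have nx : nbhs x' [set z : A1an v | (x' p + y' p) / 2 < z p].
  by apply: open_nbhs_nbhs; split; [exact: open_eval_gt|rewrite /=; lra].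
have ny : nbhs y' [set z : A1an v | z p < (x' p + y' p) / 2].
  by apply: open_nbhs_nbhs; split; [exact: open_eval_lt|rewrite /=; lra].
have [z [/=]] := cl' _ _ nx ny.
by move=> /= /lt_trans/[apply]; rewrite ltxx.
Qed.

Lemma poly_shiftK (a : k) p : (p \Po ('X + a%:P)) \Po ('X - a%:P) = p.
Proof.
by rewrite -comp_polyA comp_polyD comp_polyX comp_polyC subrK comp_polyXr.
Qed.

Lemma poly_taylor (a : k) n p : (size p <= n.+1)%N ->
  p = \sum_(i < n.+1) (p \Po ('X + a%:P))`_i *: ('X - a%:P) ^+ i.
Proof.
move=> pn; rewrite -{1}(poly_shiftK a p); set q := p \Po _.
have qn : (size q <= n.+1)%N.
  rewrite /q; have [->|p0] := eqVneq p 0; first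
    by rewrite comp_poly0 size_poly0.
  rewrite size_comp_poly2// size_XaddC//.
rewrite comp_polyE (big_ord_widen n.+1 (fun i => q`_i *: ('X - a%:P) ^+ i))//.
rewrite big_mkcond; apply: eq_bigr => i _; case: ifPn => //; rewrite -leqNgt =>
  qi.
by rewrite nth_default// scale0r.
Qed.

Lemma eta_XsubC (a : k) (r : {nonneg R}) : eta v a r ('X - a%:P) = r%:num.
Proof. by rewrite eta_subr subrr nabs0; apply/max_idPr. Qed.

(** By Taylor expansion at [a], the point [eta v a r] is the largest seminorm on the closed disk.
    This maximality later characterizes the boundary point algebraically. *)
Lemma le_eta (a : k) (r : {nonneg R}) x p :
  x ('X - a%:P) <= r%:num -> x p <= eta v a r p.
Proof.
move=> xr; rewrite {1}(poly_taylor a (leqnSn (size p))).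
have := @hev_sum_le _ _ _ (Some x) 0 'I_(size p).+1
  (fun i => (p \Po ('X + a%:P))`_i *: ('X - a%:P) ^+ i) (eta v a r p)
  (seminorm_ge0 _ _); apply => i /=.
rewrite seminormZ seminormX.
apply: le_trans (gauss_norm_ge v (ge0 r) _ i).
by rewrite ler_wpM2l ?nabs_ge0// lerXn2r ?nnegrE ?seminorm_ge0.
Qed.

Lemma eta_center (a b : k) (r : {nonneg R}) :
  v (a - b) <= r%:num -> eta v a r = eta v b r.
Proof.
move=> ab; apply: A1an_ext => p; apply/eqP; rewrite eq_le; apply/andP; split.
  by apply: le_eta; rewrite eta_subr ge_max ab /=.
by apply: le_eta; rewrite eta_subr ge_max nabsB_sym ab /=.
Qed.

(** Along an ultrafilter every evaluation stays in a segment, by [le_eta], hence converges; the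
    axioms of a multiplicative seminorm pass to the limit. *)
Lemma compact_A1an_disk (a : k) (r : R) :
  compact [set x : A1an v | x ('X - a%:P) <= r].
Proof.
have [r0|r0] := ltP r 0.
  suff -> : [set x : A1an v | x ('X - a%:P) <= r] = set0 by exact: compact0.
  by apply/seteqP; split=> // x /= /le_lt_trans/(_ r0);
    rewrite ltNge seminorm_ge0.
rewrite compact_ultra => F FU FA.
have FP : ProperFilter F by exact: ultra_proper.
pose r' := NngNum r0.
have bnd p : exists l : R,
    (fun y : A1an v => y p) @ F --> l.
  have := @segment_compact R 0 (eta v a r' p); rewrite compact_ultra.
  move=> /(_ ((fun y : A1an v => y p) @ F)).
  have U : UltraFilter ((fun y : A1an v => y p) @ F) by exact: fmap_ultra.
  move=> /(_ U); case; last by move=> l [_ lc]; exists l.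
  apply: (@filterS _ F _ _ _ _ FA) => x xr; rewrite /= in_itv.
  by apply/andP; split; [exact: seminorm_ge0|exact: (@le_eta a r')].
have [L LP] := choice bnd.
have L0 p : 0 <= L p.
  by apply: (cvgr_to_ge (LP p)); apply: nearW => y; exact: seminorm_ge0.
have LM p q : L (p * q) = L p * L q.
  apply: (cvg_unique (@Rhausdorff R) (LP _)).
  apply: cvg_trans (cvgM (LP p) (LP q)); apply: near_eq_cvg.
  by apply: nearW => y /=; rewrite seminormM.
have LD p q : L (p + q) <= L p + L q.
  apply: (ler_cvg_to (LP _) (cvgD (LP p) (LP q))).
  by apply: nearW => y /=; rewrite seminormD.
have LC c : L c%:P = v c.
  apply: (cvg_unique (@Rhausdorff R) (LP _)).
  rewrite (_ : (fun y : A1an v => y c%:P) = fun=> v c); first exact: cvg_cst.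
  by apply/funext => y; rewrite seminormC.
exists (A1anPoint L0 LM LD LC); split; last exact: A1an_cvgP.
by apply: (cvgr_to_le (LP _)); exact: FA.
Qed.

Lemma closed_A1an_disk (a : k) (r : R) :
  closed [set x : A1an v | x ('X - a%:P) <= r].
Proof.
have -> : [set x : A1an v | x ('X - a%:P) <= r] =
    ~` [set x : A1an v | r < x ('X - a%:P)].
  by apply/seteqP; split=> x /=; [move=> h; apply/negP;
    rewrite -leNgt|move/negP; rewrite -leNgt].
by apply: open_closedC; exact: open_eval_gt.
Qed.

Lemma A1an_locally_compact : locally_compact [set: A1an v].
Proof.
move=> x _; exists [set y : A1an v | y 'X <= x 'X + 1].
  rewrite withinET; apply: (filterS (P := [set y : A1an v | y 'X < x 'X + 1])).
    by move=> y /= /ltW.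
  apply: open_nbhs_nbhs; split; first exact: open_eval_lt.
  by rewrite /= ltrDl.
have -> : [set y : A1an v | y 'X <= x 'X + 1] = [set y : A1an v | y ('X - 0%:P)
  <= x 'X + 1].
  by rewrite polyC0 subr0.
by split; [exact: compact_A1an_disk|exact: closed_A1an_disk].
Qed.

Lemma P1an_hausdorff : hausdorff_space (P1an v).
Proof.
apply: one_point_compactification_hausdorff.
  exact: A1an_locally_compact.
exact: A1an_hausdorff.
Qed.

(** * Affine disks and their topological boundary *)

Lemma affine_closed_diskE (a : k) (r : R) z :
  affine_closed_disk a r z <-> hev z 1 ('X - a%:P) <= r * hev z 1 1.
Proof.
case: z => [x|] /=.
  by rewrite seminorm1 mulr1; split=> [[y yr /Some_inj <-]|xr]; [|exists x].
rewrite coefB coefX coefC coef1 /= subr0 nabs1 nabs0 mulr0 ler10.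
by split=> // -[].
Qed.

Lemma affine_open_diskE (a : k) (r : R) z : 0 < r ->
  affine_open_disk a r z <-> hev z 1 ('X - a%:P) < r * hev z 1 1.
Proof.
move=> r0; case: z => [x|] /=.
  by rewrite seminorm1 mulr1; split=> [[y yr /Some_inj <-]|xr]; [|exists x].
rewrite coefB coefX coefC coef1 /= subr0 nabs1 nabs0 mulr0 ltr10.
by split=> // -[].
Qed.

Lemma open_affine_open_disk (a : k) (r : R) : open (affine_open_disk a r : set
  (P1an v)).
Proof.
by apply: one_point_compactification_open_some; exact: open_eval_lt.
Qed.

Lemma closed_affine_closed_disk (a : k) (r : R) :
  closed (affine_closed_disk a r : set (P1an v)).
Proof.
apply: (compact_closed P1an_hausdorff).
apply: continuous_compact; last exact: compact_A1an_disk.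
apply: continuous_subspaceT => x.
exact: one_point_compactification_some_continuous.
Qed.

Lemma seminorm_sum_lt x (I : finType) (F : I -> {poly k}) (c : R) : 0 < c ->
  (forall i, x (F i) < c) -> x (\sum_i F i) < c.
Proof.
move=> c0 Fc; elim/big_ind: _ => //; first by rewrite seminorm0.
by move=> p q pc qc; rewrite (le_lt_trans (seminormD_max _ _ _))// gt_max pc.
Qed.

Lemma seminorm_comp_lt x (a : k) q (c : R) : 0 < c ->
  (forall i, v q`_i * x ('X - a%:P) ^+ i < c) -> x (q \Po ('X - a%:P)) < c.
Proof.
move=> c0 qc; rewrite comp_polyE; apply: seminorm_sum_lt => // i.
by rewrite seminormZ seminormX.
Qed.

Lemma eta_comp (a : k) (r : {nonneg R}) q :
  eta v a r (q \Po ('X - a%:P)) = gauss_norm v r%:num q.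
Proof.
rewrite etaE -comp_polyA comp_polyB comp_polyX comp_polyC addrK.
by rewrite comp_polyXr.
Qed.

Lemma seminorm_comp_Xn x (a c : k) n :
  x ((c *: 'X^n) \Po ('X - a%:P)) = v c * x ('X - a%:P) ^+ n.
Proof. by rewrite comp_polyZ comp_Xn_poly seminormZ seminormX. Qed.

Lemma eta_neq (a : k) (r : {nonneg R}) x :
  x ('X - a%:P) <= r%:num -> x <> eta v a r ->
  exists q, x (q \Po ('X - a%:P)) < gauss_norm v r%:num q.
Proof.
move=> xr xe; apply/not_existsP => H; apply: xe; apply: A1an_ext => p.
apply/eqP; rewrite eq_le le_eta//= leNgt; apply/negP => lt.
apply: (H (p \Po ('X + a%:P))).
by rewrite -(eta_comp a r) poly_shiftK.
Qed.

(* In both lemmas, drop the extremal term of [q] as long as it is not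
   dominant. *)
Lemma gauss_norm_lead_dominant x (a : k) (r : R) q : 0 < r ->
  x ('X - a%:P) <= r -> x (q \Po ('X - a%:P)) < gauss_norm v r q ->
  exists2 p, x (p \Po ('X - a%:P)) < gauss_norm v r p &
    v p`_(size p).-1 * r ^+ (size p).-1 = gauss_norm v r p.
Proof.
move=> r0 xr; pose r' := NngNum (ltW r0).
have G p : gauss_norm v r p = eta v a r' (p \Po ('X - a%:P))
  by rewrite eta_comp.
have [n] := ubnP (size q); elim: n q => // n IH q qn xq.
have [e|ne] := eqVneq (v q`_(size q).-1 * r ^+ (size q).-1) (gauss_norm v r q).
  by exists q.
have lt : v q`_(size q).-1 * r ^+ (size q).-1 < gauss_norm v r q.
  by rewrite lt_neqAle ne (gauss_norm_ge v (ltW r0)).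
have q0 : (0 < size q)%N.
  rewrite lt0n; apply: contraTneq xq => /eqP; rewrite size_poly_eq0 => /eqP ->.
  by rewrite /gauss_norm size_poly0 big_ord0 -leNgt seminorm_ge0.
set m := (size q).-1 in ne lt *; pose q' := take_poly m q.
have qE : q = q' + q`_m *: 'X^m.
  apply/polyP => i; rewrite coefD coefZ coefXn coef_take_poly.
  case: ltngtP => [im|mi|->]; rewrite ?mulr0 ?addr0 ?mulr1 ?add0r//.
  by rewrite nth_default// -(prednK q0).
have cE : eta v a r' ((q`_m *: 'X^m) \Po ('X - a%:P)) = v q`_m * r ^+ m.
  by rewrite seminorm_comp_Xn eta_XsubC.
have q'E : q' = q - q`_m *: 'X^m by apply/eqP; rewrite eq_sym subr_eq -qE.
have qNe : gauss_norm v r q' = gauss_norm v r q.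
  by rewrite !G q'E comp_polyB seminormD_dom// seminormN cE -G.
apply: (IH q').
  by rewrite (leq_ltn_trans (size_take_poly _ _))// -ltnS prednK.
rewrite qNe q'E comp_polyB (le_lt_trans (seminormD_max _ _ _))// gt_max xq
  seminormN.
rewrite seminorm_comp_Xn (le_lt_trans _ lt)// ler_wpM2l ?nabs_ge0//.
by rewrite lerXn2r ?nnegrE ?seminorm_ge0// ltW.
Qed.

Lemma gauss_norm_const_dominant x (a : k) (r : R) q : 0 < r ->
  x ('X - a%:P) = r -> x (q \Po ('X - a%:P)) < gauss_norm v r q ->
  exists2 p, x (p \Po ('X - a%:P)) < gauss_norm v r p &
    v p`_0 = gauss_norm v r p.
Proof.
move=> r0 xr; pose r' := NngNum (ltW r0).
have G p : gauss_norm v r p = eta v a r' (p \Po ('X - a%:P))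
  by rewrite eta_comp.
elim/poly_ind: q => [|q c IH] xq.
  by move: xq; rewrite comp_poly0 seminorm0 /gauss_norm size_poly0 big_ord0
    ltxx.
have c0 : (q * 'X + c%:P)`_0 = c by rewrite coefD coefMX coefC /= add0r.
have [e|ne] := eqVneq (v c) (gauss_norm v r (q * 'X + c%:P)).
  by exists (q * 'X + c%:P) => //; rewrite c0.
have lt : v c < gauss_norm v r (q * 'X + c%:P).
  rewrite lt_neqAle ne.
  by have := gauss_norm_ge v (ltW r0) (q * 'X + c%:P) 0; rewrite c0 expr0 mulr1.
have qXE : q * 'X = (q * 'X + c%:P) - c%:P by rewrite addrK.
have Gq : gauss_norm v r q * r = gauss_norm v r (q * 'X + c%:P).
  transitivity (eta v a r' ((q * 'X) \Po ('X - a%:P))).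
    by rewrite comp_polyM comp_polyX seminormM eta_XsubC -G.
  rewrite {1}qXE comp_polyB comp_polyC (G (_ + _)) seminormD_dom//.
  by rewrite seminormN seminormC -G.
apply: IH; rewrite -(ltr_pM2r r0) Gq -{1}xr -seminormM.
rewrite -{2}(comp_polyX ('X - a%:P)) -comp_polyM {1}qXE comp_polyB comp_polyC.
rewrite (le_lt_trans (seminormD_max _ _ _))// gt_max seminormN seminormC lt.
by rewrite andbT.
Qed.

(** Some polynomial with dominant leading term is smaller at [x] than its Gauss norm. At a point
    outside the disk the leading term dominates even more, so the value there is at least the Gauss
    norm: the inequality that holds at [x] defines a neighbourhood inside the disk. *)
Lemma nbhs_affine_closed_disk (a : k) (r : {nonneg R}) x : 0 < r%:num ->
  x ('X - a%:P) <= r%:num -> x <> eta v a r ->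
  nbhs (Some x : P1an v) (affine_closed_disk a r%:num).
Proof.
move=> r0 xr /(eta_neq xr)[q /(gauss_norm_lead_dominant r0 xr)[p xp pN]].
have nx : nbhs (Some x : P1an v)
    (Some @` [set y : A1an v | y (p \Po ('X - a%:P)) < gauss_norm v r%:num p]).
  apply: one_point_compactification_some_nbhs; apply: open_nbhs_nbhs.
  by split=> //; exact: open_eval_lt.
apply: filterS nx.
move=> _ [y /= yp <-]; exists y => //=; rewrite leNgt; apply/negP => ry.
move: yp; apply/negP; rewrite -leNgt.
set m := (size p).-1 in pN; set t := y _ in ry.
have t0 : 0 < t by exact: lt_trans ry.
have N0 : 0 < gauss_norm v r%:num p by exact: le_lt_trans (seminorm_ge0 _ _) xp.
have pm0 : 0 < v p`_m.
  rewrite lt_def nabs_ge0 andbT; apply: contraTneq N0 => e.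
  by rewrite -pN e mul0r ltxx.
have pE : p = take_poly m p + p`_m *: 'X^m.
  apply/polyP => i; rewrite coefD coefZ coefXn coef_take_poly.
  case: ltngtP => [im|mi|->]; rewrite ?mulr0 ?addr0 ?mulr1 ?add0r//.
  by rewrite nth_default// (leq_trans _ mi)// leqSpred.
have topE : y ((p`_m *: 'X^m) \Po ('X - a%:P)) = v p`_m * t ^+ m.
  by rewrite seminorm_comp_Xn.
have pcE : p \Po ('X - a%:P) = (p`_m *: 'X^m) \Po ('X - a%:P) +
    (take_poly m p \Po ('X - a%:P)) by rewrite [in LHS]pE comp_polyD addrC.
rewrite pcE seminormD_dom topE.
  by rewrite -pN ler_pM2l// lerXn2r ?nnegrE ?ltW.
apply: seminorm_comp_lt => [|i]; first by rewrite mulr_gt0 ?exprn_gt0.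
rewrite coef_take_poly -/t; case: ltnP => im; last first.
  by rewrite nabs0 mul0r mulr_gt0 ?exprn_gt0.
have : v p`_i * r%:num ^+ i <= v p`_m * r%:num ^+ m by rewrite pN gauss_norm_ge.
have expE (u : R) : u ^+ m = u ^+ (m - i) * u ^+ i.
  by rewrite -exprD subnK// ltnW.
rewrite !expE !mulrA ler_pM2r ?exprn_gt0//.
rewrite ltr_pM2r ?exprn_gt0// => /le_lt_trans; apply.
by rewrite ltr_pM2l// ltrXn2r ?nnegrE ?ltW// -lt0n subn_gt0.
Qed.

(** Mirror image of the previous argument, with a dominant constant term: at any point of the open
    disk the value of the polynomial equals its Gauss norm. *)
Lemma nbhs_affine_open_diskC (a : k) (r : {nonneg R}) (z : P1an v) : 0 < r%:num
  ->
  ~ affine_open_disk a r%:num z -> z <> Some (eta v a r) ->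
  nbhs z (~` affine_open_disk a r%:num).
Proof.
move=> r0 zr ze; have [zr'|zr'] := pselect (affine_closed_disk a r%:num z);
  last first.
  apply: filterS (open_nbhs_nbhs (conj (closed_openC (@closed_affine_closed_disk
    a r%:num)) zr')).
  by move=> w /= + h; apply; case: h => y /= yr <-; exists y => //=; exact: ltW.
case: zr' zr ze => x /= xr <-{z} xr' xe.
have {xr'}xr' : x ('X - a%:P) = r%:num.
  by apply/eqP; rewrite eq_le xr /= leNgt; apply/negP => h; apply: xr';
    exists x.
have {}xe : x <> eta v a r by move=> e; apply: xe; rewrite e.
have [q /(gauss_norm_const_dominant r0 xr')[p xp pN]] := eta_neq xr xe.
have nx : nbhs (Some x : P1an v)
    (Some @` [set y : A1an v | y (p \Po ('X - a%:P)) < gauss_norm v r%:num p]).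
  apply: one_point_compactification_some_nbhs; apply: open_nbhs_nbhs.
  by split=> //; exact: open_eval_lt.
apply: filterS nx.
move=> _ [y /= yp <-] [y' /= yr /Some_inj e]; subst y'.
move: yp; apply/negP; rewrite -leNgt.
have N0 : 0 < gauss_norm v r%:num p by exact: le_lt_trans (seminorm_ge0 _ _) xp.
have pE : p = (p - (p`_0)%:P) + (p`_0)%:P by rewrite subrK.
have pcE : p \Po ('X - a%:P) = (p`_0)%:P + ((p - (p`_0)%:P) \Po ('X - a%:P)).
  by rewrite [in LHS]pE comp_polyD comp_polyC addrC.
rewrite pcE seminormD_dom seminormC pN//.
apply: seminorm_comp_lt => // -[|i].
  by rewrite coefB coefC eqxx subrr nabs0 mul0r.
rewrite coefB coefC /= subr0.
have [->|pi] := eqVneq p`_i.+1 0; first by rewrite nabs0 mul0r.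
apply: lt_le_trans (gauss_norm_ge v (ltW r0) p i.+1).
rewrite ltr_pM2l; last by rewrite lt_def nabs_ge0 nabs_eq0 pi.
by rewrite ltrXn2r ?nnegrE ?seminorm_ge0 ?ltW.
Qed.

Lemma bigmaxr_continuous (F : nat -> R -> R) n : (forall i, continuous (F i)) ->
  continuous (fun t => \big[Num.max/0]_(i < n) F i t).
Proof.
elim: n F => [|n IH] F cF t.
  by under eq_fun do rewrite big_ord0; exact: cvg_cst.
under eq_fun do rewrite big_ord_recl.
apply: (@continuous_max R R^o (F 0%N)); first exact: cF.
by apply: (IH (fun i => F i.+1)) => i; exact: cF.
Qed.

Lemma gauss_norm_continuous p : continuous (fun t : R => gauss_norm v `|t| p).
Proof.
apply: (@bigmaxr_continuous (fun i t => v p`_i * `|t| ^+ i)) => i t.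
apply: cvgM; first exact: cvg_cst.
apply: (@continuous_comp R R R (fun t : R => `|t|) (fun t => t ^+ i)).
  exact: norm_continuous.
exact: exprn_continuous.
Qed.

(** Moving the radius along this path leaves a closed disk on one side and enters the open disk on
    the other, so [eta v a r] is interior to neither the closed disk nor the complement of the open
    one. The absolute value only makes the path total. *)
Lemma eta_radius_continuous (a : k) :
  continuous (fun t : R => Some (eta v a (`|t|)%:nng) : P1an v).
Proof.
move=> t; apply: (@continuous_comp _ _ _ (fun t =>
  eta v a (`|t|)%:nng : A1an v)).
  apply: A1an_cvgP => p /=.
  exact: gauss_norm_continuous.
exact: one_point_compactification_some_continuous.
Qed.

(* Images of affine closed disks under Moebius maps have this form. *)
Definition disk_with_boundary (D : set (P1an v)) z :=
  exists (a : k) (r : {nonneg R}),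
    [/\ 0 < r%:num, z = Some (eta v a r) &
        D = affine_closed_disk a r%:num \/ D = ~` affine_open_disk a r%:num].

Lemma disk_with_boundary_closed D z : disk_with_boundary D z -> closed D.
Proof.
move=> [a [r [_ _ [->|->]]]]; first exact: closed_affine_closed_disk.
by apply: open_closedC; exact: open_affine_open_disk.
Qed.

Lemma disk_with_boundary_mem D z : disk_with_boundary D z -> D z.
Proof.
move=> [a [r [_ -> [->|->]]]].
  by exists (eta v a r) => //; rewrite /mkset eta_XsubC.
by case=> y + /Some_inj e; rewrite e /mkset eta_XsubC ltxx.
Qed.

Lemma disk_with_boundaryE D z : disk_with_boundary D z -> bdry_point D = z.
Proof.
move=> Dz; have [a [r [r0 zE DE]]] := Dz.
have znotin : ~ interior D z.
  rewrite zE => Dint.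
  have rr : Some (eta v a r) = Some (eta v a (`|r%:num|)%:nng) :> P1an v.
    congr (Some (eta v a _)); apply/val_inj => /=.
    by rewrite ger0_norm.
  have : nbhs (r%:num : R) [set t : R | D (Some (eta v a (`|t|)%:nng))].
    apply: (@eta_radius_continuous a r%:num D).
    by move: Dint; rewrite rr.
  move=> /nbhs_ballP[e /= e0 eD].
  case: DE => DE; rewrite {}DE in eD.
    have : ball r%:num e (r%:num + e / 2).
      by rewrite /ball /= opprD addrA subrr sub0r normrN gtr0_norm; lra.
    move=> /eD [y + /Some_inj yE]; rewrite {}yE /mkset eta_XsubC /=.
    by rewrite gtr0_norm; lra.
  (* Here the radius has to shrink; [d < r] keeps it positive, so that the absolute value in the
     path is harmless. *)
  pose d := Num.min e r%:num / 2.
  have d0 : 0 < d by rewrite divr_gt0// lt_min e0.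
  have de : d < e.
    have : Num.min e r%:num <= e by rewrite ge_min lexx.
    by rewrite /d; lra.
  have dr : d < r%:num.
    have : Num.min e r%:num <= r%:num by rewrite ge_min lexx orbT.
    by rewrite /d; lra.
  have : ball r%:num e (r%:num - d).
    by rewrite /ball /= subKr gtr0_norm.
  move=> /eD; apply; exists (eta v a (`|r%:num - d|)%:nng) => //.
  by rewrite /mkset eta_XsubC /= gtr0_norm; lra.
rewrite /bdry_point -(closure_id D).1; last exact: disk_with_boundary_closed Dz.
apply: get_unique; first by split=> //; exact: disk_with_boundary_mem Dz.
move=> w [Dw wint]; apply: contrapT => wz; apply: wint.
rewrite /interior; case: DE => DE; rewrite {}DE in Dw *.
  case: Dw wz => x /= xr <- wz; apply: nbhs_affine_closed_disk => //.
  by move=> e; apply: wz; rewrite zE e.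
by apply: nbhs_affine_open_diskC => //; rewrite -zE.
Qed.

(** As the boundary is determined by the set alone, the boundary of an image may be computed along
    any convenient factorization of the map. *)
Lemma disk_with_boundary_unique D z w :
  disk_with_boundary D z -> disk_with_boundary D w -> z = w.
Proof. by move=> /disk_with_boundaryE <- /disk_with_boundaryE <-. Qed.

End A1anTopology.

(** * Moebius images of disks and invariance of [rho] *)

Section MoebiusDisks.
Context {R : realType} {k : fieldType} {v : nonarch_abs R k}.
Implicit Types (x : A1an v) (z w : P1an v) (p q : {poly k}) (M N : 'M[k]_2).

Lemma hev_one_or_lin z (a : k) : 0 < hev z 1 ('X - a%:P) \/ 0 < hev z 1 1.
Proof.
case: z => [x|] /=; first by right; rewrite seminorm1.
by left; rewrite coefB coefX coefC subr0 nabs1.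
Qed.

(** Maximality of [eta v a t] on the complement of the open disk, which contains infinity: sections
    are normalized by [T - a] instead of 1. *)
Lemma hev_gauss_le (a : k) (t : {nonneg R}) z n p : 0 < t%:num ->
  (size p <= n.+1)%N -> t%:num * hev z 1 1 <= hev z 1 ('X - a%:P) ->
  hev z n p * t%:num ^+ n <= eta v a t p * hev z 1 ('X - a%:P) ^+ n.
Proof.
move=> t0 pn zt; rewrite -ler_pdivlMr ?exprn_gt0//.
set U := hev z 1 ('X - a%:P).
have T0 : 0 <= eta v a t p * U ^+ n / t%:num ^+ n.
  by rewrite divr_ge0 ?mulr_ge0 ?exprn_ge0 ?seminorm_ge0 ?hev_ge0// ltW.
rewrite {1}(poly_taylor a pn); apply: hev_sum_le => // -[i /= ilt].
rewrite hevZ ler_pdivlMr ?exprn_gt0//.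
have : v (p \Po ('X + a%:P))`_i * t%:num ^+ i <= eta v a t p
  by exact: gauss_norm_ge.
have U0 : 0 <= U by exact: hev_ge0.
move=> /(ler_wpM2r (exprn_ge0 n U0)); apply: le_trans.
rewrite -!mulrA ler_wpM2l ?nabs_ge0//.
have iE : (i + (n - i))%N = n by rewrite (subnKC (ltnSE ilt)).
have -> : hev z n (('X - a%:P) ^+ i) = U ^+ i * hev z 1 1 ^+ (n - i).
  have := @hevM _ _ _ z i (n - i) (('X - a%:P) ^+ i) (1 ^+ (n - i)).
  rewrite iE expr1n mulr1 size_poly1 size_exp_XsubC => -> //.
  rewrite -(@hevX _ _ _ z i) ?size_XsubC//; congr (_ * _).
  by rewrite -(@hevX _ _ _ z (n - i)) ?size_poly1// expr1n.
have tE : t%:num ^+ n = t%:num ^+ i * t%:num ^+ (n - i) by rewrite -exprD iE.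
have UE : U ^+ n = U ^+ i * U ^+ (n - i) by rewrite -exprD iE.
rewrite tE UE mulrACA -[leLHS]mulrA [leLHS](_ : _ = (t%:num ^+ i * U ^+ i) *
  (t%:num * hev z 1 1) ^+ (n - i)); last by rewrite exprMn; ring.
rewrite [leRHS]mulrA ler_wpM2l ?mulr_ge0 ?exprn_ge0//.
by rewrite lerXn2r ?nnegrE ?mulr_ge0 ?hev_ge0.
Qed.

Lemma seminorm_le_eta z (a : k) (r : {nonneg R}) n p :
  hev z 1 ('X - a%:P) <= r%:num * hev z 1 1 ->
  hev z n p <= eta v a r p * hev z 1 1 ^+ n.
Proof.
move=> /affine_closed_diskE[x xr <-]; rewrite /hev seminorm1 expr1n mulr1.
exact: le_eta.
Qed.

(* [w] is the boundary of the disk cut out by [|l1| <= r |l2|]: it dominates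
   every point of the disk once sections are normalized by [l2]. *)
Definition dominates w (l2 : {poly k}) (D : set (P1an v)) :=
  [/\ D w, 0 < hev w 1 l2 &
    forall y n p, D y -> (size p <= n.+1)%N ->
      hev y n p * hev w 1 l2 ^+ n <= hev w n p * hev y 1 l2 ^+ n].

Lemma dominates_unique w w' l2 D : dominates w l2 D -> dominates w' l2 D -> w =
  w'.
Proof.
move=> [Dw w0 wP] [Dw' w0' wP'].
apply: (@P1an_ext _ _ _ w' w (hev w' 1 l2 / hev w 1 l2)).
  by rewrite mulf_neq0 ?invr_eq0 ?gt_eqF.
move=> n p pn; rewrite expr_div_n mulrA; apply: (mulIf (x := hev w 1 l2 ^+ n)).
  by rewrite expf_neq0// gt_eqF.
rewrite divfK ?expf_neq0 ?gt_eqF//.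
by apply/eqP; rewrite eq_le wP'// wP.
Qed.

(** Infinity satisfies the inequality exactly when [v a <= r * v c]. If it does not, the set is a
    closed disk around the zero of [l1]; if it does, the set is the complement of an open disk
    around the zero of [l2]. *)
Lemma linear_disk (r : R) (a b c d : k) : 0 < r ->
  a * d - b * c != 0 ->
  let l1 := a *: 'X + b%:P in let l2 := c *: 'X + d%:P in
  let D := [set z : P1an v | hev z 1 l1 <= r * hev z 1 l2] in
  exists2 w, disk_with_boundary D w & dominates w l2 D.
Proof.
move=> r0 det l1 l2 D.
have [lt|le] := ltP (r * v c) (v a).
  have a0 : a != 0.
    rewrite -(nabs_eq0 v) gt_eqF// (le_lt_trans _ lt)// mulr_ge0 ?nabs_ge0//.
    exact: ltW.
  have va0 : 0 < v a by rewrite lt_def nabs_ge0 nabs_eq0 a0.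
  (* [d'] is the value of [l2] at the zero [e] of [l1]. On the disk it dominates the expansion of
     [l2] in powers of [T - e], so [l2] has constant size there. *)
  pose e := - b / a; pose d' := c * e + d.
  have d'0 : d' != 0.
    have dE : a * d - b * c = a * d' by rewrite /d' /e; field.
    by apply: contraNneq det => d'0; rewrite dE d'0 mulr0.
  have vd0 : 0 < v d' by rewrite lt_def nabs_ge0 nabs_eq0 d'0.
  have l1E : l1 = a *: ('X - e%:P).
    by rewrite /l1 scalerBr scale_polyC /e mulrCA divff// mulr1 polyCN opprK.
  have l2E : l2 = d' *: 1 + c *: ('X - e%:P).
    rewrite /l2 scalerBr -alg_polyC scale_polyC /d' -!mul_polyC !polyCD !polyCM.
    by rewrite polyC1; ring.
  have r'0 : 0 <= r * v d' / v a by rewrite divr_ge0 ?mulr_ge0 ?nabs_ge0 ?ltW.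
  pose r' := NngNum r'0.
  have r'gt0 : 0 < r'%:num by rewrite /= divr_gt0 ?mulr_gt0.
  have H1 z : hev z 1 l1 = v a * hev z 1 ('X - e%:P) by rewrite l1E hevZ.
  have dom z : hev z 1 ('X - e%:P) <= r'%:num * hev z 1 1 -> hev z 1 l2 = v d' *
    hev z 1 1.
    move=> zr; have O0 : 0 < hev z 1 1.
      have [U0|//] := hev_one_or_lin z e.
      by rewrite -(pmulr_rgt0 _ r'gt0); exact: lt_le_trans zr.
    rewrite l2E hev_dom hevZ// hevZ.
    apply: (@le_lt_trans _ _ (v c * (r'%:num * hev z 1 1))).
      by rewrite ler_wpM2l ?nabs_ge0.
    rewrite mulrA ltr_pM2r//= mulrA ltr_pdivrMr//.
    by rewrite mulrCA mulrA [v d' * v a]mulrC ltr_pM2r.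
  have DE : D = affine_closed_disk e r'%:num.
    apply/seteqP; split=> z; rewrite affine_closed_diskE.
      rewrite /D /= H1 => zD; rewrite leNgt; apply/negP => zr.
      have U0 : 0 < hev z 1 ('X - e%:P).
        by apply: le_lt_trans zr; rewrite mulr_ge0 ?hev_ge0// ltW.
      move: zD; apply/negP; rewrite -ltNge l2E.
      apply: le_lt_trans (ler_wpM2l (ltW r0) (hevD _ _ _ _)) _.
      rewrite maxr_pMr ?ltW// gt_max !hevZ !mulrA ltr_pM2r// lt andbT.
      by move: zr; rewrite /= -mulrAC ltr_pdivrMr// [_ * v a]mulrC.
    move=> zr; rewrite /D /= H1 dom// mulrC mulrA -ler_pdivlMr//.
    by move: zr; rewrite /= mulrAC.
  exists (Some (eta v e r')); first by exists e, r'; split=> //; left.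
  have wD : hev (Some (eta v e r')) 1 ('X - e%:P) <= r'%:num * hev (Some (eta v
    e r')) 1 1.
    by rewrite /hev eta_XsubC seminorm1 mulr1.
  split; first by rewrite DE affine_closed_diskE.
    by rewrite dom// /hev seminorm1 mulr1.
  move=> y n p; rewrite DE affine_closed_diskE => yr pn.
  rewrite !dom// !exprMn [hev (Some _) 1 1]/hev seminorm1 expr1n mulr1.
  rewrite mulrC mulrCA ler_wpM2l ?exprn_ge0 ?nabs_ge0//.
  exact: seminorm_le_eta.
have c0 : c != 0.
  apply: contraNneq det => c0; rewrite c0 mulr0 subr0.
  move: le; rewrite c0 nabs0 mulr0 => a0.
  by rewrite (_ : a = 0) ?mul0r//; apply/eqP; rewrite -(nabs_eq0 v) eq_le a0
    nabs_ge0.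
have vc0 : 0 < v c by rewrite lt_def nabs_ge0 nabs_eq0 c0.
pose e := - d / c; pose b' := a * e + b.
have b'0 : b' != 0.
  have dE : a * d - b * c = - (c * b') by rewrite /b' /e; field.
  by apply: contraNneq det => b'0; rewrite dE b'0 mulr0 oppr0.
have vb0 : 0 < v b' by rewrite lt_def nabs_ge0 nabs_eq0 b'0.
have l2E : l2 = c *: ('X - e%:P).
  by rewrite /l2 scalerBr scale_polyC /e mulrCA divff// mulr1 polyCN opprK.
have l1E : l1 = b' *: 1 + a *: ('X - e%:P).
  rewrite /l1 scalerBr -alg_polyC scale_polyC /b' -!mul_polyC !polyCD !polyCM.
  by rewrite polyC1; ring.
have t0 : 0 <= v b' / (r * v c) by rewrite divr_ge0 ?mulr_ge0 ?nabs_ge0 ?ltW.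
pose t := NngNum t0.
have tgt0 : 0 < t%:num by rewrite /= divr_gt0 ?mulr_gt0.
have rc0 : 0 < r * v c by rewrite mulr_gt0.
have H2 z : hev z 1 l2 = v c * hev z 1 ('X - e%:P) by rewrite l2E hevZ.
have tE z : (t%:num * hev z 1 1 <= hev z 1 ('X - e%:P)) =
    (v b' * hev z 1 1 <= r * (v c * hev z 1 ('X - e%:P))).
  by rewrite /= mulrAC ler_pdivrMr// [_ * (r * v c)]mulrC -mulrA.
have DE z : D z <-> t%:num * hev z 1 1 <= hev z 1 ('X - e%:P).
  rewrite tE /D /= H2; split=> h.
    have -> : v b' * hev z 1 1 = hev z 1 (l1 - a *: ('X - e%:P)).
      by rewrite l1E addrK hevZ.
    rewrite (le_trans (hevD _ _ _ _))// ge_max h hevN hevZ mulrA.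
    by rewrite ler_wpM2r ?hev_ge0.
  rewrite l1E (le_trans (hevD _ _ _ _))// ge_max !hevZ h mulrA.
  by rewrite ler_wpM2r ?hev_ge0.
have DE' : D = ~` affine_open_disk e t%:num.
  apply/seteqP; split=> z.
    by move=> /DE h /(affine_open_diskE _ _ tgt0); rewrite ltNge h.
  by move=> h; apply/DE; rewrite leNgt; apply/negP =>
    /(affine_open_diskE _ _ tgt0).
exists (Some (eta v e t)); first by exists e, t; split=> //; right.
split.
- by apply/DE; rewrite /hev eta_XsubC seminorm1 mulr1.
- by rewrite H2 /hev eta_XsubC mulr_gt0.
move=> y n p /DE yt pn; rewrite !H2 !exprMn mulrCA [leRHS]mulrCA.
rewrite ler_wpM2l ?exprn_ge0 ?nabs_ge0// {2 3}/hev eta_XsubC.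
exact: hev_gauss_le.
Qed.

Lemma moebius_disk_with_boundary M (a : k) (r : {nonneg R}) : M \in unitmx ->
  0 < r%:num ->
  disk_with_boundary (moebius M @` affine_closed_disk a r%:num)
                     (moebius M (Some (eta v a r))).
Proof.
move=> MU r0; pose N := invmx M.
have NU : N \in unitmx by rewrite unitmx_inv.
have NM z : moebius N (moebius M z) = z by rewrite moebius_comp// mulVmx//
  moebius1.
have MN z : moebius M (moebius N z) = z by rewrite moebius_comp// mulmxV//
  moebius1.
have N1 : moebius_homog N 1 1 = N 1 0 *: 'X + (N 1 1)%:P.
  by rewrite moebius_homog1 !coef1 scale1r scale0r addr0.
have NX : moebius_homog N 1 ('X - a%:P) =
    (N 0 0 - a * N 1 0) *: 'X + (N 0 1 - a * N 1 1)%:P.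
  rewrite moebius_homog1 !coefB !coefX !coefC /= sub0r subr0 scale1r.
  rewrite /moebius_num /moebius_den -!mul_polyC polyCN !polyCB !polyCM; ring.
have det : (N 0 0 - a * N 1 0) * N 1 1 - (N 0 1 - a * N 1 1) * N 1 0 != 0.
  have := mx2_det NU; congr (_ != 0); ring.
have [w Dw domw] := linear_disk r0 det.
set D := (X in disk_with_boundary X _) in Dw domw.
have DE : moebius M @` affine_closed_disk a r%:num = D.
  have H z : D z <-> affine_closed_disk a r%:num (moebius N z).
    rewrite affine_closed_diskE /D /= -NX -N1.
    have [c c0 cE] := hev_moebius NU z.
    rewrite -!cE ?size_XsubC ?size_poly1// expr1 mulrA.
    by rewrite ler_pM2r.
  apply/seteqP; split=> z.
    by move=> [y yD <-]; apply/H; rewrite NM.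
  by move=> /H zD; exists (moebius N z); rewrite ?MN.
(* Domination is phrased with homogeneous evaluations and is therefore transported by [hev_moebius];
   uniqueness of the dominating point concludes. *)
rewrite DE; suff -> : moebius M (Some (eta v a r)) = w by [].
apply: dominates_unique domw; rewrite -/D.
set eta' := Some (eta v a r); set z := moebius M eta'.
have [c c0 cE] := hev_moebius NU z.
have zE : moebius N z = eta' by rewrite NM.
rewrite zE in cE.
have eta1 n : hev eta' n 1 = 1 by exact: seminorm1.
have z1 : hev z 1 (N 1 0 *: 'X + (N 1 1)%:P) = c.
  by rewrite -N1 -cE ?size_poly1// eta1 mul1r expr1.
split.
- rewrite -DE; exists eta' => //; exists (eta v a r) => //.
  by rewrite /mkset eta_XsubC.
- by rewrite z1.
move=> y n p; rewrite -DE => -[y0 y0D yE] pn; rewrite -{}yE.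
have [d d0 dE] := hev_moebius NU (moebius M y0); rewrite NM in dE.
pose q := moebius_homog M n p.
have pE : p = moebius_homog N n q.
  by rewrite /q moebius_homog_comp// mulmxV// moebius_homog_id.
have qn : (size q <= n.+1)%N by exact: size_moebius_homog.
rewrite z1 {1 2}pE -!cE -?dE// -N1 -dE ?size_poly1// expr1.
move/affine_closed_diskE/(seminorm_le_eta n q) : y0D => le.
rewrite exprMn [leLHS](_ : _ = hev y0 n q * (c ^+ n * d ^+ n)); last by ring.
rewrite [leRHS](_ : _ = hev eta' n q * hev y0 1 1 ^+ n * (c ^+ n * d ^+ n));
  last by ring.
by rewrite ler_wpM2r// mulr_ge0// exprn_ge0// ltW.
Qed.

(** The map [T |-> a + 1 / T], which reduces the complement of an open disk around [a] to a closed
    disk around 0. *)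
Definition inversion_mx (a : k) : 'M[k]_2 :=
  \matrix_(i, j) if i == 0 then (if j == 0 then a else 1) else (j == 0)%:R.

Definition inversion_mxV (a : k) : 'M[k]_2 :=
  \matrix_(i, j) if i == 0 then (j != 0)%:R else (if j == 0 then 1 else - a).

Lemma inversion_mxK a : inversion_mx a *m inversion_mxV a = 1%:M.
Proof.
apply/matrixP => i j; rewrite !mxE !big_ord_recl big_ord0 !mxE /=.
case: i => -[|[|//]] ? /=; case: j => -[|[|//]] ? /=;
  rewrite ?mulr0 ?mulr1 ?mul0r ?mul1r ?addr0 ?add0r ?mulrN ?mulr1 ?subrr//.
Qed.

Lemma inversion_mx_unit a : inversion_mx a \in unitmx.
Proof. by case/mulmx1_unit: (inversion_mxK a). Qed.

Lemma inversion_mxV_unit a : inversion_mxV a \in unitmx.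
Proof. by case/mulmx1_unit: (inversion_mxK a). Qed.

Lemma inversion_mxVK a : inversion_mxV a *m inversion_mx a = 1%:M.
Proof. exact: mulmx1C (inversion_mxK a). Qed.

Lemma moebius_inversion (a : k) (r : R) : 0 < r ->
  moebius (inversion_mx a) @` affine_closed_disk 0 r^-1 =
  ~` affine_open_disk a r :> set (P1an v).
Proof.
move=> r0; have AU := inversion_mx_unit a; have BU := inversion_mxV_unit a.
have H z : affine_closed_disk 0 r^-1 (moebius (inversion_mxV a) z) <->
    ~ affine_open_disk a r z.
  rewrite affine_closed_diskE (affine_open_diskE _ _ r0) polyC0 subr0.
  have [c c0 cE] := hev_moebius BU z.
  have eX := cE 1%N 'X; have e1 := cE 1%N 1.
  rewrite expr1 size_polyX in eX; rewrite expr1 size_poly1 in e1.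
  rewrite -(ler_pM2r c0) -mulrA eX// e1//.
  rewrite !moebius_homog1 !coefX !coef1 /= !scale1r !scale0r addr0 add0r.
  rewrite /moebius_num /moebius_den !mxE /= scale0r add0r scale1r polyCN polyC1.
  by rewrite ler_pdivlMl// leNgt; split=> /negP.
apply/seteqP; split=> z.
  by move=> [y yD <-]; apply/H; rewrite moebius_comp// inversion_mxVK moebius1.
move=> /H zD; exists (moebius (inversion_mxV a) z) => //.
by rewrite moebius_comp// inversion_mxK moebius1.
Qed.

Lemma disk_with_boundary_moebius M D z : M \in unitmx -> disk_with_boundary D z
  ->
  disk_with_boundary (moebius M @` D) (moebius M z).
Proof.
move=> MU [a [r [r0 -> [->|DE]]]]; first exact: moebius_disk_with_boundary.
have ri0 : 0 <= r%:num^-1 by rewrite invr_ge0.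
have ri : 0 < (NngNum ri0)%:num by rewrite /= invr_gt0.
have AU := inversion_mx_unit a.
have DA : disk_with_boundary
    (moebius (inversion_mx a) @` affine_closed_disk 0 r%:num^-1)
    (moebius (inversion_mx a) (Some (eta v 0 (NngNum ri0)))).
  exact: moebius_disk_with_boundary.
rewrite moebius_inversion// -DE in DA.
have -> : Some (eta v a r) = moebius (inversion_mx a) (Some (eta v 0 (NngNum
  ri0))) :> P1an v.
  by apply: disk_with_boundary_unique DA; exists a, r; split=> //; right.
rewrite moebius_comp// {1}DE -(moebius_inversion _ r0).
have -> : moebius M @` (moebius (inversion_mx a) @` affine_closed_disk 0
  r%:num^-1) =
    moebius (M *m inversion_mx a) @` affine_closed_disk 0 r%:num^-1 :> set (P1an
      v).
  rewrite image_comp; apply: eq_imagel => y _ /=.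
  by rewrite moebius_comp.
apply: (@moebius_disk_with_boundary (M *m inversion_mx a) 0 (NngNum ri0)) => //.
by rewrite unitmx_mul MU.
Qed.

Lemma disk_with_boundary_act (h : PGL2 k) D z : disk_with_boundary D z ->
  disk_with_boundary (PGL2_act h @` D) (PGL2_act h z).
Proof. exact: disk_with_boundary_moebius (valP (repr h)). Qed.

Lemma affine_closed_disk_boundary (a : k) (r : {nonneg R}) : 0 < r%:num ->
  disk_with_boundary (affine_closed_disk a r%:num) (Some (eta v a r)).
Proof. by move=> r0; exists a, r; split=> //; left. Qed.

Lemma affine_open_disk_boundary (a : k) (r : {nonneg R}) : 0 < r%:num ->
  disk_with_boundary (~` affine_open_disk a r%:num) (Some (eta v a r)).
Proof. by move=> r0; exists a, r; split=> //; right. Qed.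

Lemma closed_disk_boundary (D : set (P1an v)) :
  closed_disk D -> disk_with_boundary D (bdry_point D).
Proof.
move=> [h [a [r [r0 ->]]]].
have := disk_with_boundary_act h (@affine_closed_disk_boundary a (NngNum (ltW
  r0)) r0).
by move=> DE; rewrite (disk_with_boundaryE DE).
Qed.

(** Tested on the points [eta v c s] with [s < t]: the value [s = 0] locates the centre, and a value
    strictly between [r] and [t] would contradict the inclusion. *)
Lemma affine_open_disk_sub (c a : k) (t r : R) : 0 < t ->
  affine_open_disk c t `<=` (affine_closed_disk a r : set (P1an v)) ->
  v (c - a) <= r /\ t <= r.
Proof.
move=> t0 sub.
have H (s : {nonneg R}) : s%:num < t -> v (c - a) <= r /\ s%:num <= r.
  move=> st; have : affine_open_disk c t (Some (eta v c s) : P1an v).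
    by exists (eta v c s) => //; rewrite /mkset eta_XsubC.
  move=> /sub[y + /Some_inj ye]; rewrite /mkset ye eta_subr ge_max.
  by move=> /andP.
have [ca r0] := H 0%:nng t0; split=> //.
rewrite leNgt; apply/negP => rt.
have s0 : 0 <= (r + t) / 2 by move: r0 => /=; lra.
have st : (r + t) / 2 < t by lra.
by have [_ /=] := H (NngNum s0) st; lra.
Qed.

(** In a coordinate where [D] is an affine closed disk of radius [r], the open disk can be widened
    to radius [r] around its own centre [c] without leaving [D]. Maximality makes this an equality,
    and [eta v c r] is the boundary point of [D] because [c] lies in [D]. *)
Lemma maximal_open_disk_boundary (D E : set (P1an v)) :
  closed_disk D -> maximal_open_disk E D -> disk_with_boundary (~` E)
    (bdry_point D).
Proof.
move=> [h [a [r [r0 DE]]]] [Eo ED Emax].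
pose r' := NngNum (ltW r0).
have /disk_with_boundaryE -> : disk_with_boundary D (PGL2_act h (Some (eta v a
  r'))).
  by rewrite DE; exact: disk_with_boundary_act (@affine_closed_disk_boundary a
    r' r0).
pose E' := PGL2_act h^-1%g @` E.
have hE : PGL2_act h @` E' = E by rewrite /E' -{2}(invgK h) PGL2_act_imageK.
have E'D : E' `<=` affine_closed_disk a r.
  by rewrite -(PGL2_act_imageK h (affine_closed_disk a r)) -DE;
    exact: image_subset.
have [w [c [t [t0 _ cE']]]] : exists w, disk_with_boundary (~` E') w.
  case: Eo => h' [c [t [t0 EE]]]; eexists.
  rewrite /E' EE -PGL2_act_imageM -PGL2_act_imageC.
  exact: disk_with_boundary_act (@affine_open_disk_boundary c (NngNum (ltW t0))
    t0).
case: cE' => [cE'|/(congr1 setC)]; last rewrite !setCK => cE'.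
  have : ~ (~` E') None by rewrite cE' => -[].
  by move=> /contrapT/E'D[].
have [ca tr] : v (c - a) <= r /\ t%:num <= r.
  by apply: affine_open_disk_sub => //; rewrite -cE'.
have FE : PGL2_act h @` affine_open_disk c r = E.
  apply: Emax; first by exists h, c, r.
    rewrite -hE cE'; apply: image_subset => _ [y /= yt <-].
    by exists y => //=; exact: lt_le_trans tr.
  rewrite DE; apply: image_subset => _ [y /= yt <-]; exists y => //=.
  have -> : 'X - a%:P = ('X - c%:P) + (c - a)%:P by rewrite polyCB addrA subrK.
  by rewrite (le_trans (seminormD_max _ _ _))// ge_max (ltW yt) seminormC.
have -> : eta v a r' = eta v c r' by apply: eta_center; rewrite nabsB_sym.
rewrite -FE -PGL2_act_imageC.
exact: disk_with_boundary_act (@affine_open_disk_boundary c r' r0).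
Qed.

(** * Moebius invariance of the distance *)

(** The path between the two points climbs to the smallest disk containing both and descends again;
    its top radius is the maximum, and both branches of [eta_dist] measure this path. *)
Lemma eta_distE (a b : k) (r s : R) : 0 < r -> 0 < s ->
  eta_dist v a r b s = ln (Num.max (v (a - b)) (Num.max r s) ^+ 2 / (r * s)).
Proof.
move=> r0 s0; have m0 : 0 < Num.max r s by rewrite lt_max r0.
have rs0 : 0 < r / s by rewrite divr_gt0.
rewrite /eta_dist; case: leP => [ab|ab].
  have [rs|sr] := leP r s.
    have le1 : r / s <= 1 by rewrite ler_pdivrMr// mul1r.
    rewrite ler0_norm ?ln_le0// -lnV ?posrE//; congr ln.
    by field; rewrite ?gt_eqF.
  have le1 : 1 <= r / s by rewrite ler_pdivlMr// mul1r ltW.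
  rewrite ger0_norm ?ln_ge0//; congr ln.
  by field; rewrite ?gt_eqF.
have /andP[ra sa] : (r < v (a - b)) && (s < v (a - b)) by rewrite -gt_max.
have d0 : 0 < v (a - b) by exact: lt_trans ra.
rewrite !ger0_norm ?ln_ge0 ?ler_pdivlMr// ?mul1r ?ltW//.
rewrite -lnM ?posrE ?divr_gt0//; congr ln.
by field; rewrite ?gt_eqF.
Qed.

(* [Num.max (v (a - b)) (Num.max r s) / s] is the optimal constant comparing
   [eta a r] with [eta b s] on linear forms; comparing both ways yields an
   invariant description of [eta_dist]. *)
Lemma eta_le_linear (a b : k) (r s : {nonneg R}) (C : R) : 0 < s%:num ->
  (Num.max (v (a - b)) (Num.max r%:num s%:num) / s%:num <= C) <->
  (forall l : {poly k}, (size l <= 2)%N -> eta v a r l <= C * eta v b s l).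
Proof.
move=> s0; rewrite ler_pdivrMr// ge_max ge_max; split.
  move=> /and3P[ab rC sC] l l2.
  have C1 : 1 <= C by move: sC; rewrite -{1}[s%:num]mul1r ler_pM2r.
  rewrite {1}(poly_taylor b l2); set q := _ \Po _.
  have := @hev_sum_le _ _ _ (Some (eta v a r)) 0 'I_2
    (fun i => q`_i *: ('X - b%:P) ^+ i); apply.
    by rewrite mulr_ge0 ?seminorm_ge0//; lra.
  move=> i; rewrite /hev seminormZ seminormX eta_subr.
  apply: (@le_trans _ _ (C * (v q`_i * s%:num ^+ i))); last first.
    rewrite ler_wpM2l//; first lra.
    exact: gauss_norm_ge.
  rewrite mulrCA ler_wpM2l ?nabs_ge0//.
  case: i => -[|[|//]] ? /=; first by rewrite !expr0 mulr1.
  by rewrite !expr1 ge_max ab.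
move=> H; have := H ('X - b%:P); rewrite size_XsubC => /(_ isT).
rewrite eta_subr eta_XsubC ge_max => /andP[-> ->] /=.
have := H 1; rewrite size_poly1 !seminorm1 mulr1 => /(_ isT) C1.
by rewrite -{1}[s%:num]mul1r ler_pM2r.
Qed.

(** Pulling linear forms back by [M] rescales the two points by [c] and [d]. The factor [d / c]
    cancels against the one obtained with the points exchanged. *)
Lemma eta_ratio_moebius (a b a' b' : k) (r s r' s' : {nonneg R}) M (c d : R) :
  M \in unitmx -> 0 < s%:num -> 0 < s'%:num -> 0 < c -> 0 < d ->
  (forall l : {poly k}, (size l <= 2)%N ->
     eta v a' r' l * c = eta v a r (moebius_homog M 1 l)) ->
  (forall l : {poly k}, (size l <= 2)%N ->
     eta v b' s' l * d = eta v b s (moebius_homog M 1 l)) ->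
  Num.max (v (a' - b')) (Num.max r'%:num s'%:num) / s'%:num =
  Num.max (v (a - b)) (Num.max r%:num s%:num) / s%:num * (d / c).
Proof.
move=> MU s0 s'0 c0 d0 cE dE.
have NU : invmx M \in unitmx by rewrite unitmx_inv.
(* Both sides are compared through their upper bounds [C], where [eta_le_linear] applies; every
   linear form is a pullback because [M] is invertible. *)
have key (C : R) : (Num.max (v (a' - b')) (Num.max r'%:num s'%:num) / s'%:num <=
  C) =
    (Num.max (v (a - b)) (Num.max r%:num s%:num) / s%:num <= C * (c / d)).
  have E (l : {poly k}) : (size l <= 2)%N -> (eta v a' r' l <= C * eta v b' s'
    l) =
      (eta v a r (moebius_homog M 1 l) <= C * (c / d) * eta v b s (moebius_homog
        M 1 l)).
    move=> l2; rewrite -cE// -dE// -(ler_pM2r c0); congr (_ <= _).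
    by field; rewrite gt_eqF.
  apply/idP/idP => /(eta_le_linear _ _ _ _ _).
    move=> /(_ s'0) H; apply/eta_le_linear => // l l2.
    have -> : l = moebius_homog M 1 (moebius_homog (invmx M) 1 l).
      by rewrite moebius_homog_comp// mulVmx// moebius_homog_id.
    by rewrite -E ?size_moebius_homog// H ?size_moebius_homog.
  move=> /(_ s0) H; apply/eta_le_linear => // l l2.
  by rewrite E// H ?size_moebius_homog.
have cd0 : 0 < c / d by rewrite divr_gt0.
apply/eqP; rewrite eq_le; apply/andP; split.
  have dc : d / c * (c / d) = 1 by field; rewrite !gt_eqF.
  by rewrite key -[X in _ <= X]mulrA dc mulr1.
set X := (X in _ <= X); have := key X; rewrite lexx => /esym.
by rewrite -(ler_pdivrMr _ _ cd0) invf_div.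
Qed.

Lemma rho_moebius M (z w : P1an v) D E : M \in unitmx ->
  disk_with_boundary D z -> disk_with_boundary E w ->
  rho (moebius M z) (moebius M w) = rho z w.
Proof.
move=> MU Dz Ew.
have [a' [r' [r'0 zE' _]]] := disk_with_boundary_moebius MU Dz.
have [b' [s' [s'0 wE' _]]] := disk_with_boundary_moebius MU Ew.
case: Dz Ew => a [r [r0 zE _]] [b [s [s0 wE _]]].
have [c c0 cE] := hev_moebius MU z; have [d d0 dE] := hev_moebius MU w.
rewrite zE' zE in cE; rewrite wE' wE in dE.
rewrite zE' wE' zE wE !rho_eta// !eta_distE//.
have e1 := eta_ratio_moebius MU s0 s'0 c0 d0 (cE 1%N) (dE 1%N).
have e2 := eta_ratio_moebius MU r0 r'0 d0 c0 (dE 1%N) (cE 1%N).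
rewrite nabsB_sym [Num.max s'%:num _]maxC [v (b - a)]nabsB_sym
  [Num.max s%:num _]maxC in e2.
move: e1 e2; set m' := Num.max (v (a' - b')) _; set m := Num.max (v (a - b)) _.
move=> e1 e2; congr ln.
have mE (x y z0 : R) : x ^+ 2 / (y * z0) = (x / z0) * (x / y).
  by rewrite expr2 invfM; ring.
rewrite !mE e1 e2; field.
by rewrite !gt_eqF.
Qed.

Lemma rho_act (h : PGL2 k) (z w : P1an v) D E :
  disk_with_boundary D z -> disk_with_boundary E w ->
  rho (PGL2_act h z) (PGL2_act h w) = rho z w.
Proof. exact: rho_moebius (valP (repr h)). Qed.

Lemma rho_gt0 (z w : P1an v) D E :
  disk_with_boundary D z -> disk_with_boundary E w -> z <> w -> 0 < rho z w.
Proof.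
move=> [a [r [r0 -> _]]] [b [s [s0 -> _]]] zw.
rewrite rho_eta// eta_distE//; set m := Num.max _ _.
have rm : r%:num <= m by rewrite /m !le_max lexx !orbT.
have sm : s%:num <= m by rewrite /m !le_max lexx !orbT.
apply: ln_gt0; rewrite ltr_pdivlMr ?mulr_gt0// mul1r expr2.
have [rlt|mr] := ltP r%:num m.
  by rewrite (lt_le_trans (_ : _ < m * s%:num)) ?ltr_pM2r// ler_wpM2l// ltW//
    (lt_le_trans s0).
have {}rm : r%:num = m by apply/eqP; rewrite eq_le rm.
have [slt|ms] := ltP s%:num m; first by rewrite rm ltr_pM2l// -rm.
have {}sm : s%:num = m by apply/eqP; rewrite eq_le sm.
have rs : r = s by apply/val_inj; rewrite /= rm sm.
case: zw; rewrite -rs; congr Some; apply: eta_center.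
by rewrite rm /m le_max lexx.
Qed.

(** For nested disks the path only descends, so [rho] is the logarithm of the ratio of the radii.
    This turns distances between boundary points into radii of disks. *)
Lemma rho_nested (a b : k) (r s : {nonneg R}) : 0 < r%:num -> 0 < s%:num ->
  affine_closed_disk b s%:num `<=` (affine_closed_disk a r%:num : set (P1an v))
    ->
  s%:num = r%:num * expR (- rho (Some (eta v a r)) (Some (eta v b s))) /\ v (b -
    a) <= r%:num.
Proof.
move=> r0 s0 sub.
have : affine_closed_disk b s%:num (Some (eta v b s) : P1an v).
  exact: disk_with_boundary_mem (affine_closed_disk_boundary b s0).
move=> /sub[y + /Some_inj ye]; rewrite /mkset ye eta_subr ge_max =>
  /andP[ba sr].
split=> //; rewrite rho_eta// eta_distE// nabsB_sym.
rewrite (max_idPl sr) (max_idPr ba) expr2 -mulf_div divff ?gt_eqF// mul1r.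
rewrite -lnV ?posrE ?divr_gt0// lnK ?posrE ?invr_gt0 ?divr_gt0// invf_div.
by field; rewrite gt_eqF.
Qed.

End MoebiusDisks.

(** * Spherical metric on points of type 1 *)

Section TypeOnePoints.
Context {R : realType} {k : fieldType} {v : nonarch_abs R k}.
Implicit Types (x y : @P1 k) (M : 'M[k]_2) (a b : k).

Definition P1_fst x : k := if x is Some a then a else 1.
Definition P1_snd x : k := if x is Some a then 1 else 0.
Definition P1_norm x : R := Num.max (v (P1_fst x)) (v (P1_snd x)).
Definition P1_wedge x y : k := P1_fst x * P1_snd y - P1_snd x * P1_fst y.

Lemma P1_norm_gt0 x : 0 < P1_norm x.
Proof. by rewrite lt_max; case: x => [a|] /=; rewrite nabs1 ltr01 ?orbT. Qed.

Lemma P1_an_inj : injective (@P1_an _ _ v).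
Proof.
move=> [a|] [b|] //= /Some_inj/eta_eq[_ /= ab]; congr Some; apply/eqP.
by rewrite -subr_eq0 -(nabs_eq0 v) eq_le ab nabs_ge0.
Qed.

Lemma affine_closed_disk_P1 a (r : R) x :
  affine_closed_disk a r (P1_an v x) <-> exists2 b, x = Some b & v (b - a) <= r.
Proof.
split=> [[y + yx]|[b -> br]].
  case: x yx => [b|//] /Some_inj ->; rewrite /mkset eta_subr ge_max =>
    /andP[br _].
  by exists b.
exists (eta v b 0%:nng) => //; rewrite /mkset eta_subr ge_max br /=.
exact: le_trans (nabs_ge0 v (b - a)) br.
Qed.

(** The spherical metric is the chordal metric of the homogeneous coordinates [(a : 1)] and
    [(1 : 0)] for the sup norm, a formula without cases on which matrices act simply. *)
Lemma spherical_distE x y :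
  spherical_dist v x y = v (P1_wedge x y) / (P1_norm x * P1_norm y).
Proof.
have vN (a b : k) : v a < v b -> v (a - b) = v b.
  by move=> ab; rewrite nabsB_sym nabsD_dom// nabsN.
rewrite /spherical_dist /P1_wedge /P1_norm.
case: x y => [a|] [b|] /=; rewrite ?nabs1 ?nabs0 ?mulr1 ?mul1r ?mulr0 ?mul0r
  ?sub0r ?subr0.
- have [a1|a1] := leP (v a) 1; have [b1|b1] := leP (v b) 1 => /=.
  + by rewrite mulr1 divr1.
  + have ab := le_lt_trans a1 b1; rewrite mul1r vN// divff// gt_eqF//.
    exact: lt_trans b1.
  + have ab := le_lt_trans b1 a1; rewrite mulr1 nabsB_sym vN// divff// gt_eqF//.
    exact: lt_trans a1.
  + have a0 : a != 0 by rewrite -(nabs_eq0 v) gt_eqF// (lt_trans _ a1).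
    have b0 : b != 0 by rewrite -(nabs_eq0 v) gt_eqF// (lt_trans _ b1).
    have -> : a^-1 - b^-1 = (b - a) / (a * b) by field; rewrite a0 b0.
    by rewrite nabsM nabsV nabsM nabsB_sym.
- have [a1|a1] := leP (v a) 1 => /=.
    by rewrite nabsN nabs1 (max_idPl ler01) mulr1 divr1.
  by rewrite nabsV nabsN nabs1 (max_idPl ler01) mulr1 mul1r.
- have [b1|b1] := leP (v b) 1 => /=.
    by rewrite (max_idPl ler01) mulr1 nabs1 divr1.
  by rewrite nabsN nabsV (max_idPl ler01) mul1r nabs1 mul1r.
- by rewrite ?subrr ?oppr0 ?nabs0 ?mul0r.
Qed.

Lemma spherical_dist_ge0 x y : 0 <= spherical_dist v x y.
Proof.
by rewrite spherical_distE divr_ge0 ?nabs_ge0 ?mulr_ge0 ?(ltW (P1_norm_gt0 _)).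
Qed.

Lemma spherical_dist_le a b : spherical_dist v (Some a) (Some b) <= v (a - b).
Proof.
rewrite spherical_distE /P1_wedge /= mulr1 mul1r ler_pdivrMr.
  by rewrite ler_peMr ?nabs_ge0// mulr_ege1// /P1_norm /= nabs1 le_max lexx
    orbT.
by rewrite mulr_gt0 ?P1_norm_gt0.
Qed.

Lemma spherical_dist_ge (B : R) a b : 1 <= B -> v a <= B -> v b <= B ->
  v (a - b) / B ^+ 2 <= spherical_dist v (Some a) (Some b).
Proof.
move=> B1 aB bB; have B0 : 0 < B by lra.
rewrite spherical_distE /P1_wedge /= mulr1 mul1r.
rewrite ler_wpM2l ?nabs_ge0// lef_pV2 ?posrE ?mulr_gt0 ?P1_norm_gt0
  ?exprn_gt0//.
rewrite expr2 ler_pM ?(ltW (P1_norm_gt0 _))//.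
  by rewrite /P1_norm /= nabs1 ge_max aB.
by rewrite /P1_norm /= nabs1 ge_max bB.
Qed.

Lemma moebius_P1 M x : M \in unitmx -> exists y (c : k),
  [/\ c != 0, moebius M (P1_an v x) = P1_an v y,
      M 0 0 * P1_fst x + M 0 1 * P1_snd x = c * P1_fst y &
      M 1 0 * P1_fst x + M 1 1 * P1_snd x = c * P1_snd y].
Proof.
move=> MU; have det := mx2_det MU.
have denE a : (moebius_den M).[a] = M 1 0 * a + M 1 1.
  by rewrite /moebius_den !hornerE.
have numE a : (moebius_num M).[a] = M 0 0 * a + M 0 1.
  by rewrite /moebius_num !hornerE.
case: x => [a|]; rewrite [P1_fst _]/= [P1_snd _]/=; last first.
  rewrite !mulr1 !mulr0 !addr0.
  have [c0|c0] := eqVneq (M 1 0) 0.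
    exists None, (M 0 0); split; rewrite /= ?mulr1 ?mulr0 ?c0 ?eqxx//.
    by apply: contraNneq det => ->; rewrite c0 mul0r mulr0 subrr.
  exists (Some (M 0 0 / M 1 0)), (M 1 0); split=> //=.
  - by rewrite (negPf c0).
  - by rewrite mulrC divfK.
  - by rewrite mulr1.
rewrite !mulr1; have [d0|d0] := eqVneq (M 1 0 * a + M 1 1) 0.
  exists None, (M 0 0 * a + M 0 1); split; rewrite ?mulr1 ?mulr0 ?d0//.
    apply: contraNneq det => n0.
    have E0 : M 0 1 = - (M 0 0 * a) by apply/eqP; rewrite -addr_eq0 addrC n0.
    have E1 : M 1 1 = - (M 1 0 * a) by apply/eqP; rewrite -addr_eq0 addrC d0.
    by rewrite E0 E1; apply/eqP; ring.
  by apply: moebius_infty; rewrite eta0E denE d0 nabs0.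
exists (Some ((M 0 0 * a + M 0 1) / (M 1 0 * a + M 1 1))), (M 1 0 * a + M 1 1).
split=> //; last by rewrite /= mulr1.
  2: by rewrite [RHS]mulrC divfK.
have xd : eta v a 0%:nng (moebius_den M) <> 0.
  by rewrite eta0E denE; apply/eqP; rewrite nabs_eq0.
rewrite [P1_an _ _]/= (moebius_affine xd); congr Some; apply: A1an_ext => p.
rewrite (@moebius_A1anE _ _ _ _ _ xd (size p))// !eta0E denE.
rewrite -nabsX -nabsV -nabsM; congr (v _).
rewrite (@horner_coef_wide _ (size p).+1 p)// /moebius_homog horner_sum
  mulr_suml.
apply: eq_bigr => -[i /= ilt] _.
rewrite hornerZ hornerM !horner_exp denE numE -!mulrA; congr (_ * _).
rewrite expr_div_n; congr (_ * _).
have -> : (M 1 0 * a + M 1 1) ^+ size p = (M 1 0 * a + M 1 1) ^+ i * (M 1 0 * a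
  + M 1 1) ^+ (size p - i).
  by rewrite -exprD subnKC.
by rewrite invfM mulrCA divff ?mulr1// expf_neq0.
Qed.

Lemma PGL2_act_P1 (h : PGL2 k) x : exists y, PGL2_act h (P1_an v x) = P1_an v y.
Proof. by have [y [c []]] := moebius_P1 x (valP (repr h)); exists y. Qed.

(** A matrix multiplies [P1_wedge] by its determinant [D], while by Cramer's rule it shrinks the
    norm of coordinates at most by the factor [v D / B]. *)
Lemma spherical_dist_lipschitz (h : PGL2 k) : exists2 C : R, 0 < C &
  forall x x' y y', PGL2_act h (P1_an v x) = P1_an v y ->
    PGL2_act h (P1_an v x') = P1_an v y' ->
    spherical_dist v y y' <= C * spherical_dist v x x'.
Proof.
pose M := val (repr h); have MU : M \in unitmx := valP (repr h).
have det := mx2_det MU.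
set D := (X in X != 0) in det.
have vD : 0 < v D by rewrite lt_def nabs_ge0 nabs_eq0 det.
pose B := Num.max (Num.max (v (M 0 0)) (v (M 0 1))) (Num.max (v (M 1 0)) (v (M 1
  1))).
have B0 : 0 <= B by rewrite /B !le_max nabs_ge0.
have [B00 B01 B10 B11] : [/\ v (M 0 0) <= B, v (M 0 1) <= B, v (M 1 0) <= B & v
  (M 1 1) <= B].
  by rewrite /B !le_max !lexx !orbT.
have norm_le x y c : M 0 0 * P1_fst x + M 0 1 * P1_snd x = c * P1_fst y ->
    M 1 0 * P1_fst x + M 1 1 * P1_snd x = c * P1_snd y ->
    v D * P1_norm x <= B * (v c * P1_norm y).
  move=> e1 e2.
  have E1 : D * P1_fst x = c * (M 1 1 * P1_fst y) - c * (M 0 1 * P1_snd y).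
    by rewrite mulrCA -e1 [c * (M 0 1 * _)]mulrCA -e2 /D; ring.
  have E2 : D * P1_snd x = c * (M 0 0 * P1_snd y) - c * (M 1 0 * P1_fst y).
    by rewrite mulrCA -e2 [c * (M 1 0 * _)]mulrCA -e1 /D; ring.
  have bnd (m z : k) : v m <= B -> v z <= P1_norm y ->
      v (c * (m * z)) <= B * (v c * P1_norm y).
    move=> mB zy; rewrite !nabsM mulrCA ler_pM ?mulr_ge0 ?nabs_ge0//.
    by rewrite ler_wpM2l ?nabs_ge0.
  have f1 : v (P1_fst y) <= P1_norm y by rewrite /P1_norm le_max lexx.
  have f2 : v (P1_snd y) <= P1_norm y by rewrite /P1_norm le_max lexx orbT.
  rewrite /P1_norm maxr_pMr ?nabs_ge0// -!nabsM E1 E2 ge_max.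
  by rewrite !(le_trans (nabsD_max _ _ _)) ?ge_max ?nabsN ?bnd.
(* The added 1 secures positivity at once. *)
exists ((B / v D) ^+ 2 * v D + 1).
  by rewrite ltr_pwDr// mulr_ge0 ?nabs_ge0// exprn_ge0// divr_ge0 ?nabs_ge0.
move=> x x' y y' hx hx'.
have [z [c [c0 + e1 e2]]] := moebius_P1 x MU.
rewrite -/(PGL2_act h _) hx => /P1_an_inj yz; rewrite -{z}yz in e1 e2.
have [z [c' [c'0 + e1' e2']]] := moebius_P1 x' MU.
rewrite -/(PGL2_act h _) hx' => /P1_an_inj yz; rewrite -{z}yz in e1' e2'.
have W : c * c' * P1_wedge y y' = D * P1_wedge x x'.
  transitivity ((c * P1_fst y) * (c' * P1_snd y') - (c * P1_snd y) * (c' *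
    P1_fst y')).
    by rewrite /P1_wedge; ring.
  by rewrite -e1 -e2 -e1' -e2' /P1_wedge /D; ring.
have vc : 0 < v c by rewrite lt_def nabs_ge0 nabs_eq0 c0.
have vc' : 0 < v c' by rewrite lt_def nabs_ge0 nabs_eq0 c'0.
have vW : v (P1_wedge y y') = v D * v (P1_wedge x x') / (v c * v c').
  by rewrite -nabsM -W !nabsM mulrAC divff ?mul1r// mulf_neq0 ?gt_eqF.
apply: (@le_trans _ _ ((B / v D) ^+ 2 * v D * spherical_dist v x x'));
  last first.
  by rewrite ler_wpM2r ?spherical_dist_ge0// lerDl.
have n1 := norm_le _ _ _ e1 e2; have n2 := norm_le _ _ _ e1' e2'.
rewrite !spherical_distE vW -[leLHS]mulrA -invfM.
have -> : v c * v c' * (P1_norm y * P1_norm y') = (v c * P1_norm y) * (v c' *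
  P1_norm y').
  by ring.
have -> : (B / v D) ^+ 2 * v D * (v (P1_wedge x x') / (P1_norm x * P1_norm x'))
  =
    v D * v (P1_wedge x x') * ((B / (v D * P1_norm x)) * (B / (v D * P1_norm
      x'))).
  by field; rewrite !gt_eqF ?P1_norm_gt0.
rewrite ler_wpM2l ?mulr_ge0 ?nabs_ge0// invfM ler_pM ?invr_ge0 ?mulr_ge0
  ?nabs_ge0 ?(ltW (P1_norm_gt0 _))//.
  rewrite ler_pdivlMr ?mulr_gt0 ?P1_norm_gt0// mulrC ler_pdivrMr ?mulr_gt0
    ?P1_norm_gt0//.
rewrite ler_pdivlMr ?mulr_gt0 ?P1_norm_gt0// mulrC ler_pdivrMr ?mulr_gt0
  ?P1_norm_gt0//.
Qed.

End TypeOnePoints.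

(** * Perron-Frobenius *)

Lemma normcD_le (R : rcfType) (x y : R[i]) :
  Normc.normc (x + y) <= Normc.normc x + Normc.normc y.
Proof. by rewrite -lecR rmorphD/=; exact: (@ler_normD _ R[i]). Qed.

Section PerronFrobenius.
Context {R : realType} {n : nat}.
Variable M : 'M[R]_n.
Hypothesis n_gt0 : (0 < n)%N.
Hypothesis M_ge0 : forall i j, 0 <= M i j.
Hypothesis M2_gt0 : forall i j, 0 < (M *m M) i j.

Let Mv (u : 'I_n -> R) i := \sum_j M i j * u j.

Let Mv_comp u i : Mv (Mv u) i = \sum_j (M *m M) i j * u j.
Proof.
rewrite /Mv; under eq_bigr do rewrite mulr_sumr.
rewrite exchange_big /=; apply: eq_bigr => j _; rewrite mxE mulr_suml.
by apply: eq_bigr => l _; rewrite mulrA.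
Qed.

Let Mv2_gt0 u : (forall i, 0 <= u i) -> (exists i, u i != 0) ->
  forall i, 0 < Mv (Mv u) i.
Proof.
move=> u0 [j uj] i; rewrite Mv_comp (bigD1 j)//= ltr_pwDl//.
  by rewrite mulr_gt0// lt_def uj u0.
by apply: sumr_ge0 => l _; rewrite mulr_ge0// ltW.
Qed.

Let C := \sum_i \sum_j M i j.

(* Coordinate [ord0] holds the constant [c] and the others a probability vector
   [u] with [c u <= M u]. *)
Let K := [set w : 'rV[R]_n.+1 |
  [/\ forall i : 'I_n.+1, `[0, (if i == ord0 then C else 1)]%classic (w ord0 i),
      \sum_(i < n) w ord0 (lift ord0 i) = 1 &
      forall i : 'I_n, w ord0 ord0 * w ord0 (lift ord0 i) <=
        \sum_j M i j * w ord0 (lift ord0 j)]].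

Let sum_continuous (F : 'I_n -> 'rV[R]_n.+1 -> R) :
  (forall i, continuous (F i)) -> continuous (fun w => \sum_i F i w).
Proof.
move=> cF; apply: continuous_big => [|i _]; last exact: cF.
exact: (@add_continuous R^o).
Qed.

Let K_compact : compact K.
Proof.
have -> : K = [set w : 'rV[R]_n.+1 | forall i, `[0, (if i == ord0 then C else
  1)]%classic (w ord0 i)] `&`
   ([set w | \sum_(i < n) w ord0 (lift ord0 i) = 1] `&`
    \bigcap_(i in [set: 'I_n]) [set w | w ord0 ord0 * w ord0 (lift ord0 i) -
        \sum_j M i j * w ord0 (lift ord0 j) <= 0]).
  apply/seteqP; split=> w.
    by move=> [h1 h2 h3]; split=> //; split=> // i _ /=; rewrite subr_le0.
  move=> [h1 [h2 h3]]; split=> // i.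
  by rewrite -subr_le0; exact: h3.
have cc i : continuous (fun w : 'rV[R]_n.+1 => w ord0 i)
  by exact: coord_continuous.
apply: compact_closedI.
  by apply: (@rV_compact _ _ (fun i : 'I_n.+1 =>
    `[0, (if i == ord0 then C else 1)]%classic)) => i; exact: segment_compact.
apply: closedI.
  apply: (@preimage_closed _ _ (fun w : 'rV[R]_n.+1 =>
    \sum_(i < n) w ord0 (lift ord0 i)) [set x | x = 1]).
    by move=> w _; exact: (@sum_continuous (fun i w =>
      w ord0 (lift ord0 i)) (fun i => cc (lift ord0 i)) w).
  exact: closed_eq.
apply: closed_bigI => i _.
apply: (@preimage_closed _ _ (fun w : 'rV[R]_n.+1 =>
  w ord0 ord0 * w ord0 (lift ord0 i) -
        \sum_j M i j * w ord0 (lift ord0 j)) [set x | x <= 0]);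
          last exact: closed_le.
have c1 : continuous (fun w : 'rV[R]_n.+1 => w ord0 ord0 * w ord0 (lift ord0
  i)).
  by move=> x; exact: (cvgM (cc ord0 x) (cc (lift ord0 i) x)).
have c2 : continuous (fun w : 'rV[R]_n.+1 => \sum_j M i j * w ord0 (lift ord0
  j)).
  apply: (@sum_continuous (fun j w => M i j * w ord0 (lift ord0 j))) => j x.
  exact: (cvgM (cvg_cst (M i j)) (cc (lift ord0 j) x)).
by move=> w _; exact: (cvgB (c1 w) (c2 w)).
Qed.

Let K_of (u : 'I_n -> R) (c : R) : 0 <= c -> (forall i, 0 <= u i) -> \sum_i u i
  = 1 ->
  (forall i, c * u i <= Mv u i) ->
  K (\row_i (if unlift ord0 i is Some j then u j else c)).
Proof.
move=> c0 u0 u1 cu.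
have ule j : u j <= 1 by rewrite -u1 (bigD1 j)//= lerDl sumr_ge0.
have lE j : (\row_i (if unlift ord0 i is Some j then u j else c)) ord0 (lift
  ord0 j) = u j.
  by rewrite mxE liftK.
have zE : (\row_i (if unlift ord0 i is Some j then u j else c)) ord0 ord0 = c.
  by rewrite mxE unlift_none.
split.
- move=> i; case: (unliftP ord0 i) => [j ->|->].
    by rewrite /= lE in_itv /= u0 ule.
  (* The bound [C] on [c]: sum [c u <= M u] over the coordinates and use that each [u j] is at most
     1. *)
  rewrite /= zE in_itv /= c0 -[c]mulr1 -u1 mulr_sumr.
  apply: (le_trans (ler_sum _ (fun i _ => cu i))).
  apply: ler_sum => l _; apply: ler_sum => j _.
  by rewrite ler_piMr.
- by under eq_bigr do rewrite lE.
- by move=> i; rewrite zE lE; under eq_bigr do rewrite lE; exact: cu.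
Qed.

(** Collatz-Wielandt principle: a pair in [K] with [c] maximal satisfies [M u = c u], since any
    defect could be converted into a larger [c]. *)
Lemma perron : exists c (u : 'I_n -> R),
  (forall i, 0 < u i) /\ (forall i, \sum_j M i j * u j = c * u i).
Proof.
have normalize (y : 'I_n -> R) (c : R) : 0 <= c -> (forall i, 0 < y i) ->
    (forall i, c * y i <= Mv y i) -> exists2 w, K w & w ord0 ord0 = c.
  move=> c0 y0 cy; pose s := \sum_i y i.
  have s0 : 0 < s.
    rewrite /s (bigD1 (Ordinal n_gt0))//= ltr_pwDl//.
    by apply: sumr_ge0 => i _; exact: ltW.
  exists (\row_i (if unlift ord0 i is Some j then y j / s else c)); last first.
    by rewrite mxE unlift_none.
  apply: (@K_of (fun j => y j / s)) => // [i||i].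
  - by rewrite divr_ge0 ?ltW.
  - by rewrite -mulr_suml divff ?gt_eqF.
  - rewrite mulrA /Mv; under eq_bigr do rewrite mulrA.
    by rewrite -mulr_suml ler_wpM2r ?invr_ge0 ?(ltW s0)//; exact: cy.
have K0 : K !=set0.
  have [|||w Kw _] := normalize (fun=> 1) 0 => //; last by exists w.
  by move=> i; rewrite mul0r; apply: sumr_ge0 => j _; rewrite mulr1.
have cc : {within K, continuous (fun w : 'rV[R]_n.+1 => w ord0 ord0)}.
  by apply: continuous_subspaceT => x; exact: coord_continuous.
have [w] := compact_EVT_max K0 K_compact cc; rewrite inE => Kw wmax.
have [w01 w1 wle] := Kw.
pose c := w ord0 ord0; pose u i := w ord0 (lift ord0 i).
have u0 i : 0 <= u i by have := w01 (lift ord0 i); rewrite /= in_itv /= =>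
  /andP[].
have c0 : 0 <= c by have := w01 ord0; rewrite /= in_itv /= => /andP[].
have unz : exists i, u i != 0.
  apply/existsP; apply: contraTT isT => /existsPn unz.
  have := w1; rewrite big1 => [/esym/eqP|i _]; first by rewrite oner_eq0.
  by apply/eqP; move/negPn: (unz i).
have eigen i : Mv u i = c * u i.
  apply: contrapT => /eqP neq.
  pose z i := Mv u i - c * u i.
  have z0 j : 0 <= z j by rewrite subr_ge0; exact: wle.
  have zi : exists j, z j != 0 by exists i; rewrite subr_eq0.
  (* The defect [z = M u - c u] is nonnegative and nonzero, so its image under the square of [M] is
     positive. That image is [M y - c y], hence [c] can be increased for [y]. *)
  pose y := Mv (Mv u).
  have y0 j : 0 < y j by exact: Mv2_gt0.
  have strict j : c * y j < Mv y j.
    rewrite -subr_gt0; have -> : Mv y j - c * y j = Mv (Mv z) j.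
      have lin (a b : 'I_n -> R) (d : R) l : Mv (fun i =>
        a i - d * b i) l = Mv a l - d * Mv b l.
        rewrite /Mv mulr_sumr -sumrB; apply: eq_bigr => m _; ring.
      have -> : Mv z = (fun l => Mv (Mv u) l - c * Mv u l) by apply/funext => l;
        rewrite -lin.
      by rewrite lin.
    exact: Mv2_gt0.
  (* The default value [c + 1] also exceeds [c], so the minimum does. *)
  pose c' := \big[Num.min/(c + 1)]_j (Mv y j / y j).
  have c'gt : c < c'.
    rewrite /c'; elim/big_ind: _ => [|a b ca cb|j _]; first by rewrite ltrDl.
      by rewrite lt_min ca.
    by rewrite ltr_pdivlMr.
  have c'le j : c' * y j <= Mv y j.
    rewrite -ler_pdivlMr// /c' (bigD1 j)//= ge_min lexx//.
  have [|||w' Kw' w'c] := normalize y c' => //;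
    first exact: ltW (le_lt_trans c0 c'gt).
  have := wmax w'; rewrite inE w'c => /(_ Kw'); rewrite leNgt.
  by rewrite -/c c'gt.
exists c, u; split=> // i.
(* The left side is positive, so no coordinate of [u] vanishes. *)
have ci : Mv (Mv u) i = c ^+ 2 * u i.
  rewrite (_ : Mv u = (fun j => c * u j)); last by apply/funext.
  transitivity (c * Mv u i); last by rewrite eigen mulrA.
  by rewrite /Mv mulr_sumr; apply: eq_bigr => j _; ring.
have : 0 < c ^+ 2 * u i by rewrite -ci; exact: Mv2_gt0.
move=> h; rewrite lt_def u0 andbT; apply: contraTneq h => ->.
by rewrite mulr0 ltxx.
Qed.

(* A left eigenvector is bounded by pairing its modulus with [u]. *)
Lemma spectral_radius_perron (c : R) (u : 'I_n -> R) : (forall i, 0 < u i) ->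
  (forall i, \sum_j M i j * u j = c * u i) -> spectral_radius M = c.
Proof.
move=> u0 uM; pose f := real_complex R.
have c0 : 0 <= c.
  rewrite -(pmulr_lge0 c (u0 (Ordinal n_gt0))) -uM.
  by apply: sumr_ge0 => j _; rewrite mulr_ge0// ltW.
have ub z : eigenvalue (map_mx f M) z -> Normc.normc z <= c.
  move=> /eigenvalueP[x xM xn0].
  have S0 : 0 < \sum_i Normc.normc (x ord0 i) * u i.
    have nn i : 0 <= Normc.normc (x ord0 i) * u i.
      by rewrite mulr_ge0 ?(ltW (u0 i))//; case: (x ord0 i) => a b;
        exact: sqrtr_ge0.
    rewrite lt_def sumr_ge0 ?andbT//; apply: contraNneq xn0 => /psumr_eq0P S0.
    apply/eqP/rowP => j; rewrite !mxE; apply: Normc.eq0_normc; apply/eqP.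
    by have /eqP := S0 (fun i _ => nn i) j isT;
      rewrite mulf_eq0 [u j == 0]gt_eqF// orbF.
  rewrite -(ler_pM2r S0) !mulr_sumr.
  have step j : Normc.normc z * Normc.normc (x ord0 j) <= \sum_i Normc.normc (x
    ord0 i) * M i j.
    rewrite -Normc.normcM.
    have -> : z * x ord0 j = \sum_i x ord0 i * f (M i j).
      have := congr1 (fun A : 'rV_n => A ord0 j) xM; rewrite !mxE => <-.
      by apply: eq_bigr => i _; rewrite mxE.
    elim/big_rec2: _ => [|i y1 y2 _ IH]; first by rewrite Normc.normc0.
    apply: le_trans (normcD_le _ _) _; rewrite Normc.normcM lerD//.
    by rewrite ler_wpM2l//; [case: (x ord0 i) => a b;
      exact: sqrtr_ge0|rewrite /= expr0n addr0 sqrtr_sqr ger0_norm].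
  apply: (@le_trans _ _ (\sum_j (\sum_i Normc.normc (x ord0 i) * M i j) * u j)).
    by apply: ler_sum => j _; rewrite mulrA ler_wpM2r// ltW.
  rewrite le_eqVlt; apply/orP; left; apply/eqP.
  under eq_bigr do rewrite mulr_suml.
  rewrite exchange_big /=; apply: eq_bigr => i _.
  under eq_bigr do rewrite -mulrA.
  by rewrite -mulr_sumr uM mulrCA.
(* [eigenvalue] refers to row vectors whereas [u] is a column; the determinant of [c - M] passes
   from one to the other. *)
have ev : eigenvalue (map_mx f M) (f c).
  rewrite eigenvalue_map; apply/eigenvalueP.
  have : \det (c%:M - M) == 0.
    rewrite -det_tr; apply/det0P; exists (\row_i u i).
      apply/eqP => /rowP/(_ (Ordinal n_gt0)); rewrite !mxE => /eqP.
      by rewrite gt_eqF.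
    apply/rowP => j; rewrite !mxE.
    under eq_bigr do rewrite !mxE mulrBr.
    rewrite sumrB (bigD1 j)//= eqxx mulr1n big1 ?addr0.
      under eq_bigr do rewrite mulrC.
      by rewrite uM mulrC subrr.
    by move=> i ij; rewrite eq_sym (negPf ij) mulr0n mulr0.
  move=> /det0P[w w0 wM]; exists w => //.
  by apply/eqP; rewrite -mul_mx_scalar eq_sym -subr_eq0 -mulmxBr wM.
have nc : Normc.normc (f c) = c by rewrite /= expr0n addr0 sqrtr_sqr ger0_norm.
have uB : ubound [set Normc.normc z | z in [set z : R[i] | eigenvalue (map_mx f
  M) z]] c.
  by move=> _ [z /= ez <-]; exact: ub.
apply/eqP; rewrite eq_le; apply/andP; split.
  by apply: ge_sup uB; exists (Normc.normc (f c)); exists (f c).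
rewrite -{1}nc; apply: ub_le_sup; first by exists c.
by exists (f c).
Qed.

End PerronFrobenius.

(** * Hausdorff measures *)

Section HausdorffMeasure.
Context {R : realType} {X : Type} (d : X -> X -> R).
Local Open Scope ereal_scope.

Lemma diameter_le (U : set X) (c : R) :
  (forall x y, U x -> U y -> (d x y <= c)%R) -> diameter d U <= c%:E.
Proof.
by move=> Uc; apply: ge_ereal_sup => _ [x Ux [y Uy <-]]; rewrite lee_fin Uc.
Qed.

Lemma diameter_ge (U : set X) x y : U x -> U y -> (d x y)%:E <= diameter d U.
Proof. by move=> Ux Uy; apply: ereal_sup_ubound; exists x => //; exists y. Qed.

Lemma hausdorff_gauge_ge0 s (U : set X) : 0 <= hausdorff_gauge d s U.
Proof. by rewrite /hausdorff_gauge; case: ifP => // _; exact: poweR_ge0. Qed.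

Hypothesis d_ge0 : forall x y, (0 <= d x y)%R.

Lemma hausdorff_gauge_le s (U : set X) (c : R) : (0 <= s)%R -> (0 <= c)%R ->
  (forall x y, U x -> U y -> (d x y <= c)%R) ->
  hausdorff_gauge d s U <= (c `^ s)%:E.
Proof.
move=> s0 c0 Uc; rewrite /hausdorff_gauge; case: eqP => [_|/eqP/set0P[x Ux]].
  by rewrite lee_fin powR_ge0.
have d0 : 0 <= diameter d U.
  by apply: le_trans (diameter_ge Ux Ux); rewrite lee_fin.
rewrite -poweR_EFin; apply: gt0_ler_poweR => //;
  rewrite ?in_itv/= ?leey ?andbT//.
exact: diameter_le.
Qed.

Lemma hausdorff_gauge_ge s (U : set X) x y : (0 <= s)%R -> U x -> U y ->
  (d x y `^ s)%:E <= hausdorff_gauge d s U.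
Proof.
move=> s0 Ux Uy; rewrite /hausdorff_gauge.
have /negPf -> : U != set0 by apply/set0P; exists x.
rewrite -poweR_EFin; apply: gt0_ler_poweR => //;
  rewrite ?in_itv/= ?leey ?andbT ?lee_fin//.
  by apply: le_trans (diameter_ge Ux Uy); rewrite lee_fin.
exact: diameter_ge.
Qed.

Lemma hausdorff_measure_eq0 s (A : set X) : (0 <= s)%R ->
  (forall e delta : R, (0 < e)%R -> (0 < delta)%R ->
     exists (T : finType) (U : T -> set X) (c : T -> R),
       [/\ A `<=` \bigcup_t U t,
           forall t, (0 <= c t <= delta)%R,
           forall t x y, U t x -> U t y -> (d x y <= c t)%R &
           (\sum_t c t `^ s <= e)%R]) ->
  hausdorff_measure d s A = 0.
Proof.
move=> s0 H.
have pre delta : (0 < delta)%R -> hausdorff_premeasure d s delta A = 0.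
  move=> delta0; apply/eqP; rewrite eq_le; apply/andP; split; last first.
    by apply: le_ereal_inf_tmp => _ [U _ <-]; apply: nneseries_ge0 => n _ _;
      exact: hausdorff_gauge_ge0.
  apply/lee_addgt0Pr => e e0; rewrite add0e.
  have [T [U [c [AU c0 Uc ce]]]] := H e delta e0 delta0.
  (* The finite cover is continued by empty sets, whose gauge is 0 for every exponent. *)
  pose V n := if insub n is Some i then U (@enum_val T T i) else set0.
  have VE t : V (enum_rank t) = U t.
    by rewrite /V insubT// => lt; congr U; rewrite -[RHS]enum_rankK;
      congr enum_val; exact: val_inj.
  apply: (@le_trans _ _ (\sum_(n <oo) hausdorff_gauge d s (V n))).
    apply: ereal_inf_lbound; exists V => //; split.
      by move=> x /AU[t _ Ut]; exists (enum_rank t) => //; rewrite VE.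
    move=> n; apply: diameter_le => x y; rewrite /V; case: insubP => [i _ _|//].
    by move=> Ux Uy; apply: le_trans (Uc _ _ _ Ux Uy) _;
      case/andP: (c0 (enum_val i)).
  rewrite (@nneseries_split _ _ 0 #|T|); last by move=> *;
    exact: hausdorff_gauge_ge0.
  rewrite add0n [X in _ + X]eseries0 ?adde0; last first.
    move=> n Tn _; rewrite /V insubF ?ltnNge ?Tn//.
    by rewrite /hausdorff_gauge eqxx.
  rewrite big_mkord; apply: (@le_trans _ _ (\sum_(t : T) (c t `^ s)%:E));
    last first.
    by rewrite sumEFin lee_fin.
  rewrite (reindex (@enum_rank T))/=; last first.
    by apply: onW_bij; exact: enum_rank_bij.
  apply: lee_sum => t _; rewrite VE; apply: hausdorff_gauge_le => //.
    by case/andP: (c0 t).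
  exact: Uc.
apply/eqP; rewrite eq_le; apply/andP; split.
  by apply: ge_ereal_sup => _ [delta /= delta0 <-]; rewrite pre.
apply: ereal_sup_ubound; exists 1%R; [exact: ltr01|exact: pre].
Qed.

Lemma hausdorff_measure_gt0 s (A : set X) (c : R) : (0 < c)%R ->
  (forall U : nat -> set X, A `<=` \bigcup_n U n ->
     c%:E <= \sum_(n <oo) hausdorff_gauge d s (U n)) ->
  0 < hausdorff_measure d s A.
Proof.
move=> c0 H; apply: (@lt_le_trans _ _ c%:E); first by rewrite lte_fin.
apply: (@le_trans _ _ (hausdorff_premeasure d s 1 A)); last first.
  by apply: ereal_sup_ubound; exists 1%R => //=; exact: ltr01.
by apply: le_ereal_inf_tmp => _ [U [AU _] <-]; exact: H.
Qed.

(** At exponent 0 each nonempty member of a cover weighs 1. This supplies the exponent that the mass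
    argument below, stated for positive exponents, leaves out. *)
Lemma hausdorff_measure0_gt0 (A : set X) : A !=set0 ->
  0 < hausdorff_measure d 0 A.
Proof.
move=> [x Ax]; apply: (@hausdorff_measure_gt0 _ _ 1) => // U AU.
have [n _ Ux] := AU x Ax.
apply: (@le_trans _ _ (\sum_(0 <= i < n.+1) hausdorff_gauge d 0 (U i)));
  last first.
  by apply: nneseries_lim_ge => i _ _; exact: hausdorff_gauge_ge0.
rewrite big_nat_recr//=; apply: (@le_trans _ _ (hausdorff_gauge d 0 (U n))).
  rewrite /hausdorff_gauge poweRe0.
  by have /negPf -> : U n != set0 by apply/set0P; exists x.
by rewrite leeDr// sume_ge0// => i _; exact: hausdorff_gauge_ge0.
Qed.

Lemma hausdorff_dim_le s (A : set X) : (0 <= s)%R ->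
  (forall t, (s < t)%R -> hausdorff_measure d t A = 0) ->
  hausdorff_dim d A <= s%:E.
Proof.
move=> s0 H; apply/lee_addgt0Pr => e e0; apply: ereal_inf_lbound.
exists (s + e)%R; last by rewrite EFinD.
by split; [rewrite addr_ge0// ltW|apply: H; rewrite ltrDl].
Qed.

Lemma hausdorff_dim_ge s (A : set X) :
  (forall t, (0 <= t)%R -> (t < s)%R -> 0 < hausdorff_measure d t A) ->
  s%:E <= hausdorff_dim d A.
Proof.
move=> H; apply: le_ereal_inf_tmp => _ [t [t0 Ht] <-]; rewrite lee_fin leNgt.
by apply/negP => /(H t t0); rewrite Ht ltxx.
Qed.

End HausdorffMeasure.

(** * Mass on the tree of words *)

Section MassDistribution.
Context {R : realType} (I : finType) (adm : rel I) (i0 : I).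
Variable mu : seq I -> R.
Hypothesis mu_ge0 : forall w, 0 <= mu w.
Hypothesis mu_sub : forall w, path adm i0 w ->
  mu w <= \sum_(c | adm (last i0 w) c) mu (rcons w c).
Variable W : nat -> option (seq I).

Let term (w : seq I) n : \bar R :=
  if W n is Some w' then (if prefix w w' then (mu w')%:E else 0%E) else 0%E.

(** What the cover [W] spends below [w]. It is compared with [mu w], which the children of [w] may
    exceed in total, as happens for a subeigenvector. *)
Let mass w : \bar R := (\sum_(n <oo) term w n)%E.

Let term_ge0 w n : (0 <= term w n)%E.
Proof. by rewrite /term; case: (W n) => // w'; case: ifP => // _;
  rewrite lee_fin. Qed.

(** A given word extends at most one child of [w], so at most one summand is nonzero. *)
Let term_children w n :
  (\sum_(c | adm (last i0 w) c) term (rcons w c) n <= term w n)%E.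
Proof.
rewrite /term; case: (W n) => [w'|]; last by rewrite big1.
have pre c : prefix (rcons w c) w' -> prefix w w'.
  by move=> /prefixP[t ->]; apply/prefixP; exists (c :: t); rewrite cat_rcons.
have [[c0 wc0]|H] := pselect (exists c0, prefix (rcons w c0) w'); last first.
  rewrite big1; first by case: ifP => // _; rewrite lee_fin.
  by move=> c _; case: ifP => // wc; case: H; exists c.
rewrite (pre _ wc0).
have uniq c : prefix (rcons w c) w' -> c = c0.
  move: wc0; rewrite !prefixE !size_rcons => /eqP -> /eqP.
  by move=> /rcons_inj[].
have [ac|nc] := boolP (adm (last i0 w) c0).
  rewrite (bigD1 c0)//= wc0 big1 ?adde0// => c /andP[_ cc0].
  by case: ifP => // /uniq e; rewrite e eqxx in cc0.
rewrite big1 ?lee_fin// => c ac; case: ifP => // /uniq e.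
by rewrite -e ac in nc.
Qed.

Let descend w : path adm i0 w -> (mass w < (mu w)%:E)%E ->
  exists c, adm (last i0 w) c /\ (mass (rcons w c) < (mu (rcons w c))%:E)%E.
Proof.
move=> wp wlt; apply: contrapT => /forallNP H.
have le c : adm (last i0 w) c -> ((mu (rcons w c))%:E <= mass (rcons w c))%E.
  by move=> ac; rewrite leNgt; apply/negP => lt; apply: (H c).
move: wlt; apply/negP; rewrite -leNgt.
apply: (@le_trans _ _ (\sum_(c | adm (last i0 w) c) (mu (rcons w c))%:E)%E).
  by rewrite sumEFin lee_fin mu_sub.
apply: (@le_trans _ _ (\sum_(c | adm (last i0 w) c) mass (rcons w c))%E).
  exact: lee_sum.
rewrite /mass -nneseries_sum//.
apply: lee_nneseries => [n _ _|n _]; first by apply: sume_ge0.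
exact: term_children.
Qed.

(* The deficit [mu w - mass w > 0] passes to some child at each step. *)
Lemma escaping_ray : (\sum_(n <oo) (if W n is Some w then (mu w)%:E else 0) <
  (mu [::])%:E)%E ->
  exists c : nat -> I, forall m, path adm i0 (mkseq c m) /\
    forall n, W n <> Some (mkseq c m).
Proof.
move=> lt0.
have m0 : (mass [::] < (mu [::])%:E)%E.
  rewrite /mass (@eq_eseriesr _ _ (fun n => if W n is Some w then (mu w)%:E else
    0%E))//.
  by move=> n _; rewrite /term; case: (W n) => // w; rewrite prefix0s.
have [next nextP] : exists next : seq I -> I, forall w, path adm i0 w ->
    (mass w < (mu w)%:E)%E ->
    adm (last i0 w) (next w) /\ (mass (rcons w (next w)) < (mu (rcons w (next
      w)))%:E)%E.
  have : forall w, exists c, path adm i0 w -> (mass w < (mu w)%:E)%E ->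
      adm (last i0 w) c /\ (mass (rcons w c) < (mu (rcons w c))%:E)%E.
    move=> w; have [[wp wlt]|H] := pselect (path adm i0 w /\ (mass w < (mu
      w)%:E)%E).
      by have [c cP] := descend wp wlt; exists c.
    by exists i0 => wp wlt; case: H.
  by move=> /choice[next nP]; exists next.
pose V n := iter n (fun w => rcons w (next w)) [::].
have VE n : V n = mkseq (fun m => next (V m)) n.
  by elim: n => // n IH; rewrite mkseqS -IH.
have VP n : path adm i0 (V n) /\ (mass (V n) < (mu (V n))%:E)%E.
  elim: n => [//|n [wp wlt]]; have [a lt] := nextP _ wp wlt.
  by rewrite /V iterS -/(V n); split=> //; rewrite rcons_path wp.
exists (fun m => next (V m)) => m; rewrite -VE.
have [wp wlt] := VP m; split=> // n Wn.
move: wlt; apply/negP; rewrite -leNgt.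
(* If [V m] belonged to the cover, it would contribute its whole mass to [mass (V m)], against the
   deficit. *)
have tE : term (V m) n = (mu (V m))%:E by rewrite /term Wn prefix_refl.
rewrite -tE; apply: (@le_trans _ _ (\sum_(0 <= i < n.+1) term (V m) i)%E).
  by rewrite big_nat_recr//= leeDr// sume_ge0.
by apply: nneseries_lim_ge.
Qed.

End MassDistribution.

(** * Dynamics of a Schottky figure *)

Lemma expR_small (R : realType) (a e : R) : 0 < a -> 0 < e ->
  exists N, forall n, (N <= n)%N -> expR (- (n%:R * a)) <= e.
Proof.
move=> a0 e0; exists (Num.truncn (e^-1 / a)).+1 => n Nn.
have h : e^-1 <= n%:R * a.
  rewrite -ler_pdivrMr//; apply: (@le_trans _ _ (Num.truncn (e^-1 / a)).+1%:R).
    have e'0 : 0 <= e^-1 / a by rewrite divr_ge0 ?invr_ge0 ?ltW.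
    by have /andP[_ /ltW] := truncn_itv e'0.
  by rewrite ler_nat.
rewrite expRN -[e]invrK lef_pV2 ?posrE ?expR_gt0 ?invr_gt0//.
by rewrite (le_trans h)// (le_trans _ (expR_ge1Dx _))// lerDr.
Qed.

Lemma sum_tuple_cons (V : nmodType) (I : finType) n (F : seq I -> V) :
  \sum_(t : n.+1.-tuple I) F t = \sum_j \sum_(t : n.-tuple I) F (j :: t).
Proof.
rewrite pair_big /=.
rewrite (reindex (fun p : I * n.-tuple I => cons_tuple p.1 p.2)) //=.
exists (fun t : n.+1.-tuple I => (thead t, behead_tuple t)) => [[j t] _|t _] /=.
  by congr pair; apply: val_inj.
by rewrite [RHS]tuple_eta; apply: val_inj.
Qed.

Lemma finite_seq_size (I : finType) n : finite_set [set w : seq I | (size w <=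
  n)%N].
Proof.
elim: n => [|n IH].
  by apply: (@sub_finite_set _ _ [set [::]]) => // -[|].
apply: (@sub_finite_set _ _ ([set [::]] `|`
  [set i :: w | i in [set: I] & w in [set w | (size w <= n)%N]])).
  by move=> [|i w] /= wn; [left|right; exists i => //; exists w].
rewrite finite_setU; split=> //.
by apply: finite_image2 => //; exact: finite_finset.
Qed.

Section SchottkyDynamics.
Context {R : realType} {k : fieldType} {v : nonarch_abs R k}.
Variables (I : finType) (S : I -> PGL2 k) (bar : I -> I).
Variables (D E : I -> set (P1an v)).
Hypothesis barK : involutive bar.
Hypothesis S_bar : forall i, S (bar i) = (S i)^-1%g.
Hypothesis D_disk : forall i, closed_disk (D i).
Hypothesis D_disj : forall i j z, D i z -> D j z -> i = j.
Hypothesis E_max : forall i, maximal_open_disk (E i) (D i).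
Hypothesis S_D : forall i, PGL2_act (S i) @` (~` D (bar i)) = E i.

Definition admissible (i j : I) := j != bar i.

Local Notation adm := admissible.
Local Notation act i := (@PGL2_act R k v (S i)).

Definition disk_pt i : P1an v := bdry_point (D i).

(** The word is [i :: w], given by head and tail so as to be nonempty; all its letters except the
    last one act, on the disk of the last one. *)
Fixpoint word_disk i (w : seq I) : set (P1an v) :=
  if w is j :: w' then act i @` word_disk j w' else D i.

Fixpoint word_pt i (w : seq I) : P1an v :=
  if w is j :: w' then act i (word_pt j w') else disk_pt i.

(** The distance in the exponent of the matrix entry [(i, j)]. *)
Definition gap i j : R := rho (disk_pt (bar i)) (disk_pt j).

Fixpoint word_len i (w : seq I) : R :=
  if w is j :: w' then gap i j + word_len j w' else 0.

Definition word_rad i w : R := (eta_params (word_pt i w)).2%:num.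

Lemma disk_ptP i : disk_with_boundary (D i) (disk_pt i).
Proof. exact: closed_disk_boundary. Qed.

Lemma open_disk_ptP i : disk_with_boundary (~` E i) (disk_pt i).
Proof. exact: maximal_open_disk_boundary. Qed.

Lemma E_sub i : E i `<=` D i.
Proof. by case: (E_max i). Qed.

Lemma S_E i : act i @` (~` E (bar i)) = D i.
Proof.
rewrite PGL2_act_imageC -S_D barK S_bar.
by have := PGL2_act_imageK (S i)^-1%g (~` D i); rewrite invgK => ->;
  rewrite setCK.
Qed.

(** Both points bound the complement of [E i], seen once as the image of [D (bar i)] and once as the
    complement of a maximal open disk of [D i]. *)
Lemma S_disk_pt i : act i (disk_pt (bar i)) = disk_pt i.
Proof.
apply: disk_with_boundary_unique (open_disk_ptP i).
rewrite -S_D -PGL2_act_imageC setCK.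
exact: disk_with_boundary_act (disk_ptP _).
Qed.

Lemma S_D_sub i j : j != bar i -> act i @` D j `<=` D i.
Proof.
move=> ji; apply: subset_trans (@E_sub i); rewrite -S_D; apply: image_subset.
by move=> z Dj Di; move: ji; rewrite (D_disj Dj Di) eqxx.
Qed.

Lemma word_disk_sub i w : path adm i w -> word_disk i w `<=` D i.
Proof.
elim: w i => [|j w IH] i /=; first by move=> _; exact: subset_refl.
move=> /andP[ij jw].
by apply: subset_trans (S_D_sub ij); apply: image_subset; exact: IH.
Qed.

Lemma word_disk_cat i w w' : path adm i (w ++ w') ->
  word_disk i (w ++ w') `<=` word_disk i w.
Proof.
elim: w i => [|j w IH] i /=; first exact: word_disk_sub.
by move=> /andP[_ jw]; apply: image_subset; exact: IH.
Qed.

Lemma word_disk_disj i j w w' z : path adm i w -> path adm j w' ->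
  size w = size w' -> word_disk i w z -> word_disk j w' z -> i :: w = j :: w'.
Proof.
elim: w w' i j z => [|a w IH] [|b w'] i j z //.
  by move=> _ _ _ Di Dj; rewrite (D_disj Di Dj).
move=> iw jw' [ss] zi zj.
have ij : i = j.
  by apply: (@D_disj _ _ z); [exact: (word_disk_sub iw)|exact: (word_disk_sub
    jw')].
rewrite -{j}ij in jw' zj *.
case: zi zj => y yw <- [y' yw' /PGL2_act_inj yy].
rewrite {}yy in yw'.
by case/andP: iw jw' => _ aw /andP[_ bw']; rewrite (IH w' a b y).
Qed.

Lemma word_ptP i w : disk_with_boundary (word_disk i w) (word_pt i w).
Proof.
elim: w i => [|j w IH] i /=; first exact: disk_ptP.
exact: disk_with_boundary_act.
Qed.

(** By invariance everything but the last letter [i] of the old word can be removed. [S_disk_pt]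
    then replaces [disk_pt i] by the image of [disk_pt (bar i)], and [act i] cancels as well. *)
Lemma rho_word i w c :
  rho (word_pt i w) (word_pt i (rcons w c)) = gap (last i w) c.
Proof.
elim: w i => [|j w IH] i /=.
  rewrite -{1}S_disk_pt; exact: rho_act (disk_ptP _) (disk_ptP _).
by rewrite (rho_act _ (word_ptP _ _) (word_ptP _ _)).
Qed.

Lemma gap_gt0 i j : adm i j -> 0 < gap i j.
Proof.
move=> ij; apply: rho_gt0 (disk_ptP _) (disk_ptP _) _ => e.
have := disk_with_boundary_mem (disk_ptP (bar i)); rewrite e => Dj.
move: ij; rewrite /adm.
by rewrite (D_disj Dj (disk_with_boundary_mem (disk_ptP j))) eqxx.
Qed.

Lemma word_len_rcons i w c :
  word_len i (rcons w c) = word_len i w + gap (last i w) c.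
Proof.
by elim: w i => [|j w IH] i /=; rewrite ?addr0 ?add0r// IH addrA.
Qed.

Lemma gap_bounds : exists m B : R, 0 < m /\
  forall i j, (adm i j -> m <= gap i j) /\ gap i j <= B.
Proof.
exists (\big[Num.min/1]_(p : I * I | adm p.1 p.2) gap p.1 p.2).
exists (\big[Num.max/0]_(p : I * I) gap p.1 p.2); split.
  elim/big_ind: _ => [|a b a0 b0|p ij]; rewrite ?ltr01// ?lt_min ?a0//.
  exact: gap_gt0.
move=> i j; split=> [ij|].
  by rewrite (bigD1 (i, j))//= ge_min lexx.
by rewrite (bigD1 (i, j))//= le_max lexx.
Qed.

Definition affine i := ~ D i None.

Lemma affine_word_disk i w : affine i -> path adm i w ->
  exists c (r : {nonneg R}),
    [/\ 0 < r%:num, word_disk i w = affine_closed_disk c r%:num,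
        word_pt i w = Some (eta v c r) & r%:num = word_rad i w].
Proof.
move=> ai iw; have [c [r [r0 pE DE]]] := word_ptP i w.
have rE : r%:num = word_rad i w.
  by rewrite /word_rad pE (eta_params_spec v c r0).1.
exists c, r; split=> //; case: DE => // DE.
case: ai; apply: (word_disk_sub iw); rewrite DE.
by case.
Qed.

Lemma word_rad_gt0 i w : affine i -> path adm i w -> 0 < word_rad i w.
Proof. by move=> ai iw; have [c [r [r0 _ _ <-]]] := affine_word_disk ai iw. Qed.

(** Appending a letter nests the new affine disk in the old one, with boundary points at distance
    [gap], so [rho_nested] multiplies the radius by [expR (- gap)]. *)
Lemma word_radE i w : affine i -> path adm i w ->
  word_rad i w = word_rad i [::] * expR (- word_len i w).
Proof.
move=> ai; elim/last_ind: w => [|w c IH]; first by rewrite /= oppr0 expR0 mulr1.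
move=> iwc; have /andP[iw lc] : path adm i w && adm (last i w) c
  by rewrite -rcons_path.
rewrite word_len_rcons opprD expRD mulrA -IH//.
have [a [r [r0 DE pE <-]]] := affine_word_disk ai iw.
have [b [s [s0 DE' pE' <-]]] := affine_word_disk ai iwc.
rewrite -(rho_word i w c) pE pE'; apply: (rho_nested r0 s0 _).1.
by rewrite -DE -DE' -cats1; apply: word_disk_cat; rewrite cats1.
Qed.

Lemma word_len_ge (m : R) i w : (forall i j, adm i j -> m <= gap i j) ->
  path adm i w -> (size w)%:R * m <= word_len i w.
Proof.
move=> mP; elim: w i => [|j w IH] i /=; first by rewrite mul0r.
by move=> /andP[ij jw]; rewrite -natr1 mulrDl mul1r addrC lerD ?mP ?IH.
Qed.

Definition word_act (w : seq I) (z : P1an v) : P1an v :=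
  foldr (fun i y => act i y) z w.

(** Points outside all [E j] form a fundamental domain; its translate by a reduced word lies in the
    disk of that word. *)
Lemma word_act_disk i w z : (forall j, ~ E j z) -> path adm i w ->
  word_disk i w (word_act (i :: w) z).
Proof.
move=> zE; elim: w i => [|j w IH] i /=.
  by move=> _; rewrite -S_E; exists z => //; exact: zE.
by move=> /andP[_ jw]; exists (word_act (j :: w) z) => //; exact: IH.
Qed.

Lemma disk_pt_notin_E i j : ~ E j (disk_pt i).
Proof.
move=> Ej; have := disk_with_boundary_mem (open_disk_ptP i); apply.
by rewrite {1}(D_disj (disk_with_boundary_mem (disk_ptP i)) (E_sub Ej)).
Qed.

(** The first letter is not counted in [size w]: these are the disks of words with [n + 1]
    letters. *)
Definition level n : set (P1an v) :=
  [set z | exists i w, [/\ path adm i w, size w = n & word_disk i w z]].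

Lemma level_closed n : closed (level n).
Proof.
have -> : level n = \bigcup_(p in [set p : I * seq I | path adm p.1 p.2 /\ size
  p.2 = n]) word_disk p.1 p.2.
  apply/seteqP; split=> z.
    by move=> [i [w [iw wn wz]]]; exists (i, w).
  by move=> [[i w] /= [iw wn] wz]; exists i, w.
apply: closed_bigcup => [|[i w] _]; last exact: disk_with_boundary_closed
  (word_ptP i w).
apply: (@sub_finite_set _ _ ([set: I] `*` [set w | (size w <= n)%N])).
  by move=> [i w] /= [_ ->].
by apply: finite_setX; [exact: finite_finset|exact: finite_seq_size].
Qed.

Lemma level_take n i w z : path adm i w -> (n <= size w)%N ->
  word_disk i w z -> level n z.
Proof.
move=> iw nw wz; exists i, (take n w); split.
- by move: iw; rewrite -{1}(cat_take_drop n w) cat_path => /andP[].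
- by rewrite size_takel.
- by apply: (@word_disk_cat i (take n w) (drop n w)); rewrite cat_take_drop.
Qed.

(** * The limit set and the nested word disks *)

Variable Gamma : set (PGL2 k).
Hypothesis Gamma_subgroup : subgroup Gamma.
Hypothesis Gamma_S : forall i, Gamma (S i).
Hypothesis Gamma_min : forall H, subgroup H -> (forall i, H (S i)) -> Gamma `<=`
  H.

Definition word_prod (w : seq I) : PGL2 k := foldr (fun i g =>
  (S i * g)%g) 1%g w.

Lemma word_prod_act w z : PGL2_act (word_prod w) z = word_act w z.
Proof.
elim: w => [|i w IH] /=; first exact: PGL2_act1.
by rewrite PGL2_actM IH.
Qed.

Lemma word_prod_Gamma w : Gamma (word_prod w).
Proof.
case: Gamma_subgroup => G1 GM _.
by elim: w => [|i w IH] //=; exact: GM.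
Qed.

Lemma word_prod_cat w w' : word_prod (w ++ w') = (word_prod w * word_prod w')%g.
Proof. by elim: w => [|i w IH] /=; rewrite ?mul1g// IH mulgA. Qed.

Lemma Gamma_word h : Gamma h -> exists2 w, sorted adm w & h = word_prod w.
Proof.
move=> Gh; have [w ->] : exists w, h = word_prod w.
  apply: (Gamma_min (H := [set h | exists w, h = word_prod w])) Gh; last first.
    by move=> i; exists [:: i]; rewrite /= mulg1.
  split.
  - by exists [::].
  - by move=> _ _ [w ->] [w' ->]; exists (w ++ w'); rewrite word_prod_cat.
  - move=> _ [w ->]; exists (rev (map bar w)).
    elim: w => [|i w IH] /=; first by rewrite invg1.
    by rewrite rev_cons -cats1 word_prod_cat -IH /= mulg1 S_bar invgM.
elim: w => [|i w [w' w'r IH]]; first by exists [::].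
rewrite /= IH; case: w' w'r {IH} => [|j w'] w'r; first by exists [:: i].
have [ij|ij] := eqVneq j (bar i); last by exists (i :: j :: w') => //=;
  apply/andP.
exists w'; first exact: path_sorted w'r.
by rewrite /= ij S_bar mulgA mulgV mul1g.
Qed.

(** A point of [E a] is the image under [S a] of a point outside [D (bar a)], again in the orbit. If
    no orbit point escapes the [E a], letters can be stripped off indefinitely. *)
Lemma orbit_level (x : P1an v) n :
  (forall y, orbit_of Gamma x y -> exists a, E a y) ->
  orbit_of Gamma x `<=` level n.
Proof.
case: Gamma_subgroup => _ GM GV.
move=> H; elim: n => [|n IH] y xy; have [a Ea] := H y xy.
  by exists a, [::]; split=> //; exact: E_sub.
have [z zD zy] : (act a @` (~` D (bar a))) y by rewrite S_D.
have xz : orbit_of Gamma x z.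
  case: xy => h Gh hx; exists ((S a)^-1 * h)%g; first by apply: GM => //;
    exact: GV.
  by rewrite PGL2_actM hx -zy PGL2_actK.
have [j [w [jw wn wz]]] := IH z xz.
exists a, (j :: w); split; rewrite /= ?wn//; last by exists z.
rewrite jw andbT; apply/eqP => ja; apply: zD; rewrite -ja.
exact: word_disk_sub wz.
Qed.

(** Either the orbit meets the fundamental domain, and all its points except those given by short
    words are in [level n], or it lies entirely in [level n]. Accumulation points stay there because
    the level is closed and finite sets do not accumulate. *)
Lemma limit_set_level n : limit_set Gamma `<=` level n.
Proof.
case: Gamma_subgroup => _ GM GV.
move=> z [x [_ zlim]].
have T1 : accessible_space (P1an v) := hausdorff_accessible (@P1an_hausdorff R k
  v).
suff [F [finF OF]] : exists F : set (P1an v),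
    finite_set F /\ orbit_of Gamma x `<=` F `|` level n.
  apply: contrapT => zn.
  have cF : closed ((F `\ z) `|` level n).
    apply: closedU; last exact: level_closed.
    have /accessible_finite_set_closed cfin := T1.
    by apply: cfin; exact: finite_setD.
  have nz : nbhs z (~` ((F `\ z) `|` level n)).
    by apply: open_nbhs_nbhs; split; [exact: closed_openC|case=> // -[_];
      apply].
  have [y [yz yO]] := zlim _ nz; apply.
  by case: (OF _ yO) => [Fy|]; [left; split=> // ; exact/eqP|right].
have [[y [[h Gh hx] yE]]|H] := pselect (exists y, orbit_of Gamma x y /\ forall
  a, ~ E a y); last first.
  exists set0; split=> // y yO; right; apply: (@orbit_level x) yO => y' y'O.
  by apply: contrapT => /forallNP yE; apply: H; exists y'.
exists ((fun w => word_act w y) @` [set w | (size w <= n)%N]); split.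
  by apply: finite_image; exact: finite_seq_size.
move=> _ [h' Gh' <-].
have [|w wr hE] := @Gamma_word (h' * h^-1)%g; first by apply: GM => //;
  exact: GV.
have -> : PGL2_act h' x = word_act w y.
  by rewrite -word_prod_act -hE PGL2_actM -hx PGL2_actK.
have [wn|nw] := leqP (size w) n; first by left; exists w.
right; case: w wr nw {hE} => [//|i w] /= iw nw.
apply: (level_take iw); first by rewrite -ltnS.
exact: (@word_act_disk i w).
Qed.

Lemma word_rad_small i (e : R) : affine i -> 0 < e ->
  exists N, forall w, path adm i w -> (N <= size w)%N -> word_rad i w < e.
Proof.
move=> ai e0; have [m [B [m0 mP]]] := gap_bounds.
have r0 : 0 < word_rad i [::] by exact: word_rad_gt0.
exists (Num.truncn (word_rad i [::] / (m * e))).+1 => w iw Nw.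
rewrite word_radE// expRN ltr_pdivrMr ?expR_gt0//.
have h : word_rad i [::] < (size w)%:R * m * e.
  rewrite -mulrA -ltr_pdivrMr ?mulr_gt0//.
  apply: lt_le_trans (_ : (Num.truncn (word_rad i [::] / (m * e))).+1%:R <= _).
    have /andP[_] := truncn_itv (divr_ge0 (ltW r0) (ltW (mulr_gt0 m0 e0))).
    exact.
  by rewrite ler_nat.
apply: lt_le_trans h _; rewrite mulrC ler_wpM2l ?(ltW e0)//.
apply: le_trans (word_len_ge (fun i j => (mP i j).1) iw) _.
by apply: le_trans (expR_ge1Dx _); rewrite lerDr.
Qed.

(** Since [T - l] divides [p - p(l)], the value of [p] at [y n] differs from [v p.[l]] by at most a
    constant times [r n]. *)
Lemma seminorm_near_type1 (y : nat -> A1an v) (l : k) (r : nat -> R) :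
  (forall n, y n ('X - l%:P) <= r n) -> r @ \oo --> (0 : R) ->
  y @ \oo --> eta v l 0%:nng.
Proof.
move=> yr r0; apply: A1an_cvgP => p.
have rn0 n : 0 <= r n by exact: le_trans (seminorm_ge0 _ _) (yr n).
have [B rB] : exists B : {nonneg R}, forall n, r n <= B%:num.
  have /cvg_seq_bounded/bounded_fun_has_ubound[B ub] : cvgn r by apply/cvg_ex;
    exists 0.
  have B0 : 0 <= B by apply: le_trans (rn0 0%N) _; apply: ub; exists 0%N.
  by exists (NngNum B0) => n; apply: ub; exists n.
have [q pq] : exists q, p - (p.[l])%:P = q * ('X - l%:P).
  by apply/factor_theorem; rewrite /root !hornerE subrr.
rewrite eta0E; apply/cvgrPdist_le => e e0.
have q0 : 0 < eta v l B q + 1 by rewrite ltr_wpDl ?seminorm_ge0.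
have /cvgr0_norm_le/(_ _ (divr_gt0 e0 q0)) := r0.
apply: filterS => n; rewrite ger0_norm// => rne.
have bnd : y n (p - (p.[l])%:P) <= e.
  rewrite pq seminormM mulrC.
  apply: (@le_trans _ _ (r n * (eta v l B q + 1))).
    rewrite ler_pM ?seminorm_ge0//.
    by rewrite (le_trans (le_eta q (le_trans (yr n) (rB n))))// lerDl.
  by rewrite -ler_pdivlMr.
rewrite /= ler_distl -(seminormC (y n)); apply/andP; split.
  rewrite lerBlDr -{1}[p](subrK (p.[l])%:P).
  by rewrite (le_trans (seminormD _ _ _))// addrC lerD2l.
have -> : (p.[l])%:P = p - (p - (p.[l])%:P) by rewrite subKr.
by rewrite (le_trans (seminormD _ _ _))// seminormN lerD2l.
Qed.

Hypothesis vcomplete : complete_abs v.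

Lemma ray_limit i (c : nat -> I) : affine i ->
  (forall n, path adm i (mkseq c n)) ->
  exists b : k, (forall n, word_disk i (mkseq c n) (P1_an v (Some b))) /\
    limit_set Gamma (P1_an v (Some b)).
Proof.
move=> ai ray; pose W := mkseq c.
have sizeW n : size (W n) = n by rewrite size_mkseq.
have [cn cnP] : exists cn : nat -> k, forall n,
    word_disk i (W n) = affine_closed_disk (cn n) (word_rad i (W n)).
  have := fun n => affine_word_disk ai (ray n).
  move=> /choice[cn cnP]; exists cn => n.
  by have [r [_ -> _ ->]] := cnP n.
have sub m n : (m <= n)%N -> word_disk i (W n) `<=` word_disk i (W m).
  move=> mn; have [w' WE] : exists w', W n = W m ++ w'.
    by rewrite /W /mkseq -(subnKC mn) iotaD map_cat; eexists.
  by rewrite WE; apply: word_disk_cat; rewrite -WE; exact: ray.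
have rad0 n : 0 <= word_rad i (W n) by apply/ltW/word_rad_gt0.
have cin m n : (m <= n)%N -> v (cn n - cn m) <= word_rad i (W m).
  move=> mn; have : word_disk i (W n) (P1_an v (Some (cn n))).
    by rewrite cnP affine_closed_disk_P1; exists (cn n); rewrite // subrr nabs0.
  by move=> /(sub _ _ mn); rewrite cnP affine_closed_disk_P1 => -[_ [<-]].
have small e : 0 < e -> exists N, forall n, (N <= n)%N -> word_rad i (W n) < e.
  move=> /(word_rad_small ai)[N NP]; exists N => n Nn.
  by apply: NP; [exact: ray|rewrite sizeW].
have [|l lP] := vcomplete (u := cn).
  move=> e e0; have [N NP] := small e e0; exists N => m n Nm Nn.
  have -> : cn m - cn n = (cn m - cn N) - (cn n - cn N)
    by rewrite opprB addrA subrK.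
  apply: le_lt_trans (NP N (leqnn N)).
  by rewrite (le_trans (nabsD_max _ _ _))// ge_max nabsN !cin.
have lin n : word_disk i (W n) (P1_an v (Some l)).
  rewrite cnP affine_closed_disk_P1; exists l => //.
  have [N NP] := lP _ (word_rad_gt0 ai (ray n)).
  have -> : l - cn n = - (cn (maxn N n) - l) + (cn (maxn N n) - cn n).
    by rewrite opprB addrA subrK.
  rewrite (le_trans (nabsD_max _ _ _))// ge_max nabsN cin ?leq_maxr// andbT.
  by rewrite ltW// NP// leq_maxl.
exists l; split=> //.
(* These orbit points lie in the shrinking disks and, as boundary points, have positive radius, so
   they converge to the point [l] of type 1 without reaching it. *)
pose y0 n := word_act (i :: W n) (disk_pt i).
have y0D n : word_disk i (W n) (y0 n).
  by apply: word_act_disk (ray n) => j; exact: disk_pt_notin_E.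
have y0G n : orbit_of Gamma (disk_pt i) (y0 n).
  exists (word_prod (i :: W n)); first exact: word_prod_Gamma.
  exact: word_prod_act.
have y0E n : exists a (r : {nonneg R}), 0 < r%:num /\ y0 n = Some (eta v a r).
  have := disk_with_boundary_act (word_prod (i :: W n)) (disk_ptP i).
  by rewrite word_prod_act => -[a [r [r0 yE _]]]; exists a, r.
have y0l n : y0 n <> P1_an v (Some l).
  have [a [r [r0 ->]]] := y0E n; move=> /Some_inj/eta_eq[rE _].
  by rewrite rE ltxx in r0.
have [y yP] : exists y : nat -> A1an v, forall n, Some (y n) = y0 n.
  have : forall n, exists y : A1an v, Some y = y0 n.
    by move=> n; have [a [r [_ ->]]] := y0E n; exists (eta v a r).
  by move=> /choice[y yP]; exists y.
have yr n : y n ('X - l%:P) <= word_rad i (W n).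
  have := y0D n; rewrite -yP cnP => -[_ /[swap] /Some_inj -> /= yc].
  have -> : 'X - l%:P = ('X - (cn n)%:P) - (l - cn n)%:P.
    by rewrite polyCB opprB addrA subrK.
  rewrite (le_trans (seminormD_max _ _ _))// ge_max yc seminormN seminormC /=.
  by have := lin n; rewrite cnP affine_closed_disk_P1 => -[_ [<-]].
have rad_cvg : (fun n => word_rad i (W n)) @ \oo --> (0 : R).
  apply/cvgrPdist_lt => e e0; have [N NP] := small e e0.
  by exists N => // n /= Nn; rewrite sub0r normrN ger0_norm// NP.
have ycvg : (fun n => Some (y n) : P1an v) @ \oo --> P1_an v (Some l).
  apply: (cvg_comp y (Some : A1an v -> P1an v) (seminorm_near_type1 yr
    rad_cvg)).
  exact: one_point_compactification_some_continuous.
exists (disk_pt i); split; last first.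
  move=> U /ycvg[N _ NU]; exists (Some (y N)).
  by rewrite yP; split=> //; [exact/eqP/y0l|rewrite -yP; apply: NU => /=].
(* An orbit reduced to one point would make the sequence constant, hence equal to its limit of type
   1. *)
move=> orb; have const n : Some (y n) = disk_pt i.
  by have := y0G n; rewrite orb yP.
have : disk_pt i = P1_an v (Some l).
  apply: (cvg_unique (@P1an_hausdorff R k v) _ ycvg).
  rewrite (_ : (fun n => _) = fun=> disk_pt i); first exact: cvg_cst.
  by apply/funext.
by rewrite -(const 0%N) yP => /y0l.
Qed.

Hypothesis avoid : forall i j : I, exists l, l != i /\ l != j.

Local Notation dS := (spherical_dist v).
Local Notation Lambda := (P1_an v @^-1` limit_set Gamma).

(** By disjointness at most one disk contains infinity, so only its letter and [bar c] have to be
    avoided. *)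
Lemma affine_pred c : exists2 a, affine a & adm a c.
Proof.
have [[b Db]|H] := pselect (exists b, D b None); last first.
  have [a [ac _]] := avoid (bar c) c; exists a.
    by move=> Da; apply: H; exists a.
  by rewrite /adm; apply: contra ac => /eqP ->; rewrite barK.
have [a [ac ab]] := avoid (bar c) b; exists a.
  by move=> Da; rewrite (D_disj Da Db) eqxx in ab.
by rewrite /adm; apply: contra ac => /eqP ->; rewrite barK.
Qed.

(* If [D i] contains infinity, move it by [S a] into an affine disk. *)
Lemma word_disk_diameter : exists2 C : R, 0 < C & forall i w, path adm i w ->
  forall x y : @P1 k, word_disk i w (P1_an v x) -> word_disk i w (P1_an v y) ->
    dS x y <= C * expR (- word_len i w).
Proof.
have H i : exists C : R, 0 < C /\ forall w, path adm i w ->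
  forall x y : @P1 k, word_disk i w (P1_an v x) -> word_disk i w (P1_an v y) ->
    dS x y <= C * expR (- word_len i w).
  have [a aff ai] := affine_pred i.
  have [C C0 CP] := spherical_dist_lipschitz (v := v) (S a)^-1%g.
  have r0 : 0 < word_rad a [::] by exact: word_rad_gt0.
  exists (C * word_rad a [::]); split=> [|w iw x y wx wy]; first
    by rewrite mulr_gt0.
  have aiw : path adm a (i :: w) by rewrite /= ai.
  have [c [r [rgt0 DE _ rE]]] := affine_word_disk aff aiw.
  have [x' xx'] := PGL2_act_P1 (v := v) (S a) x.
  have [y' yy'] := PGL2_act_P1 (v := v) (S a) y.
  have : word_disk a (i :: w) (P1_an v x') by rewrite -xx'; exists (P1_an v x).
  rewrite DE affine_closed_disk_P1 => -[b xE br].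
  have : word_disk a (i :: w) (P1_an v y') by rewrite -yy'; exists (P1_an v y).
  rewrite DE affine_closed_disk_P1 => -[b' yE br'].
  apply: (@le_trans _ _ (C * dS x' y')).
    by apply: CP; rewrite -?xx' -?yy' PGL2_actK.
  rewrite -mulrA ler_wpM2l ?(ltW C0)// xE yE.
  apply: (le_trans (spherical_dist_le _ _)); apply: (@le_trans _ _ r%:num).
    have -> : b - b' = (b - c) - (b' - c) by rewrite opprB addrA subrK.
    by rewrite (le_trans (nabsD_max _ _ _))// ge_max nabsN br.
  rewrite rE word_radE// ler_wpM2l ?(ltW r0)// ler_expR lerN2 /=.
  by rewrite lerDr ltW// gap_gt0.
have [C CP] := choice H.
exists (1 + \sum_i C i).
  by rewrite ltr_pwDl// sumr_ge0// => i _; apply/ltW; case: (CP i).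
move=> i w iw x y wx wy; have [_ Ci] := CP i.
apply: (le_trans (Ci w iw x y wx wy)); rewrite ler_wpM2r ?expR_ge0//.
rewrite (bigD1 i)//= addrCA lerDl addr_ge0// sumr_ge0// => j _.
by apply/ltW; case: (CP j).
Qed.

(** * Upper bound from a supersolution *)

Section UpperBound.
Variables (s : R) (u : I -> R).
Hypothesis u_gt0 : forall i, 0 < u i.
Hypothesis u_super : forall i,
  \sum_(j | adm i j) expR (- s * gap i j) * u j <= u i.

(** The left side is the [n]-th iterate of the matrix applied to [u], and each iteration decreases
    [u]. *)
Lemma word_sum_le n i :
  \sum_(w : n.-tuple I) (if path adm i w then expR (- s * word_len i w) * u
    (last i w) else 0)
  <= u i.
Proof.
elim: n i => [|n IH] i.
  rewrite (bigD1 [tuple])//= mulr0 expR0 mul1r big1 ?addr0//.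
  by move=> t /eqP[]; rewrite [t]tuple0.
rewrite (sum_tuple_cons n (fun w => if path adm i w then expR (- s * word_len i
  w) * u (last i w) else 0)).
apply: le_trans (u_super i); rewrite [leRHS]big_mkcond /=.
apply: ler_sum => j _; case: ifP => ij; last by rewrite big1.
apply: le_trans (ler_wpM2l (expR_ge0 _) (IH j)); rewrite mulr_sumr.
apply: ler_sum => w _ /=; case: ifP => _; last by rewrite mulr0.
by rewrite mulrDr expRD mulrA.
Qed.

Lemma hausdorff_upper t : 0 <= s -> s < t -> hausdorff_measure dS t Lambda = 0.
Proof.
move=> s0 st; have t0 : 0 < t by exact: le_lt_trans st.
apply: hausdorff_measure_eq0 (ltW t0) _; first exact: spherical_dist_ge0.
move=> e delta e0 delta0.
have [C C0 CP] := word_disk_diameter.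
have [m [B [m0 mP]]] := gap_bounds.
have [um um0 umP] : exists2 um : R, 0 < um & forall i, um <= u i.
  exists (\big[Num.min/1]_i u i).
    by elim/big_ind: _ => // a b a0 b0; rewrite lt_min a0.
  by move=> i; rewrite (bigD1 i)//= ge_min lexx.
pose U0 := \sum_i u i.
have U00 : 0 <= U0 by apply: sumr_ge0 => i _; exact: ltW.
have ts0 : 0 < (t - s) * m by rewrite mulr_gt0// subr_gt0.
have Ct0 : 0 < C `^ t by exact: powR_gt0.
have K0 : 0 < C `^ t * (U0 / um) + 1.
  by rewrite ltr_wpDl// mulr_ge0 ?(ltW Ct0)// divr_ge0// ltW.
have [N1 N1P] := expR_small m0 (divr_gt0 delta0 C0).
have [N2 N2P] := expR_small ts0 (divr_gt0 e0 K0).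
(* [N1] brings the diameters below [delta], [N2] the total gauge below [e]. *)
pose n := maxn N1 N2.
have len_ge i (w : n.-tuple I) : path adm i w -> n%:R * m <= word_len i w.
  by move=> iw; rewrite -{1}(size_tuple w); apply: word_len_ge iw => a b;
    case: (mP a b).
exists (I * n.-tuple I)%type.
exists (fun p : I * n.-tuple I => [set x : @P1 k | path adm p.1 p.2 /\ word_disk
  p.1 p.2 (P1_an v x)]).
exists (fun p : I * n.-tuple I => if path adm p.1 p.2 then C * expR (- word_len
  p.1 p.2) else 0).
split.
- move=> x /(@limit_set_level n)[i [w [iw wn wx]]].
  have wn' : size w == n by apply/eqP.
  by exists (i, Tuple wn').
- move=> [i w] /=; case: ifP => iw; last by rewrite lexx ltW.
  rewrite mulr_ge0 ?(ltW C0) ?expR_ge0//= mulrC -ler_pdivlMr//.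
  apply: le_trans (N1P n (leq_maxl _ _)).
  by rewrite ler_expR lerN2 len_ge.
- by move=> [i w] x y /= [iw wx] [_ wy]; rewrite iw; exact: CP.
have tn0 : t != 0 by rewrite gt_eqF.
(* With [l] the length of a word, [expR (- t l)] splits into [expR (- (t - s) l)], which decays with
   [n] since [l >= n m], and [expR (- s l)], which [word_sum_le] sums after insertion of the factor
   [u / um >= 1]. *)
apply: (@le_trans _ _ (C `^ t * (expR (- (n%:R * ((t - s) * m))) * (U0 / um))));
  last first.
  rewrite mulrCA; apply: (@le_trans _ _ (e / (C `^ t * (U0 / um) + 1) * (C `^ t
    * (U0 / um) + 1))).
    rewrite ler_pM ?expR_ge0//; first by rewrite mulr_ge0 ?(ltW Ct0)//
      divr_ge0// ltW.
      exact: N2P (leq_maxr _ _).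
    by rewrite lerDl.
  by rewrite divfK ?gt_eqF.
have -> : U0 / um = \sum_i u i / um by rewrite mulr_suml.
rewrite mulrA mulr_sumr.
rewrite -(pair_big predT predT (fun i (w : n.-tuple I) =>
  (if path adm i w then C * expR (- word_len i w) else 0) `^ t)) /=.
apply: ler_sum => i _.
apply: le_trans (ler_wpM2l _ (ler_wpM2r _ (@word_sum_le n i))); last 2 first.
- by rewrite mulr_ge0 ?expR_ge0 ?(ltW Ct0).
- by rewrite invr_ge0 ltW.
rewrite mulr_suml mulr_sumr; apply: ler_sum => w _.
case: ifP => iw; last by rewrite powR0// mul0r mulr0.
rewrite powRM ?expR_ge0 ?(ltW C0)// -expRM -!mulrA ler_wpM2l ?(ltW Ct0)//.
rewrite mulrA -expRD -[leLHS]mulr1 ler_pM ?expR_ge0 ?ler01//; last first.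
  by rewrite ler_pdivlMr// mul1r.
rewrite ler_expR.
have := ler_wpM2l (ltW (_ : 0 < t - s)) (len_ge i w iw); rewrite subr_gt0 =>
  /(_ st).
by rewrite mulrCA; lra.
Qed.

End UpperBound.

(** * Lower bound from a subsolution *)

Section LowerBound.
Variables (s : R) (u : I -> R).
Hypothesis s_gt0 : 0 < s.
Hypothesis u_gt0 : forall i, 0 < u i.
Hypothesis u_sub : forall i,
  u i <= \sum_(j | adm i j) expR (- s * gap i j) * u j.

Variable a : I.
Hypothesis aff : affine a.

Let mu w := expR (- s * word_len a w) * u (last a w).

Let mu_ge0 w : 0 <= mu w.
Proof. by rewrite mulr_ge0 ?expR_ge0// ltW. Qed.

Let mu_sub w : path adm a w ->
  mu w <= \sum_(c | adm (last a w) c) mu (rcons w c).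
Proof.
move=> _; apply: le_trans (ler_wpM2l (expR_ge0 _) (u_sub (last a w))) _.
rewrite mulr_sumr; apply: ler_sum => c _.
by rewrite /mu word_len_rcons last_rcons mulrDr expRD mulrA.
Qed.

(** The points that carry the mass: those of [D a] coded by an infinite word. A lower bound may
    ignore the rest of the limit set. *)
Let ray_point (x : @P1 k) := exists c : nat -> I, forall n,
  path adm a (mkseq c n) /\ word_disk a (mkseq c n) (P1_an v x).

(* The smallest word disk containing [U] has radius comparable with the diameter
   of [U], unless [U] reduces to a point, which lies in disks of arbitrarily
   small mass. *)
Lemma covering_word : exists2 K : R, 0 < K & forall (U : set (@P1 k)) (e : R),
  0 < e -> exists ow : option (seq I),
    (forall x, U x -> ray_point x ->
       exists2 w, ow = Some w & word_disk a w (P1_an v x)) /\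
    (forall w, ow = Some w -> path adm a w /\
       ((mu w)%:E <= K%:E * hausdorff_gauge dS s U + e%:E)%E).
Proof.
have [m [B [m0 mP]]] := gap_bounds.
have [uM uM0 uMP] : exists2 uM : R, 0 < uM & forall i, u i <= uM.
  exists (\sum_i u i).
    rewrite (bigD1 a)//= ltr_pwDl// sumr_ge0// => i _; exact: ltW.
  by move=> i; rewrite (bigD1 i)//= lerDl sumr_ge0// => j _; exact: ltW.
have [ca [ra [ra0 DaE _ raE]]] := affine_word_disk (w := [::]) aff isT.
(* [Q] bounds the coordinates of the points of [D a]; there the spherical distance is at least
   [v (x - y) / Q ^ 2]. *)
pose Q := Num.max 1 (Num.max (v ca) ra%:num).
have Q1 : 1 <= Q by rewrite le_max lexx.
have Q0 : 0 < Q by exact: lt_le_trans Q1.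
have inQ b : word_disk a [::] (P1_an v (Some b)) -> v b <= Q.
  rewrite DaE affine_closed_disk_P1 => -[_ [<-] br].
  have -> : b = (b - ca) + ca by rewrite subrK.
  rewrite (le_trans (nabsD_max _ _ _))// ge_max /Q !le_max lexx !orbT andbT.
  by rewrite br !orbT.
(* The diameter is compared with the radius of the next disk along the ray, which costs at most one
   more gap, bounded by [B]; [Q ^ 2] passes to the spherical metric. *)
pose ka := ra%:num * expR (- B) / Q ^+ 2.
have ka0 : 0 < ka by rewrite divr_gt0 ?exprn_gt0// mulr_gt0 ?expR_gt0.
have kas0 : 0 < ka `^ s by exact: powR_gt0.
exists (uM / ka `^ s); first by rewrite divr_gt0.
move=> U e e0.
have [[x0 [Ux0 x0r]]|H] := pselect (exists x, U x /\ ray_point x); last first.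
  by exists None; split=> // x Ux xr; case: H; exists x.
have [c cP] := x0r.
(* When no disk along the ray separates the ray points of [U], the gauge gives no control, and the
   additive [e] pays for a long prefix of the ray. *)
have [H|H] := pselect (forall n x, U x -> ray_point x ->
    word_disk a (mkseq c n) (P1_an v x)).
  have sm0 : 0 < s * m by rewrite mulr_gt0.
  have [N NP] := expR_small sm0 (divr_gt0 e0 uM0).
  exists (Some (mkseq c N)); split=> [x Ux xr|_ [<-]].
    by exists (mkseq c N) => //; exact: H.
  have [aw _] := cP N; split=> //.
  apply: (@le_trans _ _ e%:E); last first.
    by rewrite leeDr// mule_ge0 ?hausdorff_gauge_ge0// lee_fin divr_ge0 ?ltW.
  rewrite lee_fin /mu; apply: (@le_trans _ _ (e / uM * uM)); last
    by rewrite divfK ?gt_eqF.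
  rewrite ler_pM ?expR_ge0 ?(ltW (u_gt0 _))//.
  apply: le_trans (NP N (leqnn N)); rewrite ler_expR mulNr lerN2.
  have := word_len_ge (fun i j => (mP i j).1) aw; rewrite size_mkseq.
  by move=> /(ler_wpM2l (ltW s_gt0)); rewrite mulrCA.
pose bad n := `[< exists x, [/\ U x, ray_point x & ~ word_disk a (mkseq c n)
  (P1_an v x)] >].
have exbad : exists n, bad n.
  move/existsNP: H => [n /existsNP[x /not_implyP[Ux /not_implyP[xr xw]]]].
  by exists n; apply/asboolP; exists x.
(* The least bad index is not 0 because all ray points lie in [D a]; its predecessor gives the
   smallest disk along the ray that still contains them. *)
case: (ex_minnP exbad) => -[|n] /asboolP[x1 [Ux1 x1r x1w]] nmin.
  by have [c1 /(_ 0%N)[_]] := x1r.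
have good x : U x -> ray_point x -> word_disk a (mkseq c n) (P1_an v x).
  move=> Ux xr; apply: contrapT => xw.
  by have /nmin : bad n by [apply/asboolP; exists x]; rewrite ltnn.
exists (Some (mkseq c n)); split=> [x Ux xr|_ [<-]].
  by exists (mkseq c n) => //; exact: good.
have [aw _] := cP n; have [aw1 x0w1] := cP n.+1; split=> //.
have [p [r [r0 DE _ rE]]] := affine_word_disk aff aw1.
have [c1 /(_ 0%N)[_ x1a]] := x1r; have [_ x0a] := cP 0%N.
move: x0w1; rewrite DE affine_closed_disk_P1 => -[b0 x0E b0r].
move: x1w; rewrite DE affine_closed_disk_P1 => x1w.
have [b1 x1E] : exists b1, x1 = Some b1.
  by move: x1a; rewrite DaE affine_closed_disk_P1 => -[b1 -> _]; exists b1.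
have b1r : r%:num < v (b1 - p).
  by rewrite ltNge; apply/negP => b1r; apply: x1w; exists b1.
(* Ultrametricity: [x0] is in the disk and [x1] is not, so their distance exceeds the radius. *)
have dist : r%:num < v (b1 - b0).
  have -> : b1 - b0 = (b1 - p) - (b0 - p) by rewrite opprB addrA subrK.
  by rewrite nabsD_dom// nabsN (le_lt_trans b0r).
have rlow : ra%:num * expR (- B) * expR (- word_len a (mkseq c n)) <= r%:num.
  rewrite rE word_radE// mkseqS word_len_rcons opprD expRD raE.
  rewrite -!mulrA ler_wpM2l ?(ltW (word_rad_gt0 _ _))// mulrC ler_wpM2l
    ?expR_ge0//.
  by rewrite ler_expR lerN2; case: (mP (last a (mkseq c n)) (c n)).
have dlow : ka * expR (- word_len a (mkseq c n)) <= dS x1 x0.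
  rewrite x1E x0E; apply: le_trans (spherical_dist_ge Q1 _ _); last 2 first.
  - by apply: inQ; rewrite -x1E.
  - by apply: inQ; rewrite -x0E.
  rewrite /ka mulrAC ler_wpM2r ?invr_ge0 ?exprn_ge0 ?(ltW Q0)//.
  exact: le_trans rlow (ltW dist).
have glow : (((ka * expR (- word_len a (mkseq c n))) `^ s)%:E <= hausdorff_gauge
  dS s U)%E.
  apply: le_trans (hausdorff_gauge_ge (spherical_dist_ge0 (v :=
    v)) (ltW s_gt0) Ux1 Ux0).
  rewrite lee_fin ge0_ler_powR ?nnegrE ?(ltW s_gt0) ?spherical_dist_ge0//.
  by rewrite mulr_ge0 ?expR_ge0// ltW.
apply: (@le_trans _ _ ((uM / ka `^ s)%:E * hausdorff_gauge dS s U)%E);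
  last first.
  by rewrite leeDl// lee_fin ltW.
apply: le_trans (lee_wpmul2l _ glow); last by rewrite lee_fin divr_ge0 ?ltW.
rewrite -EFinM lee_fin /mu (powRM s (ltW ka0) (expR_ge0 _)) -expRM.
rewrite mulrA divfK ?gt_eqF// mulrC ler_pM ?expR_ge0 ?(ltW (u_gt0 _))//.
by rewrite ler_expR le_eqVlt; apply/orP; left; apply/eqP; ring.
Qed.

Lemma hausdorff_lower : (0 < hausdorff_measure dS s Lambda)%E.
Proof.
have [K K0 KP] := covering_word.
have ua := u_gt0 a.
(* A cover of total gauge below this constant yields words of total mass below [u a / 2 + u a / 4],
   where the second term collects the errors [e / 2 ^ (n + 1)]. This is less than [mu [::] = u a],
   so some ray escapes. *)
have c0 : 0 < u a / (2 * K) by rewrite divr_gt0// mulr_gt0.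
apply: (hausdorff_measure_gt0 c0) => U LU; rewrite leNgt; apply/negP => lt.
pose e := u a / 4.
have e0 : 0 < e by rewrite divr_gt0.
have en0 n : 0 < e / (2 ^ n.+1)%:R by rewrite divr_gt0// ltr0n expn_gt0.
have [W WP] := choice (fun n => KP (U n) _ (en0 n)).
have [|c cP] := @escaping_ray R I adm a mu mu_ge0 mu_sub W.
  apply: (@le_lt_trans _ _ (\sum_(n <oo) (K%:E * hausdorff_gauge dS s (U n) +
      (e / (2 ^ n.+1)%:R)%:E))%E).
    apply: lee_nneseries => n _.
      by case: (W n) => // w; rewrite lee_fin.
    have [_ Wn] := WP n; case: (W n) Wn => [w /(_ w erefl)[]//|_].
    by rewrite adde_ge0 ?mule_ge0 ?lee_fin ?hausdorff_gauge_ge0// ltW.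
  apply: le_lt_trans (epsilon_trick _ _ (ltW e0)) _.
    by move=> n; rewrite mule_ge0 ?lee_fin ?hausdorff_gauge_ge0// ltW.
  rewrite nneseriesZl; last by move=> n _; exact: hausdorff_gauge_ge0.
  apply: (@le_lt_trans _ _ (K%:E * (u a / (2 * K))%:E + e%:E)%E).
    by apply: leeD2r; apply: lee_wpmul2l; [rewrite lee_fin;
      exact: ltW|exact: ltW].
  rewrite -EFinM -EFinD lte_fin /mu /= mulr0 expR0 mul1r /e.
  have -> : K * (u a / (2 * K)) = u a / 2 by field; rewrite gt_eqF.
  lra.
(* The limit of the escaping ray lies in some [U n]. The word attached to [U n] has a disk
   containing this point, and disjointness of the disks of equal length makes that word a prefix of
   the ray. *)
have [b [bw bL]] := ray_limit aff (fun n => (cP n).1).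
have [n _ Ub] := LU (Some b) bL.
have br : ray_point (Some b) by exists c => m; split; [case: (cP m)|].
have [/(_ _ Ub br)[w Wn wb] /(_ w) Wn'] := WP n.
have [aw _] := Wn' Wn.
have [aw' cw] := cP (size w); apply: (cw n); rewrite Wn; congr Some.
have := word_disk_disj aw aw' _ wb (bw (size w)); rewrite size_mkseq.
by move=> /(_ erefl)[].
Qed.

End LowerBound.

Lemma limit_set_nonempty (i : I) : Lambda !=set0.
Proof.
have [a aff _] := affine_pred i.
have nx j : exists l, adm j l by have [l [lj _]] := avoid (bar j) j; exists l.
have [next nP] := choice nx.
pose c n := iter n.+1 next a.
have cP n : path adm a (mkseq c n) /\ last a (mkseq c n) = iter n next a.
  elim: n => // n [IH lE]; rewrite mkseqS last_rcons rcons_path IH lE.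
  by split=> //; exact: nP.
have [b [_ bL]] := ray_limit aff (fun n => (cP n).1).
by exists (Some b).
Qed.

(** * Comparison of the eigenvalue with 1 *)

Section Dimension.
Variables (s c : R) (u : I -> R).
Hypothesis s_ge0 : 0 <= s.
Hypothesis u_gt0 : forall i, 0 < u i.
Hypothesis u_eigen : forall i,
  \sum_(j | adm i j) expR (- s * gap i j) * u j = c * u i.

Let sum_le (t C : R) i : (forall j, adm i j -> expR (- t * gap i j) <= C * expR
  (- s * gap i j)) ->
  \sum_(j | adm i j) expR (- t * gap i j) * u j <= C * (c * u i).
Proof.
move=> H; rewrite -u_eigen mulr_sumr; apply: ler_sum => j ij.
by rewrite mulrA ler_wpM2r ?H// ltW.
Qed.

Let sum_ge (t C : R) i : (forall j, adm i j -> C * expR (- s * gap i j) <= expR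
  (- t * gap i j)) ->
  C * (c * u i) <= \sum_(j | adm i j) expR (- t * gap i j) * u j.
Proof.
move=> H; rewrite -u_eigen mulr_sumr; apply: ler_sum => j ij.
by rewrite mulrA ler_wpM2r ?H// ltW.
Qed.

Let dim_le t : 0 <= t ->
  (forall i, \sum_(j | adm i j) expR (- t * gap i j) * u j <= u i) ->
  (hausdorff_dim dS Lambda <= t%:E)%E.
Proof.
move=> t0 H; apply: hausdorff_dim_le => // t' tt'.
exact: hausdorff_upper u_gt0 H _ t0 tt'.
Qed.

Let dim_ge (i0 : I) t :
  (forall i, u i <= \sum_(j | adm i j) expR (- t * gap i j) * u j) ->
  (t%:E <= hausdorff_dim dS Lambda)%E.
Proof.
move=> H; apply: hausdorff_dim_ge => t'; rewrite le_eqVlt =>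
  /predU1P[<- _|t'0 t't].
  exact: hausdorff_measure0_gt0 (limit_set_nonempty i0).
have [a aff _] := affine_pred i0.
apply: (hausdorff_lower t'0 u_gt0 _ aff) => i.
apply: (le_trans (H i)); apply: ler_sum => j ij;
  rewrite ler_wpM2r ?(ltW (u_gt0 _))//.
by rewrite ler_expR ler_wpM2r ?lerN2 ?(ltW t't)// ltW// gap_gt0.
Qed.

Lemma hausdorff_dim_eigen (i0 : I) : hausdorff_dim dS Lambda = s%:E <-> c = 1.
Proof.
have [m [B0 [m0 mP]]] := gap_bounds.
pose B := Num.max B0 1.
have gB i j : gap i j <= B by rewrite le_max (mP i j).2.
have Bgt0 : 0 < B by rewrite lt_max ltr01 orbT.
have c0 : 0 < c.
  rewrite -(pmulr_lgt0 c (u_gt0 i0)) -u_eigen.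
  have [j [ij _]] := avoid (bar i0) i0.
  rewrite (bigD1 j)//= ltr_pwDl ?mulr_gt0 ?expR_gt0//.
  by apply: sumr_ge0 => l _; rewrite mulr_ge0 ?expR_ge0// ltW.
split=> [dimE|c1]; last first.
  apply/eqP; rewrite eq_le; apply/andP; split.
    by apply: dim_le => // i; rewrite u_eigen c1 mul1r.
  by apply: (dim_ge i0) => i; rewrite u_eigen c1 mul1r.
apply/eqP; rewrite eq_le; apply/andP; split; rewrite leNgt; apply/negP.
- move=> c1; pose e := ln c / B.
  have e0 : 0 < e by rewrite divr_gt0// ln_gt0.
  have : ((s + e)%:E <= hausdorff_dim dS Lambda)%E.
    apply: (dim_ge i0) => i.
    apply: le_trans (sum_ge (C := c^-1) _); first by rewrite mulKf ?gt_eqF.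
    move=> j ij; rewrite -[c]lnK ?posrE// -expRN -expRD ler_expR.
    have -> : ln c = e * B by rewrite divfK ?gt_eqF.
    by have := ler_wpM2l (ltW e0) (gB i j); lra.
  by rewrite dimE lee_fin gerDl leNgt e0.
(* The exponent cannot be lowered below 0. At [s = 0] the admissible entries are 1, and the row of a
   smallest coordinate of [u] already gives [c >= 1]. *)
move=> c1; have [sE|sn0] := eqVneq s 0.
  case: (@arg_minP _ _ I i0 predT u isT) => i _ imin.
  have [j [ij _]] := avoid (bar i) i.
  have := u_eigen i; rewrite (bigD1 j)//= sE oppr0 mul0r expR0 mul1r => uE.
  have : u i <= c * u i.
    rewrite -uE; apply: (le_trans (imin j isT)); rewrite lerDl.
    by apply: sumr_ge0 => l _; rewrite mulr_ge0 ?expR_ge0// ltW.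
  by rewrite ler_pMl// leNgt c1.
have s0 : 0 < s by rewrite lt_def sn0.
(* The minimum with [s] keeps [s - e] nonnegative; the other bound makes the entries grow by a
   factor at most [1 / c]. *)
pose e := Num.min s (- ln c / B).
have e0 : 0 < e by rewrite lt_min s0 divr_gt0// oppr_gt0 ln_lt0// c0.
have es : e <= s by rewrite ge_min lexx.
have eB : e * B <= - ln c by rewrite -ler_pdivlMr// ge_min lexx orbT.
have : (hausdorff_dim dS Lambda <= (s - e)%:E)%E.
  apply: dim_le => [|i]; first by rewrite subr_ge0.
  apply: le_trans (sum_le (C := c^-1) _) _; last by rewrite mulKf ?gt_eqF.
  move=> j ij; rewrite -[c]lnK ?posrE// -expRN -expRD ler_expR.
  by have := ler_wpM2l (ltW e0) (gB i j); lra.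
by rewrite dimE lee_fin lerDl oppr_ge0 leNgt e0.
Qed.

End Dimension.

End SchottkyDynamics.

(** * Bases of Schottky groups *)

(** If [h] has square 1, a representative has scalar square [c], and every eigenvalue [z] satisfies
    [w z ^ 2 = v c], so all eigenvalues have the same absolute value. *)
Lemma loxodromic_not_involution (R : realType) (k : fieldType)
    (v : nonarch_abs R k) (h : PGL2 k) : loxodromic v h -> (h * h)%g != 1%g.
Proof.
move=> [L [w [wv [x [y [ex ey xy]]]]]]; apply/eqP => hh.
have [c c0 MM] : exists2 c : k, c != 0 & val (repr h) *m val (repr h) = c%:M.
  have e : (\pi_(PGL2 k)%qT (GL2_mul (repr h) (repr h)) == \pi_(PGL2 k)%qT
    (GL2_one k)).
    by apply/eqP; exact: hh.
  have [c c0 /= cE] := PGL2_eqP _ _ e; exists c => //.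
  by rewrite cE scalemx1.
set M := map_mx _ _ in ex ey.
have sq z : eigenvalue M z -> w z ^+ 2 = v c.
  move=> /eigenvalueP[u uM u0].
  have : u *m (M *m M) = z ^+ 2 *: u.
    by rewrite mulmxA uM -scalemxAl uM scalerA expr2.
  rewrite -map_mxM MM map_scalar_mx mul_mx_scalar => /eqP.
  rewrite -subr_eq0 -scalerBl scaler_eq0 (negPf u0) orbF subr_eq0 => /eqP zc.
  by rewrite -nabsX -zc -wv.
move/eqP: xy; apply; apply/eqP.
by rewrite -(eqrXn2 (n := 2)) ?nabs_ge0// !sq.
Qed.

Lemma subgroup_smallest (G : groupType) (A : set G) : subgroup (smallest
  (@subgroup G) A).
Proof.
split.
- by move=> H [[]].
- by move=> g h Ag Ah H HP; have [[_ HM _] _] := HP; apply: HM;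
  [exact: Ag|exact: Ah].
- by move=> g Ag H HP; have [[_ _ HV] _] := HP; apply: HV; exact: Ag.
Qed.

Lemma generates_drop (G : groupType) n (gamma : 'I_n -> G) (H : set G) (j :
  'I_n) :
  generates gamma H ->
  (forall K, subgroup K -> (forall i, i != j -> K (gamma i)) -> K (gamma j)) ->
  generates (fun l => gamma (lift j l)) H.
Proof.
rewrite /generates => -> Kj.
have sG A := @subgroup_smallest G A.
have in_gen i : i != j -> smallest (@subgroup G) (range (fun l =>
  gamma (lift j l))) (gamma i).
  have [l -> _|->] := unliftP j i; last by rewrite eqxx.
  by move=> K [_]; apply; exists l.
apply/seteqP; split; apply: smallest_sub => //.
  move=> _ [i _ <-]; have [->|/in_gen//] := eqVneq i j.
  by apply: Kj => // l; exact: in_gen.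
by move=> _ [l _ <-] K [_]; apply; exists (lift j l).
Qed.

Section BasisLetters.
Context {R : realType} {k : fieldType} {v : nonarch_abs R k}.
Variables (Gamma : set (PGL2 k)) (g : nat) (gamma : 'I_g -> PGL2 k).
Hypothesis lox : forall h, Gamma h -> h != 1%g -> loxodromic v h.
Hypothesis basis : group_basis Gamma gamma.

Let gen : generates gamma Gamma. Proof. by case: basis. Qed.

(** A redundant generator could be dropped, leaving fewer generators than the rank. *)
Lemma basis_irredundant (j : 'I_g) :
  ~ (forall K, subgroup K -> (forall i, i != j -> K (gamma i)) -> K (gamma j)).
Proof.
move=> /(generates_drop gen) gen'; case: basis => _ [_ /(_ _ _ gen')].
by rewrite leqNgt ltn_predL (leq_trans _ (ltn_ord j)).
Qed.

Lemma basis_neq1 i : gamma i != 1%g.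
Proof.
apply/eqP => gi; apply: (@basis_irredundant i) => K [K1 _ _] _.
by rewrite gi.
Qed.

Lemma basis_mem i : Gamma (gamma i).
Proof. by rewrite gen => K [_]; apply; exists i. Qed.

Lemma letter_negb l : letter gamma (l.1, ~~ l.2) = (letter gamma l)^-1%g.
Proof. by case: l => i []; rewrite /letter /= ?invgK. Qed.

(** A coincidence between different indices would make a generator redundant; one between a
    generator and its own inverse is excluded since loxodromic elements are not involutions. This
    lets group elements, used in the matrix and the figure, be replaced by indices. *)
Lemma letter_inj : injective (letter gamma).
Proof.
move=> [i b] [j b'] e; have [ij|ij] := eqVneq i j; last first.
  case: (@basis_irredundant j) => K [K1 KM KV] KP.
  have Ki : K (gamma i) by exact: KP.
  move: e; rewrite /letter /=; case: b; case: b' => e.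
  - by have /(congr1 (fun h => h^-1)%g) := e; rewrite !invgK => <-.
  - by rewrite -e; exact: KV.
  - by have /(congr1 (fun h => h^-1)%g) := e; rewrite invgK => <-; exact: KV.
  - by rewrite -e.
rewrite -{j}ij in e *; have [->//|bb] := eqVneq b b'.
have gV : gamma i = (gamma i)^-1%g.
  by move: e bb; rewrite /letter /=; case: b; case: b'.
have := loxodromic_not_involution (lox (basis_mem i) (basis_neq1 i)).
by rewrite {2}gV mulgV eqxx.
Qed.

Lemma letter_index_subproof (l : 'I_g * bool) : (l.1.*2 + l.2 < g.*2)%N.
Proof.
case: l => i b /=; apply: (@leq_trans i.+1.*2); last by rewrite leq_double.
by rewrite doubleS; case: b; rewrite ?addn1 ?addn0.
Qed.

Definition letter_index l : 'I_g.*2 := Ordinal (letter_index_subproof l).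

Lemma sigma_index l : sigma gamma (letter_index l) = letter gamma l.
Proof.
case: l => i b; rewrite /sigma; congr (letter gamma _).
congr pair; last by rewrite /= oddD odd_double; case: b.
by apply: val_inj; rewrite /= addnC half_bit_double.
Qed.

Lemma sigma_inj : injective (sigma gamma).
Proof.
move=> i j /letter_inj[hij oij]; apply: val_inj => /=.
by rewrite -(odd_double_half i) -(odd_double_half j) hij oij.
Qed.

Definition sigma_bar (j : 'I_g.*2) : 'I_g.*2 :=
  letter_index (half_ord j, ~~ odd j).

Lemma sigma_barE j : sigma gamma (sigma_bar j) = (sigma gamma j)^-1%g.
Proof. by rewrite sigma_index -letter_negb. Qed.

Lemma sigma_barK : involutive sigma_bar.
Proof. by move=> j; apply: sigma_inj; rewrite !sigma_barE invgK. Qed.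

End BasisLetters.

Lemma ord_avoid n (i j : 'I_n) : (2 < n)%N -> exists l : 'I_n, l != i /\ l != j.
Proof.
move=> n2; apply: contrapT => /forallNP H.
have : (#|'I_n| <= #|pred2 i j|)%N.
  apply/subset_leq_card/fintype.subsetP => l _; rewrite inE.
  by apply/negPn/negP; rewrite negb_or => /andP lij; apply: (H l).
rewrite card_ord card2 leqNgt (leq_trans _ n2)// ltnS.
by case: (i == j).
Qed.

Theorem corollary2p20 (R : realType) (k : fieldType) (v : nonarch_abs R k)
    (vcomplete : complete_abs v)
    (Gamma : set (PGL2 k)) (Gamma_schottky : schottky_group v Gamma)
    (g : nat) (Gamma_rank : group_rank Gamma g) (g_gt1 : (1 < g)%N)
    (gamma : 'I_g -> PGL2 k) (gamma_basis : group_basis Gamma gamma)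
    (D : PGL2 k -> set (P1an v)) (D_figure : schottky_figure gamma D)
    (s : R) (s_ge0 : 0 <= s) :
  hausdorff_dim (spherical_dist v) (P1_an v @^-1` limit_set Gamma) = s%:E
  <-> spectral_radius (schottky_matrix gamma D s) = 1.
Proof.
have [Gsub _ lox _] := Gamma_schottky.
have [D_disk D_disj [E EP]] := D_figure.
have [gen _] := gamma_basis.
pose S := sigma gamma; pose bar := @sigma_bar g.
have S_range j : range (letter gamma) (S j) by exists (half_ord j, odd j).
have S_inj : injective S := sigma_inj lox gamma_basis.
have barK : involutive bar := sigma_barK lox gamma_basis.
have barE j : S (bar j) = (S j)^-1%g := sigma_barE gamma j.
(* The only place where [g > 1] is used beyond positivity: there are more than two letters. *)
have avoid (i j : 'I_g.*2) : exists l, l != i /\ l != j.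
  by apply: ord_avoid; rewrite -(doubleS 0) -[(2 < _)%N]/(1.*2 < g.*2)%N
    ltn_double.
have Dd j : closed_disk (D (S j)) by exact: D_disk.
have Ddisj i j z : D (S i) z -> D (S j) z -> i = j.
  move=> zi zj; apply: contrapT => /eqP ij.
  have ne : S i != S j by apply: contra ij => /eqP/S_inj ->.
  have := D_disj _ _ (S_range i) (S_range j) ne.
  by move=> /seteqP[/(_ z) + _]; apply.
have Emax j : maximal_open_disk (E (S j)) (D (S j)) by have [] :=
  EP _ (S_range j).
have SD j : PGL2_act (S j) @` (~` D (S (bar j))) = E (S j).
  by have [_ <-] := EP _ (S_range j); rewrite barE.
have GS j : Gamma (S j).
  have Gg i : Gamma (gamma i) by rewrite gen => K [_]; apply; exists i.
  rewrite /S /sigma /letter /=; case: odd => //.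
  by case: Gsub => _ _; apply.
have Gmin H : subgroup H -> (forall j, H (S j)) -> Gamma `<=` H.
  move=> sH HS; rewrite gen; apply: smallest_sub => // _ [i _ <-].
  have := HS (letter_index (i, false)); rewrite /S sigma_index; exact.
pose M := schottky_matrix gamma D s.
have ME i j : M i j = if admissible bar i j then
    expR (- s * gap bar (D \o S) i j) else 0.
  rewrite mxE -/(S i) -/(S j) -barE (inj_eq S_inj) /admissible eq_sym.
  by case: eqP.
have M_ge0 i j : 0 <= M i j by rewrite ME; case: ifP => // _; exact: expR_ge0.
(* Any letter [l] other than [bar i] and [bar j] gives an admissible path from [i] to [l] to [j]. *)
have M2_gt0 i j : 0 < (M *m M) i j.
  have [l [li lj]] := avoid (bar i) (bar j).
  rewrite mxE (bigD1 l)//= ltr_pwDl//; last first.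
    by apply: sumr_ge0 => m _; rewrite mulr_ge0.
  rewrite !ME /admissible li (_ : j != bar l) ?mulr_gt0 ?expR_gt0//.
  by apply: contra lj => /eqP ->; rewrite barK.
have g2 : (0 < g.*2)%N by rewrite double_gt0 ltnW.
have [c [u [u0 uM]]] := perron g2 M_ge0 M2_gt0.
rewrite (spectral_radius_perron g2 M_ge0 u0 uM).
apply: (hausdorff_dim_eigen (S := S) (bar := bar) (D := D \o S) (E := E \o S)
  barK barE Dd Ddisj Emax SD Gsub GS Gmin vcomplete avoid s_ge0 u0 _ (Ordinal
    g2)).
move=> i; rewrite -uM [LHS]big_mkcond; apply: eq_bigr => j _.
by rewrite -/M ME; case: ifP => //; rewrite mul0r.
Qed.
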